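(* Let $M$ be a smooth $d$-dimensional manifold with a connection $\nabla$ on its tangent bundle (not assumed torsion-free or Levi-Civita), let $\widetilde{\mathbf X}\in\widetilde{\mathscr C}^p_\omega([0,T],M)$ be an $M$-valued simply-bracketed $p$-branched rough path with trace $X:[0,T]\to M$, and let $f$ be a smooth one-form on $M$. Then the expression $$\int f(X)\,\mathrm d_\nabla\mathbf X:=\sum_{\alpha,\boldsymbol\beta}\frac1{|\boldsymbol\beta|!}\int f_\alpha\widetilde\Gamma^\alpha_{\boldsymbol\beta}(X)\,\mathrm d\widetilde{\mathbf X}^{(\boldsymbol\beta)}$$ ($\alpha$ ranging over coordinate indices, $\boldsymbol\beta$ over non-empty tuples of coordinate indices of length at most $\lfloor p\rfloor$) does not depend on the system of local coordinates. That is: if $X([s,t])$ is contained in the domains of two charts, the integrals over $[s,t]$ computed in the two charts coincide; consequently, for arbitrary $0\le s\le t\le T$, the sum of integrals over the intervals of a partition of $[s,t]$, on each of which $X$ stays in the domain of a single chart, depends neither on the partition nor on the charts. Moreover, for every $g\in C^\infty(M)$ and $0\le s\le t\le T$, $$g(X_t)-g(X_s)=\sum_{\boldsymbol\gamma}\frac1{|\boldsymbol\gamma|!}\int_s^t\nabla_{\boldsymbol\gamma}g(X)\,\mathrm d_\nabla\widetilde{\mathbf X}^{(\boldsymbol\gamma)},\qquad\text{where}\quad\mathrm d_\nabla\widetilde{\mathbf X}^{(\boldsymbol\gamma)}:=\sum_{\boldsymbol\beta}\frac{|\boldsymbol\gamma|!}{|\boldsymbol\beta|!}\widetilde\Gamma^{\boldsymbol\gamma}_{\boldsymbol\beta}(X)\,\mathrm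 d\widetilde{\mathbf X}^{(\boldsymbol\beta)},$$ with sums over non-empty tuples of length at most $\lfloor p\rfloor$ and the integral again computed in local coordinates by patching.
   Context: **Conventions.** $p\in[1,\infty)$ and $T\ge 0$ are fixed; $\Delta_T=\{(s,t):0\le s\le t\le T\}$; $\omega$ is a fixed control: a continuous map $\omega:\Delta_T\to[0,\infty)$ with $\omega(t,t)=0$ and $\omega(s,u)+\omega(u,t)\le\omega(s,t)$ for $s\le u\le t$. For quantities depending on $s\le t$, $\approx$ means that the difference is $O(\omega(s,t)^{(\lfloor p\rfloor+1)/p})$. $[d]=\{1,\dots,d\}$, all letters of weight $1$. $\widetilde{[d]}$ is the set of non-empty finite multisets $(\gamma_1\ldots\gamma_n)$ of elements of $[d]$, with weight $n$; $[d]\subset\widetilde{[d]}$. All sums contain only terms of weight at most $\lfloor p\rfloor$. **Forests.** For an alphabet $A$ with letters $a$ of weight $|a|\in\{1,2,\dots\}$ (finitely many of each weight), $\mathcal F^A$ is the set of finite non-planar rooted forests with vertices labelled in $A$, including the empty forest $\varnothing=1$; $\mathcal T^A$ the set of (non-empty) trees. $|\mathfrak f|$ is the sum of the weights of the labels, $\ell_{\mathfrak f}(\nu)$ the label of the vertex $\nu$. The product is disjoint union. $[\mathfrak f]_a$ is the tree obtained by joining all roots of $\mathfrak f$ to a new root labelled $a$; $\bullet_a=[\varnothing]_a$; for a tuple $\boldsymbol\alpha=(\alpha_1,\dots,\alpha_n)$, $\bullet_{\boldsymbol\alpha}=\bullet_{\alpha_1}\cdots\bullet_{\alpha_n}$,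 $|\boldsymbol\alpha|=n$, $(\boldsymbol\alpha)$ is the associated multiset and $\partial_{\boldsymbol\alpha}=\partial_{\alpha_1}\cdots\partial_{\alpha_n}$. An admissible cut $C$ of a tree $\mathfrak t$ is either a set of edges such that every path from the root upwards contains at most one edge of $C$, with $\overline{\mathfrak t}_C$ the component containing the root after deleting $C$ and $\underline{\mathfrak t}_C$ the forest of the other components, or the total cut, with $\overline{\mathfrak t}_C=\varnothing$, $\underline{\mathfrak t}_C=\mathfrak t$. The Connes–Kreimer coproduct is $\Delta_{\mathrm{CK}}\mathfrak t=\sum_C\underline{\mathfrak t}_C\otimes\overline{\mathfrak t}_C$, extended multiplicatively; $\Delta_{\mathrm{CK}}\mathfrak f=\sum_{(\mathfrak f)_{\mathrm{CK}}}\mathfrak f_{(1)}\otimes\mathfrak f_{(2)}$. For a vertex $\nu$ of $\mathfrak g$, $\mathfrak f\curvearrowright_\nu\mathfrak g$ is obtained by joining every root of $\mathfrak f$ to $\nu$; $\mathfrak f\curvearrowright_-\mathfrak g=\mathfrak f\mathfrak g$; extended linearly in $\mathfrak f$. $\ast\{\mathfrak t;(a^\nu,\mathfrak h^\nu)^{\nu\in\mathfrak t}\}$ is obtained from $\mathfrak t$ by relabelling each vertex $\nu$ with $a^\nu$ and joining all roots of the forest $\mathfrak h^\nu$ to $\nu$. **Branched rough paths.** A $p$-branched rough path over $A$ is a family of continuous maps $\mathbf X^{\mathfrak f}:\Delta_T\to\mathbb R$, $\mathfrak f\in\mathcal F^A$, $|\mathfrak f|\le\lfloor p\rfloor$, with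 $\mathbf X^\varnothing\equiv1$, $|\mathbf X^{\mathfrak f}_{st}|=O(\omega(s,t)^{|\mathfrak f|/p})$, $\mathbf X^{\mathfrak f}_{st}=\sum_{(\mathfrak f)_{\mathrm{CK}}}\mathbf X^{\mathfrak f_{(1)}}_{su}\mathbf X^{\mathfrak f_{(2)}}_{ut}$ for $s\le u\le t$, and $\mathbf X^{\mathfrak f\mathfrak g}=\mathbf X^{\mathfrak f}\mathbf X^{\mathfrak g}$ if $|\mathfrak f|+|\mathfrak g|\le\lfloor p\rfloor$; $\langle x,\mathbf X_{st}\rangle$ is the linear extension. Its trace is a path $X$ with $X^a_t-X^a_s=\mathbf X^{\bullet_a}_{st}$ (an initial value being fixed). $[0,T]$ may be replaced by any interval. An almost rough path satisfies the same conditions except that multiplicativity only holds with $\approx$; there is a unique branched rough path close to it, i.e. differing by $\approx$ in each component. **Simple bracket extensions.** For $a_1,\dots,a_n\in[d]$ put $\langle\!\langle a_1\ldots a_n\rangle\!\rangle=\bullet_{a_1}\cdots\bullet_{a_n}-\sum_{I\sqcup J=\{1,\dots,n\},\,I,J\ne\varnothing}[\prod_{i\in I}\bullet_{a_i}]_{(a_j)_{j\in J}}$. $\widetilde{\mathscr C}^p_\omega([0,T],\mathbb R^d)$ is the set of consistent simple bracket extensions, i.e. $p$-branched rough paths $\widetilde{\mathbf X}$ over $\widetilde{[d]}$ such that $\langle\bullet_{(a_1\ldots a_n)}\curvearrowright_\nu\mathfrak g,\widetilde{\mathbf X}\rangle=\langle\langle\!\langle a_1\ldots a_n\rangle\!\rangle\curvearrowright_\nu\mathfrak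 g,\widetilde{\mathbf X}\rangle$ for all $a_i\in[d]$, $\mathfrak g\in\mathcal F^{\widetilde{[d]}}$ and $\nu\in\mathfrak g$ or $\nu=-$; its (non-bracket) trace is $X=(X^1,\dots,X^d)$. **Integrals.** For $\widetilde{\mathbf X}\in\widetilde{\mathscr C}^p_\omega([0,T],\mathbb R^d)$ and smooth functions $\varphi_c$, $c\in\widetilde{[d]}$, on an open set containing the trace, the rough integral $\int_s^t\varphi_c(X)\,\mathrm d\widetilde{\mathbf X}^c$ (sum over $c$) is the limit over partitions of $[s,t]$ with vanishing mesh of $\sum_{[u,v]}\sum_{c,\boldsymbol\alpha}\frac1{|\boldsymbol\alpha|!}\partial_{\boldsymbol\alpha}\varphi_c(X_u)\widetilde{\mathbf X}^{[\bullet_{\boldsymbol\alpha}]_c}_{uv}$, over $c\in\widetilde{[d]}$ and possibly empty tuples $\boldsymbol\alpha$ in $[d]$ with $|\boldsymbol\alpha|+|c|\le\lfloor p\rfloor$. Sums over tuples $\boldsymbol\beta$ of integrals against $\mathrm d\widetilde{\mathbf X}^{(\boldsymbol\beta)}$ are interpreted accordingly. **Pushforward.** For $h$ a smooth $\mathbb R^e$-valued map on an open set containing the trace of $\widetilde{\mathbf X}\in\widetilde{\mathscr C}^p_\omega([0,T],\mathbb R^d)$, let $\Phi^{(k_1\ldots k_m)}_c=\sum\prod_{i=1}^m\frac1{|\boldsymbol\gamma^i|!}\partial_{\boldsymbol\gamma^i}h^{k_i}$, over non-empty tuples $\boldsymbol\gamma^1,\dots,\boldsymbol\gamma^m$ in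 $[d]$ whose concatenation has multiset $c\in\widetilde{[d]}$. Then $h_*\widetilde{\mathbf X}$ is the unique $p$-branched rough path over $\widetilde{[e]}$ close to the almost rough path with component on $\mathfrak t\in\mathcal T^{\widetilde{[e]}}$ equal to $$\sum_{(\boldsymbol\alpha^\nu,c^\nu)_{\nu\in\mathfrak t}}\Big(\prod_{\nu\in\mathfrak t}\tfrac{1}{|\boldsymbol\alpha^\nu|!}\,\partial_{\boldsymbol\alpha^\nu}\Phi^{\ell_{\mathfrak t}(\nu)}_{c^\nu}(X_s)\Big)\big\langle\ast\{\mathfrak t;(c^\nu,\bullet_{\boldsymbol\alpha^\nu})^{\nu\in\mathfrak t}\},\widetilde{\mathbf X}_{st}\big\rangle$$ (possibly empty tuples $\boldsymbol\alpha^\nu$ in $[d]$, $c^\nu\in\widetilde{[d]}$), extended multiplicatively to forests; its trace on $[e]$ is $h(X)$. **$M$-valued rough paths.** Charts are parametrisations $\varphi:U\to M$, $U\subset\mathbb R^d$ open. An element of $\widetilde{\mathscr C}^p_\omega([0,T],M)$ is, relative to an atlas, a collection of ${}^{\imath}\widetilde{\mathbf X}\in\widetilde{\mathscr C}^p_\omega([s_\imath,t_\imath],\mathbb R^d)$ whose intervals cover $[0,T]$, each with trace ${}^\imath X$ in the domain $U_\imath$ of a chart $\varphi_\imath$, such that $(\varphi_\jmath^{-1}\circ\varphi_\imath)_*{}^{\imath}\widetilde{\mathbf X}={}^{\jmath}\widetilde{\mathbf X}$ on $[s_\imath,t_\imath]\cap[s_\jmath,t_\jmath]$ whenever the open intervals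 intersect. The trace is $X_t=\varphi_\imath({}^\imath X_t)$. By functoriality of pushforwards the collection extends compatibly to the maximal atlas, so that $\widetilde{\mathbf X}$ has a local expression in any chart on any interval on which $X$ stays in the image of that chart; $\mathrm d\widetilde{\mathbf X}^{(\boldsymbol\beta)}$ refers to this local expression. **Connection and transfer symbols.** $\nabla_{\partial_\alpha}\partial_\beta=\Gamma^\gamma_{\alpha\beta}\partial_\gamma$. $\nabla^ng$ is the iterated covariant derivative of $g$, the direction of the most recent differentiation occupying the first slot; in a chart $\nabla_{\boldsymbol\gamma}g=\langle\nabla^ng,\partial_{\gamma_1}\otimes\cdots\otimes\partial_{\gamma_n}\rangle$ for $\boldsymbol\gamma=(\gamma_1,\dots,\gamma_n)$, i.e. $\nabla_{\gamma_1\ldots\gamma_n}g=\partial_{\gamma_1}\nabla_{\gamma_2\ldots\gamma_n}g-\sum_{k=2}^n\Gamma^\alpha_{\gamma_1\gamma_k}\nabla_{\gamma_2\ldots\gamma_{k-1}\alpha\gamma_{k+1}\ldots\gamma_n}g$. In a chart the transfer symbols $\widetilde\Gamma^{\boldsymbol\beta}_{\boldsymbol\alpha}$ (non-empty tuples of length at most $\lfloor p\rfloor$) are the unique smooth functions, symmetric in the upper tuple and symmetric in the lower tuple, with $\partial_{\boldsymbol\alpha}g=\sum_{\boldsymbol\beta}\widetilde\Gamma^{\boldsymbol\beta}_{\boldsymbol\alpha}\nabla_{\boldsymbol\beta}g$ for all $g\in C^\infty(M)$ and all $\boldsymbol\alpha$. $f_\alpha=\langle f,\partial_\alpha\rangle$.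 *)

(* Defs.v *)
From HB Require Import structures.
From mathcomp Require Import all_boot all_order all_algebra.
From mathcomp Require Import finmap multiset.
From mathcomp Require Import all_classical all_reals all_analysis.
Import Order.TTheory GRing.Theory Num.Theory.
Import numFieldNormedType.Exports.

Set Implicit Arguments.
Unset Strict Implicit.
Unset Printing Implicit Defensive.

Local Open Scope mset_scope.
Local Open Scope classical_set_scope.
Local Open Scope ring_scope.

(* Smooth functions on open subsets of R^d *)

Section Words.
Context {T : Type}.

Fixpoint words (s : seq T) (n : nat) : seq (seq T) :=
  if n is n'.+1 then [seq x :: w | x <- s, w <- words s n'] else [:: [::]].

Definition words_le (s : seq T) (n : nat) : seq (seq T) :=
  flatten [seq words s k | k <- iota 0 n.+1].

Definition newords_le (s : seq T) (n : nat) : seq (seq T) :=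
  flatten [seq words s k | k <- iota 1 n].

(* All (I, J) with I \sqcup J the set of positions of s, each position set
   being represented by the corresponding subsequence of s. *)
Fixpoint splits (s : seq T) : seq (seq T * seq T) :=
  if s is x :: s' then
    flatten [seq [:: (x :: IJ.1, IJ.2); (IJ.1, x :: IJ.2)] | IJ <- splits s']
  else [:: ([::], [::])].

End Words.

Section Smooth.
Context {R : realType} {d : nat}.
Implicit Types (U : set 'rV[R]_d) (f : 'rV[R]_d -> R).

Definition pd (i : 'I_d) f : 'rV[R]_d -> R := fun x => 'D_(delta_mx 0 i) f x.

Definition pds (w : seq 'I_d) f : 'rV[R]_d -> R := foldr pd f w.

(* Only used for open U. *)
Definition smooth_on U f : Prop := forall (w : seq 'I_d) x, U x ->
  {for x, continuous (pds w f)} /\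
  forall i, derivable (pds w f) x (delta_mx 0 i).

Definition smooth_map_on {e : nat} U (h : 'rV[R]_d -> 'rV[R]_e) : Prop :=
  forall k, smooth_on U (fun x => h x 0 k).

End Smooth.

(* Forests.  [tree] and [seq tree] are planar representatives; non-planar
   forests are the classes of [iso_forest], and a function on non-planar
   forests is a function on representatives that is constant on classes. *)

Inductive tree (A : Type) : Type := Node of A & seq (tree A).
Notation forest A := (seq (tree A)).

Inductive iso_forest {A : Type} : forest A -> forest A -> Prop :=
| iso_nil : iso_forest [::] [::]
| iso_node a f f' g g' : iso_forest f f' -> iso_forest g g' ->
    iso_forest (Node a f :: g) (Node a f' :: g')
| iso_swap t u g : iso_forest (t :: u :: g) (u :: t :: g)
| iso_trans f g h : iso_forest f g -> iso_forest g h -> iso_forest f h.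

Section Forests.
Context {A : Type}.
Implicit Types (t : tree A) (f g : forest A).

Fixpoint twt (wt : A -> nat) t : nat :=
  let: Node a f := t in (wt a + sumn [seq twt wt u | u <- f])%N.

Definition fwt (wt : A -> nat) f : nat := sumn [seq twt wt t | t <- f].

Definition bullet (a : A) : tree A := Node a [::].

(* Pairs (pruned forest, part containing the root), one for each admissible
   cut: the total cut, or independently for each child of the root a cut of
   the subtree at that child, whose total cut amounts to cutting the edge
   below the child. *)
Fixpoint tcuts t : seq (forest A * forest A) :=
  let: Node a f := t in
  ([:: t], [::]) ::
  [seq (q.1, [:: Node a q.2]) | q <-
    foldr (fun u acc => [seq (x.1 ++ y.1, x.2 ++ y.2) | x <- tcuts u, y <- acc])
          [:: ([::], [::])] f].

Definition fcuts f : seq (forest A * forest A) :=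
  foldr (fun u acc => [seq (x.1 ++ y.1, x.2 ++ y.2) | x <- tcuts u, y <- acc])
        [:: ([::], [::])] f.

(* A position of g is [::] (written "-" in f \curvearrowright_- g) or the
   address i :: i' :: ... of a vertex: the i-th root, its i'-th child, etc. *)
Fixpoint is_pos g (nu : seq nat) : bool :=
  if nu is i :: nu' then
    if drop i g is Node _ h :: _ then is_pos h nu' else false
  else true.

Fixpoint graft f g (nu : seq nat) : forest A :=
  if nu is i :: nu' then
    if drop i g is Node a h :: g' then take i g ++ Node a (graft f h nu') :: g'
    else g
  else f ++ g.

End Forests.

(* Non-empty finite multisets of indices *)

Definition letter (d : nat) : Type := {c : {mset 'I_d} | c != mset0}.

Lemma seq_mset_cons_neq0 d (a : 'I_d) (w : seq 'I_d) :
  seq_mset (a :: w) != mset0.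
Proof.
apply/eqP => /(congr1 (fun A : {mset 'I_d} => A a)).
by rewrite mset0E mset_seqE /= eqxx.
Qed.

Section Letters.
Context {d : nat}.

Definition lwt (c : letter d) : nat := size (enum_mset (val c)).

Definition letter_of (a : 'I_d) (w : seq 'I_d) : letter d :=
  exist _ (seq_mset (a :: w)) (seq_mset_cons_neq0 a w).

Definition letter1 (a : 'I_d) : letter d := letter_of a [::].

Definition letters_le (n : nat) : seq (letter d) :=
  undup [seq letter_of a w | a <- enum 'I_d,
    w <- flatten [seq words (enum 'I_d) k | k <- iota 0 n]].

Definition bullets (w : seq 'I_d) : forest (letter d) :=
  [seq bullet (letter1 a) | a <- w].

(* <<a w>> as a formal linear combination of forests. *)
Definition bracket {R : realType} (a : 'I_d) (w : seq 'I_d) :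
    seq (R * forest (letter d)) :=
  (1, bullets (a :: w)) ::
  flatten [seq (if (IJ.1, IJ.2) is (_ :: _, j :: J)
                then [:: (-1, [:: Node (letter_of j J) (bullets IJ.1)])]
                else [::])
          | IJ <- splits (a :: w)].

End Letters.

(* Rough paths.  The level is [Num.truncn p], the integer part of p;
   components of larger weight are junk values that nothing depends on. *)

Notation rpfam R A := (forest A -> R -> R -> R).

Section RoughPaths.
Context {R : realType}.
Implicit Types (p a b T : R) (omega : R -> R -> R).

Definition simplex a b : set (R * R) :=
  [set st | [/\ a <= st.1, st.1 <= st.2 & st.2 <= b]].

Definition control T omega : Prop :=
  [/\ {within simplex 0 T, continuous (fun st : R * R => omega st.1 st.2)},
      forall s t, simplex 0 T (s, t) -> 0 <= omega s t,
      forall t, 0 <= t <= T -> omega t t = 0 &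
      forall s u t, 0 <= s -> s <= u -> u <= t -> t <= T ->
        omega s u + omega u t <= omega s t].

(* F = O(omega ^ r) on the simplex over [a, b] *)
Definition bigO_control omega a b (F : R -> R -> R) (r : R) : Prop :=
  exists C : R, forall s t, simplex a b (s, t) ->
    `|F s t| <= C * omega s t `^ r.

Definition branched_rp {A : Type} (wt : A -> nat) p omega a b (X : rpfam R A)
    : Prop :=
  let N := Num.truncn p in
  [/\ forall f g s t, (fwt wt f <= N)%N -> iso_forest f g ->
        simplex a b (s, t) -> X f s t = X g s t,
      forall f, (fwt wt f <= N)%N ->
        {within simplex a b, continuous (fun st : R * R => X f st.1 st.2)} /\
        bigO_control omega a b (X f) ((fwt wt f)%:R / p),
      forall s t, simplex a b (s, t) -> X [::] s t = 1,
      forall f s u t, (fwt wt f <= N)%N -> a <= s -> s <= u -> u <= t -> t <= b ->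
        X f s t = \sum_(q <- fcuts f) X q.1 s u * X q.2 u t &
      forall f g s t, (fwt wt f + fwt wt g <= N)%N -> simplex a b (s, t) ->
        X (f ++ g) s t = X f s t * X g s t].

Definition close_rp {A : Type} (wt : A -> nat) p omega a b (X Y : rpfam R A)
    : Prop :=
  forall f, (fwt wt f <= Num.truncn p)%N ->
    bigO_control omega a b (fun s t => X f s t - Y f s t)
      ((Num.truncn p).+1%:R / p).

(* A bracketed rough path together with its non-bracket trace. *)
Record srp (d : nat) := Srp {
  srp_comp :> rpfam R (letter d);
  srp_trace : R -> 'rV[R]_d }.

Definition consistent {d : nat} p a b (X : rpfam R (letter d)) : Prop :=
  forall (i : 'I_d) (w : seq 'I_d) (g : forest (letter d)) (nu : seq nat),
    is_pos g nu -> (size (i :: w) + fwt lwt g <= Num.truncn p)%N ->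
    forall s t, simplex a b (s, t) ->
      X (graft [:: bullet (letter_of i w)] g nu) s t =
      \sum_(q <- bracket i w) q.1 * X (graft q.2 g nu) s t.

Definition simple_brp {d : nat} p omega a b (X : srp d) : Prop :=
  [/\ branched_rp lwt p omega a b X,
      consistent p a b X &
      forall (i : 'I_d) s t, simplex a b (s, t) ->
        srp_trace X t 0 i - srp_trace X s 0 i = X [:: bullet (letter1 i)] s t].

(* I is the rough integral over [s, t] of phi_c(X) against dX^c, summed over
   c; zip (s :: l) l lists the intervals of the partition. *)
Definition riemann_term {d : nat} p (X : srp d)
    (phi : letter d -> 'rV[R]_d -> R) (u v : R) : R :=
  \sum_(c <- letters_le (Num.truncn p))
  \sum_(w <- words_le (enum 'I_d) (Num.truncn p)
        | (size w + lwt c <= Num.truncn p)%N)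
    (size w)`!%:R^-1 * pds w (phi c) (srp_trace X u)
      * X [:: Node c (bullets w)] u v.

Definition rough_integral {d : nat} p (X : srp d)
    (phi : letter d -> 'rV[R]_d -> R) (s t I : R) : Prop :=
  forall eps : R, 0 < eps -> exists2 delta : R, 0 < delta &
    forall l : seq R, itv_partition s t l ->
      all (fun uv => uv.2 - uv.1 < delta) (zip (s :: l) l) ->
      `|\sum_(uv <- zip (s :: l) l) riemann_term p X phi uv.1 uv.2 - I| < eps.

End RoughPaths.

Arguments srp : clear implicits.

(* Pushforward under h *)

Section Pushforward.
Context {R : realType} {d e : nat}.
Variable h : 'rV[R]_d -> 'rV[R]_e.

Definition Phi (ks : seq 'I_e) (c : letter d) (x : 'rV[R]_d) : R :=
  \sum_(g <- words (newords_le (enum 'I_d) (lwt c)) (size ks)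
        | seq_mset (flatten g) == val c)
    \prod_(kg <- zip ks g)
      ((size kg.2)`!%:R^-1 * pds kg.2 (fun y => h y 0 kg.1) x).

(* Formal linear combination, with coefficients evaluated at x, of the trees
   *{t; (c^nu, bullet_{alpha^nu})}; the enumeration of the label of nu as a
   sequence is immaterial. *)
Fixpoint push_tree (N : nat) (x : 'rV[R]_d) (t : tree (letter e)) :
    seq (R * tree (letter d)) :=
  let: Node k f := t in
  let subs : seq (R * forest (letter d)) :=
    foldr (fun u acc => [seq (y.1 * z.1, y.2 :: z.2) | y <- push_tree N x u,
                                                       z <- acc])
          [:: (1, [::])] f in
  flatten [seq [seq ((size w)`!%:R^-1 * pds w (Phi (enum_mset (val k)) c) x
                       * q.1,
                     Node c (bullets w ++ q.2))
               | w <- words_le (enum 'I_d) N, q <- subs]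
          | c <- letters_le N].

Definition push_almost (p : R) (X : srp R d) : rpfam R (letter e) :=
  fun f s t => \prod_(tau <- f)
    \sum_(q <- push_tree (Num.truncn p) (srp_trace X s) tau
          | (twt lwt q.2 <= Num.truncn p)%N) q.1 * X [:: q.2] s t.

Definition is_pushforward (p : R) omega a b (X : srp R d) (Y : srp R e) : Prop :=
  [/\ branched_rp lwt p omega a b Y,
      close_rp lwt p omega a b Y (push_almost p X) &
      forall u, a <= u <= b -> srp_trace Y u = h (srp_trace X u)].

End Pushforward.

(* Smooth manifolds.  Charts are parametrisations cpar : cdom -> M; cinv is
   the inverse, meaningful on the image of cpar only. *)

Record chart (R : realType) (d : nat) (M : topologicalType) := Chart {
  cdom : set 'rV[R]_d;
  cpar : 'rV[R]_d -> M;
  cinv : M -> 'rV[R]_d }.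

Section Charts.
Context {R : realType} {d : nat} {M : topologicalType}.
Implicit Types c : chart R d M.

Definition cim c : set M := cpar c @` cdom c.

Definition is_chart c : Prop :=
  [/\ open (cdom c), open (cim c),
      forall x, cdom c x -> cinv c (cpar c x) = x,
      {within cdom c, continuous (cpar c)} &
      {within cim c, continuous (cinv c)}].

Definition transition c c' : 'rV[R]_d -> 'rV[R]_d := cinv c' \o cpar c.

Definition compatible c c' : Prop :=
  smooth_map_on (cdom c `&` cpar c @^-1` cim c') (transition c c') /\
  smooth_map_on (cdom c' `&` cpar c' @^-1` cim c) (transition c' c).

End Charts.

Record manifold (R : realType) (d : nat) := Manifold {
  carrier :> topologicalType;
  atlas : set (chart R d carrier);
  manifold_hausdorff : hausdorff_space carrier;
  manifold_countable : @second_countable carrier;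
  atlas_chart : forall c, atlas c -> is_chart c;
  atlas_cover : forall m : carrier, exists2 c, atlas c & cim c m;
  atlas_compatible : forall c c', atlas c -> atlas c' -> compatible c c' }.

Arguments atlas {R d} _.

Section DiffGeom.
Context {R : realType} {d : nat} {M : manifold R d}.
Implicit Types (c : chart R d M) (m : M) (W : set M) (g : M -> R).

(* Charts of the maximal atlas. *)
Definition smooth_chart c : Prop :=
  is_chart c /\ forall c', atlas M c' -> compatible c c'.

(* Only used for open W. *)
Definition smooth_fun W g : Prop := forall c, smooth_chart c ->
  smooth_on (cdom c `&` cpar c @^-1` W) (g \o cpar c).

Definition smooth_near m g : Prop :=
  exists W, [/\ open W, W m & smooth_fun W g].

(* Tangent vectors at m are derivations of the functions that are smooth near
   m; they are given the value 0 on all other functions, so that equality of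
   tangent vectors is equality of functions. *)
Definition tvec : Type := (M -> R) -> R.

Definition cvec c (i : 'I_d) m : tvec := fun g =>
  if `[< smooth_near m g >] then pd i (g \o cpar c) (cinv c m) else 0.

Definition tangent m : set tvec := [set v | exists c,
  [/\ smooth_chart c, cim c m &
      exists a : 'I_d -> R, v = fun g => \sum_i a i * cvec c i m g]].

Definition smooth_vf W (Y : M -> tvec) : Prop :=
  (forall m, W m -> tangent m (Y m)) /\
  (forall W' g, open W' -> W' `<=` W -> smooth_fun W' g ->
     smooth_fun W' (fun m => Y m g)).

Definition smooth_vf_near m (Y : M -> tvec) : Prop :=
  exists W, [/\ open W, W m & smooth_vf W Y].

(* nabla m v Y is the covariant derivative at m of Y in the direction v, for
   v in the tangent space at m and Y a vector field smooth near m. *)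
Record is_connection (nabla : M -> tvec -> (M -> tvec) -> tvec) : Prop := {
  conn_tangent : forall m v Y, tangent m v -> smooth_vf_near m Y ->
    tangent m (nabla m v Y);
  conn_linear : forall m (a : R) v w Y, tangent m v -> tangent m w ->
    smooth_vf_near m Y ->
    nabla m (fun g => a * v g + w g) Y =
      fun g => a * nabla m v Y g + nabla m w Y g;
  conn_add : forall m v Y Z, tangent m v ->
    smooth_vf_near m Y -> smooth_vf_near m Z ->
    nabla m v (fun n g => Y n g + Z n g) =
      fun g => nabla m v Y g + nabla m v Z g;
  conn_leibniz : forall m v (k : M -> R) Y, tangent m v ->
    smooth_near m k -> smooth_vf_near m Y ->
    nabla m v (fun n g => k n * Y n g) =
      fun g => v k * Y m g + k m * nabla m v Y g;
  conn_local : forall m v Y Z W, tangent m v -> open W -> W m ->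
    smooth_vf W Y -> (forall n, W n -> Y n = Z n) ->
    nabla m v Y = nabla m v Z;
  conn_smooth : forall W V Y, open W -> smooth_vf W V -> smooth_vf W Y ->
    smooth_vf W (fun m => nabla m (V m) Y) }.

Definition form_coord (f : M -> tvec -> R) c (i : 'I_d) (x : 'rV[R]_d) : R :=
  f (cpar c x) (cvec c i (cpar c x)).

Record is_one_form (f : M -> tvec -> R) : Prop := {
  form_linear : forall m (a : R) v w, tangent m v -> tangent m w ->
    f m (fun g => a * v g + w g) = a * f m v + f m w;
  form_smooth : forall c i, smooth_chart c ->
    smooth_on (cdom c) (form_coord f c i) }.

Section Connection.
Variable nabla : M -> tvec -> (M -> tvec) -> tvec.

(* christoffel c i j k = Gamma^k_{i j}: the k-th component of a tangent vector
   is its value on the k-th coordinate function. *)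
Definition christoffel c (i j k : 'I_d) (x : 'rV[R]_d) : R :=
  nabla (cpar c x) (cvec c i (cpar c x)) (cvec c j) (fun m => cinv c m 0 k).

(* Iterated covariant derivatives of g along tuples of length n. *)
Fixpoint covd_rec c g (n : nat) : seq 'I_d -> 'rV[R]_d -> R :=
  match n with
  | 0%N => fun _ => g \o cpar c
  | n'.+1 => fun w x =>
      if w is i :: w' then
        pd i (covd_rec c g n' w') x
        - \sum_(k < n') \sum_(j < d)
            christoffel c i (nth i w' k) j x
            * covd_rec c g n' (set_nth i w' k j) x
      else 0
  end.

Definition covd c g (w : seq 'I_d) : 'rV[R]_d -> R := covd_rec c g (size w) w.

(* The arguments of a transfer symbol are the upper tuple, the lower tuple
   and the point. *)
Definition is_transfer (N : nat) c (G : seq 'I_d -> seq 'I_d -> 'rV[R]_d -> R)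
    : Prop :=
  let W := newords_le (enum 'I_d) N in
  [/\ forall b a, b \in W -> a \in W -> smooth_on (cdom c) (G b a),
      forall b b' a x, b \in W -> a \in W -> cdom c x -> perm_eq b b' ->
        G b a x = G b' a x,
      forall b a a' x, b \in W -> a \in W -> cdom c x -> perm_eq a a' ->
        G b a x = G b a' x &
      forall g a x, smooth_fun setT g -> a \in W -> cdom c x ->
        pds a (g \o cpar c) x = \sum_(b <- W) G b a x * covd c g b x].

Definition transfer (N : nat) c : seq 'I_d -> seq 'I_d -> 'rV[R]_d -> R :=
  get [set G | is_transfer N c G].

(* Integrands whose rough integrals are the integral of f against d_nabla X
   and that of nabla_gamma g against d_nabla X^(gamma): the coefficient of dX^l
   is the sum of the coefficients of dX^(beta) over the tuples beta with
   multiset (beta) = l. *)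
Definition form_integrand (N : nat) (f : M -> tvec -> R) c (l : letter d)
    (x : 'rV[R]_d) : R :=
  \sum_(b <- newords_le (enum 'I_d) N | seq_mset b == val l)
    (size b)`!%:R^-1 *
    \sum_(i < d) form_coord f c i x * transfer N c [:: i] b x.

Definition ito_integrand (N : nat) g c (gam : seq 'I_d) (l : letter d)
    (x : 'rV[R]_d) : R :=
  covd c g gam x *
  \sum_(b <- newords_le (enum 'I_d) N | seq_mset b == val l)
    ((size gam)`!%:R / (size b)`!%:R) * transfer N c gam b x.

Definition form_integral (p : R) (f : M -> tvec -> R) c (Y : srp R d)
    (s t I : R) : Prop :=
  rough_integral p Y (form_integrand (Num.truncn p) f c) s t I.

Definition ito_integral (p : R) g c (Y : srp R d) (s t I : R) : Prop :=
  exists J : seq 'I_d -> R,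
    (forall gam, gam \in newords_le (enum 'I_d) (Num.truncn p) ->
       rough_integral p Y (ito_integrand (Num.truncn p) g c gam) s t (J gam)) /\
    I = \sum_(gam <- newords_le (enum 'I_d) (Num.truncn p))
          (size gam)`!%:R^-1 * J gam.

End Connection.

(* Manifold-valued rough paths *)

Record mrp := Mrp {
  mrp_idx : Type;
  mrp_lo : mrp_idx -> R;
  mrp_hi : mrp_idx -> R;
  mrp_chart : mrp_idx -> chart R d M;
  mrp_rp : mrp_idx -> srp R d;
  mrp_trace : R -> M }.

Arguments mrp_lo : clear implicits.
Arguments mrp_hi : clear implicits.
Arguments mrp_chart : clear implicits.
Arguments mrp_rp : clear implicits.

(* The cover of [0, T] by the closed intervals is required to have a finite
   subcover; without this, a cover by one-point intervals would carry no
   information. *)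
Record is_mrp (p T : R) (omega : R -> R -> R) (X : mrp) : Prop := {
  mrp_itv : forall i, [/\ 0 <= mrp_lo X i, mrp_lo X i <= mrp_hi X i
                        & mrp_hi X i <= T];
  mrp_cover : exists (n : nat) (idx : 'I_n -> mrp_idx X),
    forall t, 0 <= t <= T -> exists k, mrp_lo X (idx k) <= t <= mrp_hi X (idx k);
  mrp_charts : forall i, smooth_chart (mrp_chart X i);
  mrp_simple : forall i,
    simple_brp p omega (mrp_lo X i) (mrp_hi X i) (mrp_rp X i);
  mrp_traceE : forall i t, mrp_lo X i <= t <= mrp_hi X i ->
    cdom (mrp_chart X i) (srp_trace (mrp_rp X i) t) /\
    cpar (mrp_chart X i) (srp_trace (mrp_rp X i) t) = mrp_trace X t;
  mrp_compatible : forall i j,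
    let lo := Num.max (mrp_lo X i) (mrp_lo X j) in
    let hi := Num.min (mrp_hi X i) (mrp_hi X j) in
    lo < hi ->
    is_pushforward (transition (mrp_chart X i) (mrp_chart X j)) p omega lo hi
      (mrp_rp X i) (mrp_rp X j) }.

(* Y is the local expression of X in the chart c on the interval [s, t]. *)
Record local_expr (p : R) (omega : R -> R -> R) (X : mrp) c (s t : R)
    (Y : srp R d) : Prop := {
  local_chart : smooth_chart c;
  local_simple : simple_brp p omega s t Y;
  local_trace : forall u, s <= u <= t ->
    cdom c (srp_trace Y u) /\ cpar c (srp_trace Y u) = mrp_trace X u;
  local_compatible : forall i,
    let lo := Num.max s (mrp_lo X i) in
    let hi := Num.min t (mrp_hi X i) in
    lo < hi ->
    is_pushforward (transition (mrp_chart X i) c) p omega lo hi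
      (mrp_rp X i) Y }.

(* A partition of [s, t] with, on its k-th interval, a chart containing the
   trace and the local expression in it. *)
Record patching := Patching {
  pt_pts : seq R;
  pt_chart : nat -> chart R d M;
  pt_rp : nat -> srp R d }.

Definition patching_of (p : R) omega (X : mrp) (s t : R) (P : patching)
    : Prop :=
  itv_partition s t (pt_pts P) /\
  forall k, (k < size (pt_pts P))%N ->
    local_expr p omega X (pt_chart P k)
      (nth s (s :: pt_pts P) k) (nth s (pt_pts P) k) (pt_rp P k).

(* I is the integral over [s, t] computed by patching, for the local integral
   loc: patchings exist, and for each of them the integrals over the
   intervals of the partition exist and add up to I. *)
Definition patched_integral (p : R) omega (X : mrp)
    (loc : chart R d M -> srp R d -> R -> R -> R -> Prop) (s t I : R) : Prop :=
  (exists P, patching_of p omega X s t P) /\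
  forall P, patching_of p omega X s t P -> exists J : nat -> R,
    (forall k, (k < size (pt_pts P))%N ->
       loc (pt_chart P k) (pt_rp P k)
         (nth s (s :: pt_pts P) k) (nth s (pt_pts P) k) (J k)) /\
    \sum_(k < size (pt_pts P)) J k = I.

End DiffGeom.
Arguments mrp_lo {R d M} X _ : rename.
Arguments mrp_hi {R d M} X _ : rename.
Arguments mrp_chart {R d M} X _ : rename.
Arguments mrp_rp {R d M} X _ : rename.
Arguments tvec {R d} M.
Arguments mrp {R d} M.

(* Main.v *)
(* For a point m and a covector f_m, there is a smooth function g with dg(m) = f_m whose
   iterated covariant derivatives of order at least two have vanishing symmetric parts at
   m.  Covariant derivatives being tensors, this property does not depend on the chart, and
   it makes the integrand of the form at m the integrand of the Ito formula of g: in every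
   chart, sum_alpha f_alpha Gamma^alpha_beta = d_beta g at m.  The change of the integrand
   under a transition map is thereby that of the Ito integrand, i.e. the pullback that
   corresponds to the pushforward of rough paths, and the local integrals over an interval
   coincide.

   All rough integrals are handled through paths J whose increments differ from the
   Riemann term by O(omega^theta), theta > 1.  Such paths exist by sewing, the Riemann term
   being almost additive by Chen's relation and Taylor's formula, and they are unique up to
   constants; the Ito formula, the invariance under pushforward and the concatenation of
   intervals are thus estimates for single Riemann terms. *)
Require Import Defs.
From HB Require Import structures.
From mathcomp Require Import all_boot all_order all_algebra.
From mathcomp Require Import finmap multiset zify ring lra.
From mathcomp Require Import all_classical all_reals all_analysis.
Import Order.TTheory GRing.Theory Num.Theory.
Import numFieldNormedType.Exports.
Local Open Scope classical_set_scope.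
Local Open Scope ring_scope.

Set Implicit Arguments.
Unset Strict Implicit.
Unset Printing Implicit Defensive.

(** * Smooth functions *)

(** Transfer symbols are symmetric in the upper tuple, so the expansion of an ordinary derivative of
    g in covariant ones only sees symmetric parts; for an adapted g the first-order terms f_alpha
    Gamma^alpha_beta alone survive. With torsion or curvature the covariant derivatives are not
    symmetric, and in general only their symmetric parts can be made to vanish. The function g
    varies with the point, while Riemann terms differentiate the integrand. This is harmless: the
    change of the integrand is an identity between functions, checked one point at a time. The
    combinatorics of the pushforward is handled by jets, the Taylor coefficients of a function
    paired with a functional on words. The bracket relation writes a product of bullets as a sum
    over splittings, so that a double sum over letters and tuples collapses to a sum over words.
    Composition with a map is computed by substituting a Taylor polynomial, whose remainder has
    vanishing jet. Taking the indicator of a multiset as functional, the same substitution gives the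
    change of the Ito integrand. The exponent is theta = (floor p + 1) / p, which exceeds 1. *)

Lemma cvg_sumr {R : realType} {T : Type} {F : set_system T} {FF : Filter F} {I : Type}
    (r : seq I) (P : pred I) (f : I -> T -> R) (l : I -> R) :
  (forall i, P i -> f i @ F --> l i) ->
  (fun x => \sum_(i <- r | P i) f i x) @ F --> \sum_(i <- r | P i) l i.
Proof.
move=> H; elim: r => [|i r IH].
  rewrite big_nil [X in X @ _](_ : _ = cst 0); first exact: cvg_cst.
  by apply/funext => x; rewrite big_nil.
rewrite big_cons [X in X @ _](_ : _ =
  fun x => (if P i then f i x else 0) + \sum_(i <- r | P i) f i x); last first.
  by apply/funext => x; rewrite big_cons; case: ifP; rewrite ?add0r.
case: ifP => Pi; first by apply: cvgD => //; exact: H.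
rewrite [X in X @ _](_ : _ = (fun x => \sum_(i <- r | P i) f i x)) //.
by apply/funext => x; rewrite add0r.
Qed.

Section Calculus.
Context {R : realType} {d : nat}.
Implicit Types (U : set 'rV[R]_d) (f g : 'rV[R]_d -> R) (x y z : 'rV[R]_d).

Local Notation e_ i := (delta_mx 0 i : 'rV[R]_d).

Lemma is_derive_line f y v (r : R) :
  derivable f (y + r *: v) v ->
  is_derive r 1 (fun s => f (y + s *: v)) ('D_v f (y + r *: v)).
Proof.
have E : (fun h : R => h^-1 *: (((fun s => f (y + s *: v)) \o shift r) (h *: (1 : R)) -
            f (y + r *: v))) =
    (fun h : R => h^-1 *: ((f \o shift (y + r *: v)) (h *: v) - f (y + r *: v))).
  apply/funext => h /=; congr (_ *: (f _ - _)).
  by rewrite [_%:A]mulr1 scalerDl addrCA.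
by move=> H; apply: DeriveDef; rewrite /derivable /derive E.
Qed.

(** Coordinate increments have either sign, hence the arbitrary real a. Only derivability in the
    direction v is assumed, so that one coordinate can be moved at a time before differentiability
    is known. *)
Lemma mvt_line f y v (a : R) :
  (forall r, 0 <= r <= 1 -> derivable f (y + (r * a) *: v) v) ->
  exists2 c, 0 <= c <= 1 & f (y + a *: v) - f y = a * 'D_v f (y + (c * a) *: v).
Proof.
move=> H; pose g s := f (y + s *: v).
have dg s : (exists2 r, 0 <= r <= 1 & s = r * a) ->
    is_derive s 1 g ('D_v f (y + s *: v)).
  by case=> r r01 ->; apply: is_derive_line; exact: H.
have cont s : (exists2 r, 0 <= r <= 1 & s = r * a) -> {for s, continuous g}.
  move=> /dg ds; apply/differentiable_continuous/derivable1_diffP.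
  by case: ds.
have [a0|a0|a0] := ltgtP a 0.
- have in01 s : a <= s <= 0 -> exists2 r, 0 <= r <= 1 & s = r * a.
    move=> /andP[as_ s0]; exists (s / a); last by rewrite divfK ?lt_eqF.
    by rewrite ler_ndivrMr // ler_ndivlMr // mul0r mul1r s0.
  have [s||c cab E] := @MVT_segment R g (fun s => 'D_v f (y + s *: v)) a 0 (ltW a0).
  + by rewrite in_itv /= => /andP[/ltW ? /ltW ?]; apply: dg; apply: in01; apply/andP.
  + apply: continuous_in_subspaceT => s; rewrite inE /= in_itv /= => ?.
    by apply: cont; apply: in01.
  have [r r01 cE] : exists2 r, 0 <= r <= 1 & c = r * a.
    by apply: in01; move: cab; rewrite in_itv.
  exists r => //; rewrite -cE; move: E; rewrite /g scale0r addr0 sub0r mulrN mulrC => E.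
  by rewrite -[LHS]opprB E opprK.
- have in01 s : 0 <= s <= a -> exists2 r, 0 <= r <= 1 & s = r * a.
    move=> /andP[s0 sa]; exists (s / a); last by rewrite divfK ?gt_eqF.
    by rewrite ler_pdivlMr // ler_pdivrMr // mul0r mul1r s0.
  have [s||c cab E] := @MVT_segment R g (fun s => 'D_v f (y + s *: v)) 0 a (ltW a0).
  + by rewrite in_itv /= => /andP[/ltW ? /ltW ?]; apply: dg; apply: in01; apply/andP.
  + apply: continuous_in_subspaceT => s; rewrite inE /= in_itv /= => ?.
    by apply: cont; apply: in01.
  have [r r01 cE] : exists2 r, 0 <= r <= 1 & c = r * a.
    by apply: in01; move: cab; rewrite in_itv.
  by exists r => //; rewrite -cE; move: E; rewrite /g scale0r addr0 subr0 mulrC.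
- by exists 0; rewrite ?lexx ?ler01 // a0 scale0r addr0 mul0r subrr.
Qed.

(** The corners of a staircase from 0 to z along the coordinate axes; consecutive corners differ in
    one coordinate. *)
Definition trunc_row (k : nat) z : 'rV[R]_d := \row_i (if (i < k)%N then z 0 i else 0).

Lemma trunc_row0 z : trunc_row 0 z = 0.
Proof. by apply/rowP => i; rewrite !mxE. Qed.

Lemma trunc_row_all z : trunc_row d z = z.
Proof. by apply/rowP => i; rewrite !mxE ltn_ord. Qed.

Lemma trunc_rowS (k : 'I_d) z : trunc_row k.+1 z = trunc_row k z + z 0 k *: e_ k.
Proof.
apply/rowP => i; rewrite !mxE /= ltnS leq_eqVlt.
have [->|ne] := eqVneq i k; first by rewrite eqxx ltnn add0r mulr1.
by rewrite -val_eqE in ne; rewrite (negPf ne) /= mulr0 addr0.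
Qed.

Lemma normr_row_le z (r : R) : 0 <= r -> (forall i, `|z 0 i| <= r) -> `|z| <= r.
Proof.
move=> r0 H; rewrite /Num.Def.normr /= mx_normrE bigmax_le //= => -[i j] _ /=.
by rewrite ord1; exact: H.
Qed.

Lemma normr_row_ge z i : `|z 0 i| <= `|z|.
Proof.
rewrite [leRHS]/Num.Def.normr /= mx_normrE.
exact: (le_bigmax _ (fun ij : 'I_1 * 'I_d => `|z ij.1 ij.2|) (0, i)).
Qed.

Lemma trunc_row_near (k : 'I_d) z (c : R) : 0 <= c <= 1 ->
  `|trunc_row k z + (c * z 0 k) *: e_ k| <= `|z|.
Proof.
move=> /andP[c0 c1]; apply: normr_row_le => // i; rewrite !mxE /=.
have [->|ne] := eqVneq i k.
  rewrite ltnn add0r mulr1 normrM (ger0_norm c0).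
  by apply: le_trans (normr_row_ge z k); rewrite ler_piMl.
rewrite mulr0 addr0; case: ifP => _; first exact: normr_row_ge.
by rewrite normr0.
Qed.

Lemma differentiable_C1 U f x : open U -> U x ->
  (forall y i, U y -> derivable f y (e_ i)) ->
  (forall i, {for x, continuous (pd i f)}) ->
  differentiable f x /\ forall v, 'd f x v = \sum_i v 0 i * pd i f x.
Proof.
move=> oU Ux df cf.
pose L := (fun v : 'rV[R]_d => \sum_i v 0 i * pd i f x) : 'rV[R]_d -> R^o.
have Llin : linear L.
  move=> a u v; rewrite /L scaler_sumr -big_split /=; apply: eq_bigr => i _.
  by rewrite !mxE mulrDl -mulrA.
pose LL := GRing.isLinear.Build R 'rV[R]_d R^o _ L Llin.
pose Lf : {linear 'rV[R]_d -> R^o} := HB.pack L LL.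
have Lc : continuous Lf.
  move=> v; rewrite /Lf /= /L.
  apply: (@cvg_sumr _ _ (nbhs v) (nbhs_filter v)) => i _; apply: cvgMr_tmp; exact: coord_continuous.
have E : (f : 'rV[R]_d -> R^o) \o shift x = cst (f x) + Lf +o_ (0 : 'rV[R]_d) (@idfun 'rV[R]_d).
  apply: (iffRL (@eqaddoP R 'rV[R]_d R^o 'rV[R]_d _ _ _ _)) => _/posnumP[e].
  (* Each of the d coordinate steps gets the tolerance e / (d + 1); the successor also covers d =
     0. *)
  have e1 : 0 < e%:num / d.+1%:R by apply: divr_gt0.
  have H1 : \forall y \near x, U y /\ forall i, `|pd i f x - pd i f y| < e%:num / d.+1%:R.
    near=> y; split; first by near: y; exact: open_nbhs_nbhs.
    move=> i; move: i; near: y; apply: filter_forall => i.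
    by have /cvgrPdist_lt /(_ _ e1) := cf i.
  case/nbhs_ballP: H1 => r /= r0 Hr.
  near=> z.
  have zr : `|z| < r by near: z; apply/nbhs_ballP; exists r => //= u;
    rewrite -ball_normE /= sub0r normrN.
  have ballx u : `|u| <= `|z| -> U (x + u) /\ forall i, `|pd i f x - pd i f (x + u)| < e%:num / d.+1%:R.
    move=> uz; apply: Hr; rewrite -ball_normE /= opprD addNKr normrN.
    exact: le_lt_trans zr.
  have tele : f (x + z) - f x = \sum_(k < d) (f (x + trunc_row k.+1 z) - f (x + trunc_row k z)).
    rewrite -(big_mkord xpredT (fun k => f (x + trunc_row k.+1 z) - f (x + trunc_row k z))).
    by rewrite telescope_sumr // trunc_row0 trunc_row_all addr0.
  have stp (k : 'I_d) : `|f (x + trunc_row k.+1 z) - f (x + trunc_row k z) - z 0 k * pd k f x|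
      <= `|z| * (e%:num / d.+1%:R).
    rewrite trunc_rowS addrA.
    have [|c c01 ->] := @mvt_line f (x + trunc_row k z) (e_ k) (z 0 k).
      move=> r1 r1p; apply: df; rewrite -addrA.
      by apply: (ballx _ (trunc_row_near _ _ _)).1.
    rewrite -/(pd k f _) -mulrBr normrM ler_pM //; first exact: normr_row_ge.
    rewrite distrC -addrA; apply/ltW.
    by apply: (ballx _ (trunc_row_near _ _ _)).2.
  rewrite -[X in `|X|]/(f (z + x) - (f x + L z)) (addrC z x) opprD addrA tele /L -sumrB.
  apply: le_trans (ler_norm_sum _ _ _) _.
  apply: le_trans (ler_sum _ (fun k _ => stp k)) _.
  rewrite sumr_const card_ord -[_ *+ d]mulr_natr -mulrA [leRHS]mulrC; apply: ler_wpM2l => //.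
  by rewrite mulrAC ler_pdivrMr ?ltr0n // ler_pM2l // ler_nat.
have dE := diff_unique Lc E.
split; last by move=> v; rewrite dE.
by apply/diff_locallyP; rewrite dE.
Unshelve. all: by end_near. Qed.

End Calculus.

Section Smoothness.
Context {R : realType} {d : nat}.
Implicit Types (U : set 'rV[R]_d) (f g : 'rV[R]_d -> R) (x y z : 'rV[R]_d).

Local Notation e_ i := (delta_mx 0 i : 'rV[R]_d).

Lemma near_open U (P : 'rV[R]_d -> Prop) x :
  open U -> U x -> (forall y, U y -> P y) -> \forall y \near x, P y.
Proof. by move=> oU Ux H; apply: filterS H _; exact: open_nbhs_nbhs. Qed.

Lemma pd_local U f g i x : open U -> U x -> (forall y, U y -> f y = g y) ->
  pd i f x = pd i g x.
Proof. by move=> oU Ux H; apply: near_eq_derive; exact: (near_open oU Ux). Qed.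

Lemma pds_local U f g w x : open U -> U x -> (forall y, U y -> f y = g y) ->
  pds w f x = pds w g x.
Proof.
move=> oU + H; elim: w x => [|i w IH] x Ux /=; first exact: H.
exact: (pd_local i oU Ux).
Qed.

Lemma derivable_local U f g x v : open U -> U x -> (forall y, U y -> f y = g y) ->
  derivable f x v -> derivable g x v.
Proof. by move=> oU Ux H; apply: near_eq_derivable; exact: (near_open oU Ux). Qed.

Lemma continuous_local U f g x : open U -> U x -> (forall y, U y -> f y = g y) ->
  {for x, continuous f} -> {for x, continuous g}.
Proof.
move=> oU Ux H cf; rewrite /prop_for /continuous_at -(H x Ux).
apply: cvg_trans cf; apply: (@near_eq_cvg _ _ (nbhs x) (nbhs_filter x)); exact: near_open H.
Qed.

(** [smooth_on] speaks of all words at once, whereas closure under products and composition is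
    proved by induction on the order, applied to first derivatives. [Ck] peels off the innermost
    derivative, which is the last letter of a word. *)
Fixpoint Ck n U f : Prop := (forall x, U x -> {for x, continuous f}) /\
  if n is n'.+1 then forall i, (forall x, U x -> derivable f x (e_ i)) /\ Ck n' U (pd i f)
  else True.

Lemma CkW n U f : Ck n.+1 U f -> Ck n U f.
Proof.
elim: n f => [|n IH] f [cf H]; split=> // i; case: (H i) => df pf; split => //.
exact: IH.
Qed.

Lemma pds_rcons w i f : pds (rcons w i) f = pds w (pd i f).
Proof. by rewrite /pds foldr_rcons. Qed.

Lemma pds_cat w w' f : pds (w ++ w') f = pds w (pds w' f).
Proof. by rewrite /pds foldr_cat. Qed.

Lemma smooth_onP U f : smooth_on U f <-> forall n, Ck n U f.
Proof.
split=> [sf n|H w].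
  elim: n f sf => [|n IH] f sf; split => //; try by move=> x Ux; exact: (sf [::] x Ux).1.
  move=> i; split; first by move=> x Ux; exact: (sf [::] x Ux).2.
  by apply: IH => w x Ux; rewrite -pds_rcons; exact: sf.
elim/last_ind: w f H => [|w i IH] f H x Ux.
  by have [cf df] := H 1; split => [|i]; [exact: cf|exact: (df i).1].
rewrite pds_rcons; apply: IH => // n.
by have [_ /(_ i)[]] := H n.+1.
Qed.

Lemma smooth_pd U f i : smooth_on U f -> smooth_on U (pd i f).
Proof. by move=> sf w x Ux; rewrite -pds_rcons; exact: sf. Qed.

Lemma smooth_pds U f w : smooth_on U f -> smooth_on U (pds w f).
Proof. by move=> sf w' x Ux; rewrite -pds_cat; exact: sf. Qed.

Lemma smooth_cont U f x : smooth_on U f -> U x -> {for x, continuous f}.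
Proof. by move=> sf Ux; exact: (sf [::] x Ux).1. Qed.

Lemma smooth_derivable U f x i : smooth_on U f -> U x -> derivable f x (e_ i).
Proof. by move=> sf Ux; exact: (sf [::] x Ux).2. Qed.

Lemma smooth_onS U V f : V `<=` U -> smooth_on U f -> smooth_on V f.
Proof. by move=> VU sf w x /VU; exact: sf. Qed.


Lemma smooth_diff U f x : open U -> U x -> smooth_on U f ->
  differentiable f x /\ forall v, 'd f x v = \sum_i v 0 i * pd i f x.
Proof.
move=> oU Ux sf; apply: (differentiable_C1 oU Ux) => [y i Uy|i].
  exact: (smooth_derivable sf Uy).
exact: (smooth_cont (smooth_pd i sf) Ux).
Qed.

Lemma Ck_local n U f g : open U -> (forall y, U y -> f y = g y) ->
  Ck n U f -> Ck n U g.
Proof.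
move=> oU; elim: n f g => [|n IH] f g H [cf df]; split => //.
- by move=> x Ux; apply: (continuous_local oU Ux H); exact: cf.
- by move=> x Ux; apply: (continuous_local oU Ux H); exact: cf.
- move=> i; have [df1 df2] := df i; split.
    by move=> x Ux; apply: (derivable_local oU Ux H); exact: df1.
  by apply: (IH (pd i f)) => // y Uy; exact: (pd_local i oU Uy).
Qed.

Lemma smooth_local U f g : open U -> (forall y, U y -> f y = g y) ->
  smooth_on U f -> smooth_on U g.
Proof. by move=> oU H /smooth_onP sf; apply/smooth_onP => n; exact: (Ck_local oU H). Qed.

Lemma smooth_pointwise U f : open U ->
  (forall x, U x -> exists V, [/\ open V, V x & smooth_on V f]) -> smooth_on U f.
Proof. by move=> oU H w x /H[V [_ Vx]]; exact. Qed.

Lemma pd_cst (c : R) i : pd i (fun=> c) = (fun=> 0) :> ('rV[R]_d -> R).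
Proof. by apply/funext => x; rewrite /pd -[fun=> c]/(cst c) derive_cst. Qed.

Lemma Ck_cst n U (c : R) : Ck n U (fun=> c).
Proof.
elim: n c => [|n IH] c; split => //; try by move=> x _; exact: cst_continuous.
move=> i; split; first by move=> x _; exact: (@derivable_cst R 'rV[R]_d R^o c x (e_ i)).
by rewrite pd_cst; exact: IH.
Qed.

Lemma smooth_cst U (c : R) : smooth_on U (fun=> c).
Proof. by apply/smooth_onP => n; exact: Ck_cst. Qed.

Lemma is_derive_coord x v j : is_derive x v (fun y : 'rV[R]_d => y 0 j) (v 0 j).
Proof.
have H := @derivable_id R 'rV[R]_d x v.
apply: DeriveDef; first exact: (iffLR (derivable_mxP _ _ _) H 0 j).
by have := derive_mx H; rewrite derive_id => /(congr1 (fun M : 'rV[R]_d => M 0 j)); rewrite mxE.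
Qed.

Lemma pd_coord i j : pd i (fun y : 'rV[R]_d => y 0 j) = (fun=> (i == j)%:R).
Proof.
apply/funext => x; rewrite /pd (@derive_val _ _ _ _ _ _ _ (is_derive_coord x (e_ i) j)).
by rewrite mxE eqxx /= eq_sym.
Qed.

Lemma smooth_coord U j : smooth_on U (fun y : 'rV[R]_d => y 0 j).
Proof.
apply/smooth_onP => -[|n]; split => //; try by move=> x _; exact: coord_continuous.
move=> i; split; last by rewrite pd_coord; exact: Ck_cst.
by move=> x _; case: (is_derive_coord x (e_ i) j).
Qed.

Lemma pdD f g i x : derivable f x (e_ i) -> derivable g x (e_ i) ->
  pd i (fun y => f y + g y) x = pd i f x + pd i g x.
Proof. exact: deriveD. Qed.

Lemma pdN f i x : derivable f x (e_ i) -> pd i (fun y => - f y) x = - pd i f x.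
Proof. exact: deriveN. Qed.

Lemma pdM f g i x : derivable f x (e_ i) -> derivable g x (e_ i) ->
  pd i (fun y => f y * g y) x = pd i f x * g x + f x * pd i g x.
Proof.
move=> df dg; apply: etrans (deriveM df dg) _.
by rewrite addrC; congr (_ + _); exact: mulrC.
Qed.

Lemma continuous_for_add f g x : {for x, continuous f} -> {for x, continuous g} ->
  {for x, continuous (fun y => f y + g y)}.
Proof. by move=> cf cg; exact: (@continuousD _ _ _ f g x cf cg). Qed.

Lemma continuous_for_mul f g x : {for x, continuous f} -> {for x, continuous g} ->
  {for x, continuous (fun y => f y * g y)}.
Proof. by move=> cf cg; exact: (@continuousM _ _ f g x cf cg). Qed.

Lemma CkD n U f g : open U -> Ck n U f -> Ck n U g -> Ck n U (fun y => f y + g y).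
Proof.
move=> oU; elim: n f g => [|n IH] f g [cf df] [cg dg]; split => //.
- by move=> x Ux; exact: (continuous_for_add (cf _ Ux) (cg _ Ux)).
- by move=> x Ux; exact: (continuous_for_add (cf _ Ux) (cg _ Ux)).
- move=> i; have [df1 df2] := df i; have [dg1 dg2] := dg i; split.
    by move=> x Ux; apply: derivableD; [exact: df1|exact: dg1].
  apply: (Ck_local oU _ (IH _ _ df2 dg2)) => y Uy.
  by rewrite pdD //; [exact: df1|exact: dg1].
Qed.

Lemma CkM n U f g : open U -> Ck n U f -> Ck n U g -> Ck n U (fun y => f y * g y).
Proof.
move=> oU; elim: n f g => [|n IH] f g Cf Cg; have [cf df] := Cf; have [cg dg] := Cg;
  split => //.
- by move=> x Ux; exact: (continuous_for_mul (cf _ Ux) (cg _ Ux)).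
- by move=> x Ux; exact: (continuous_for_mul (cf _ Ux) (cg _ Ux)).
- move=> i; have [df1 df2] := df i; have [dg1 dg2] := dg i; split.
    by move=> x Ux; apply: derivableM; [exact: df1|exact: dg1].
  apply: (Ck_local oU _ (CkD oU (IH _ _ df2 (CkW Cg)) (IH _ _ (CkW Cf) dg2))) => y Uy.
  by rewrite pdM //; [exact: df1|exact: dg1].
Qed.

Lemma smoothD U f g : open U -> smooth_on U f -> smooth_on U g ->
  smooth_on U (fun y => f y + g y).
Proof. by move=> oU /smooth_onP sf /smooth_onP sg; apply/smooth_onP => n; exact: CkD. Qed.

Lemma smoothM U f g : open U -> smooth_on U f -> smooth_on U g ->
  smooth_on U (fun y => f y * g y).
Proof. by move=> oU /smooth_onP sf /smooth_onP sg; apply/smooth_onP => n; exact: CkM. Qed.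

Lemma smoothZ U (c : R) f : open U -> smooth_on U f -> smooth_on U (fun y => c * f y).
Proof. by move=> oU; apply: smoothM => //; exact: smooth_cst. Qed.

Lemma smoothN U f : open U -> smooth_on U f -> smooth_on U (fun y => - f y).
Proof.
move=> oU sf; apply: (smooth_local oU _ (smoothZ (-1) oU sf)) => y _.
by rewrite mulN1r.
Qed.

Lemma smoothB U f g : open U -> smooth_on U f -> smooth_on U g ->
  smooth_on U (fun y => f y - g y).
Proof. by move=> oU sf sg; exact: (smoothD oU sf (smoothN oU sg)). Qed.

Lemma smooth_sum (I : Type) (r : seq I) (P : pred I) U (F : I -> 'rV[R]_d -> R) :
  open U -> (forall i, P i -> smooth_on U (F i)) ->
  smooth_on U (fun y => \sum_(i <- r | P i) F i y).
Proof.
move=> oU H; elim: r => [|i r IH].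
  by apply: (@smooth_local U (fun=> 0) _ oU _ (@smooth_cst U 0)) => y _; rewrite big_nil.
case: (boolP (P i)) => Pi.
  by apply: (smooth_local oU _ (smoothD oU (H i Pi) IH)) => y _; rewrite big_cons Pi.
by apply: (smooth_local oU _ IH) => y _; rewrite big_cons (negPf Pi).
Qed.

Lemma smooth_prod (I : Type) (r : seq I) (P : pred I) U (F : I -> 'rV[R]_d -> R) :
  open U -> (forall i, P i -> smooth_on U (F i)) ->
  smooth_on U (fun y => \prod_(i <- r | P i) F i y).
Proof.
move=> oU H; elim: r => [|i r IH].
  by apply: (@smooth_local U (fun=> 1) _ oU _ (@smooth_cst U 1)) => y _; rewrite big_nil.
case: (boolP (P i)) => Pi.
  by apply: (smooth_local oU _ (smoothM oU (H i Pi) IH)) => y _; rewrite big_cons Pi.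
by apply: (smooth_local oU _ IH) => y _; rewrite big_cons (negPf Pi).
Qed.

Lemma pd_sum (I : Type) (r : seq I) (P : pred I) (F : I -> 'rV[R]_d -> R) i x :
  (forall j, P j -> derivable (F j) x (e_ i)) ->
  derivable (fun y => \sum_(j <- r | P j) F j y) x (e_ i) /\
  pd i (fun y => \sum_(j <- r | P j) F j y) x = \sum_(j <- r | P j) pd i (F j) x.
Proof.
move=> H; elim: r => [|j r [IH1 IH2]].
  rewrite (_ : (fun y => _) = fun=> 0); last by apply/funext => y; rewrite big_nil.
  by rewrite pd_cst big_nil; split => //; exact: derivable_cst.
rewrite big_cons; case: ifP => Pj.
  rewrite (_ : (fun y => _) = fun y => F j y + \sum_(j <- r | P j) F j y); last first.
    by apply/funext => y; rewrite big_cons Pj.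
  have Dj := H j Pj; split; first exact: (derivableD Dj IH1).
  by rewrite (pdD Dj IH1) IH2.
rewrite (_ : (fun y => _) = fun y => \sum_(j <- r | P j) F j y) //.
by apply/funext => y; rewrite big_cons Pj.
Qed.

Lemma pd_sumE (I : Type) (r : seq I) (P : pred I) (F : I -> 'rV[R]_d -> R) i x :
  (forall j, P j -> derivable (F j) x (e_ i)) ->
  pd i (fun y => \sum_(j <- r | P j) F j y) x = \sum_(j <- r | P j) pd i (F j) x.
Proof. by move=> H; case: (@pd_sum I r P F i x H). Qed.

Lemma pdsD U w f g x : open U -> smooth_on U f -> smooth_on U g -> U x ->
  pds w (fun y => f y + g y) x = pds w f x + pds w g x.
Proof.
move=> oU sf sg; elim: w x => [//|i w IH] x Ux /=.
rewrite (pd_local i oU Ux IH) pdD //; apply: smooth_derivable Ux; exact: smooth_pds.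
Qed.

Lemma pdsZ U w (c : R) f x : open U -> smooth_on U f -> U x ->
  pds w (fun y => c * f y) x = c * pds w f x.
Proof.
move=> oU sf; elim: w x => [//|i w IH] x Ux /=.
rewrite (pd_local i oU Ux IH) pdM; first by rewrite pd_cst mul0r add0r.
  exact: derivable_cst.
by apply: smooth_derivable Ux; exact: smooth_pds.
Qed.

Lemma pdsN U w f x : open U -> smooth_on U f -> U x ->
  pds w (fun y => - f y) x = - pds w f x.
Proof.
move=> oU sf Ux; rewrite -mulN1r -(pdsZ _ _ oU) //.
by apply: (pds_local _ oU Ux) => y _; rewrite mulN1r.
Qed.

Lemma pdsB U w f g x : open U -> smooth_on U f -> smooth_on U g -> U x ->
  pds w (fun y => f y - g y) x = pds w f x - pds w g x.
Proof.
move=> oU sf sg Ux; apply: etrans (pdsD w oU sf (smoothN oU sg) Ux) _.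
by rewrite (pdsN _ oU).
Qed.

Lemma pds_cst w (c : R) x : pds w (fun=> c) x = if w is [::] then c else 0.
Proof. by elim/last_ind: w c => [|w i IH] c //; rewrite pds_rcons pd_cst IH; case: w {IH}. Qed.

Lemma pds_sum (I : Type) (r : seq I) (P : pred I) U (F : I -> 'rV[R]_d -> R) w x :
  open U -> (forall i, P i -> smooth_on U (F i)) -> U x ->
  pds w (fun y => \sum_(i <- r | P i) F i y) x = \sum_(i <- r | P i) pds w (F i) x.
Proof.
move=> oU H Ux; elim: r => [|i r IH].
  rewrite big_nil (_ : (fun y => _) = fun=> 0) ?pds_cst; first by case: w.
  by apply/funext => y; rewrite big_nil.
rewrite big_cons; case: ifP => Pi.
  rewrite -IH -(pdsD _ oU) //; [|exact: H|exact: smooth_sum].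
  by apply: (pds_local _ oU Ux) => y _; rewrite big_cons Pi.
rewrite -IH; by apply: (pds_local _ oU Ux) => y _; rewrite big_cons Pi.
Qed.

End Smoothness.

(** * Composition of smooth maps and the chain rule *)

Section Composition.
Context {R : realType} {d e : nat}.
Implicit Types (U : set 'rV[R]_d) (V : set 'rV[R]_e).

Lemma continuous_map (h : 'rV[R]_d -> 'rV[R]_e) x :
  (forall k, {for x, continuous (fun y => h y 0 k)}) -> {for x, continuous h}.
Proof.
move=> H; apply/(@cvgrPdist_lt _ _ _ (nbhs x) (nbhs_filter x)) => r r0.
have : \forall y \near x, forall k, `|h x 0 k - h y 0 k| < r.
  near=> y => k; move: k; near: y; apply: filter_forall => k.
  by have /cvgrPdist_lt /(_ _ r0) := H k.
apply: filterS => y Hy; rewrite /Num.Def.normr /= mx_normrE bigmax_lt //= => -[i j] _ /=.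
by rewrite ord1 !mxE; exact: Hy.
Unshelve. all: by end_near. Qed.

Lemma smooth_map_cont U (h : 'rV[R]_d -> 'rV[R]_e) x : smooth_map_on U h -> U x ->
  {for x, continuous h}.
Proof. by move=> sh Ux; apply: continuous_map => k; exact: (smooth_cont (sh k) Ux). Qed.

(** Only one direction e_i of h is available, so phi is composed with the curve s |-> h (s e_i + x):
    in one variable derivability is differentiability, and differentials can be composed. *)
Lemma chain_rule V (phi : 'rV[R]_e -> R) (h : 'rV[R]_d -> 'rV[R]_e) x i :
  open V -> V (h x) -> smooth_on V phi ->
  (forall k, derivable (fun y => h y 0 k) x (delta_mx 0 i)) ->
  derivable (phi \o h) x (delta_mx 0 i) /\
  pd i (phi \o h) x = \sum_k pd k phi (h x) * pd i (fun y => h y 0 k) x.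
Proof.
move=> oV Vhx sphi dh; set v := delta_mx 0 i.
have dhx : derivable h x v.
  by apply/derivable_mxP => a k; rewrite ord1; exact: dh.
have [dphi dphiE] := smooth_diff oV Vhx sphi.
pose c (s : R) := h (s *: v + x).
have c0 : c 0 = h x by rewrite /c scale0r add0r.
have dc : differentiable c 0.
  by apply/derivable1_diffP; move/derivable1P: dhx.
have dphi' : differentiable phi (c 0) by rewrite c0.
have dcomp : differentiable (phi \o c) 0 by apply: differentiable_comp.
have D : derivable (phi \o h) x v.
  by apply/derivable1P; apply/derivable1_diffP.
split=> //.
have x0 : x = x + 0 *: v by rewrite scale0r addr0.
have cE : c = (fun s => h (x + s *: v)) by apply/funext => s; rewrite /c addrC.
have D1 : 'D_1 (phi \o c) 0 = pd i (phi \o h) x.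
  have D' : derivable (phi \o h) (x + 0 *: v) v by rewrite -x0.
  have := @derive_val _ _ _ _ _ _ _ (is_derive_line D').
  by rewrite -x0 cE /pd => <-.
have D2 : 'd c 0 1 = 'D_v h x.
  rewrite -(deriveE _ dc) cE.
  transitivity ('D_v h (x + 0 *: v)); last by rewrite -x0.
  have dh' : derivable h (x + 0 *: v) v by rewrite -x0.
  rewrite -/v in dh' *.
  have E (f := h) : (fun t : R => t^-1 *: (((fun s => h (x + s *: v)) \o shift 0) (t *: (1 : R)) -
            h (x + 0 *: v))) =
    (fun t : R => t^-1 *: ((h \o shift (x + 0 *: v)) (t *: v) - h (x + 0 *: v))).
    apply/funext => t /=; congr (_ *: (h _ - _)).
    by rewrite [_%:A]mulr1 scale0r !addr0 addrC.
  by rewrite /derive E.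
have -> : pd i (phi \o h) x = 'd phi (h x) ('D_v h x).
  by rewrite -D1 (deriveE _ dcomp) (diff_comp dc dphi') -D2 -c0.
rewrite dphiE.
apply: eq_bigr => k _; rewrite mulrC; congr (_ * _).
by rewrite derive_mx // mxE.
Qed.

Lemma Ck_comp n U V (phi : 'rV[R]_e -> R) (h : 'rV[R]_d -> 'rV[R]_e) :
  open U -> open V -> (forall x, U x -> V (h x)) -> smooth_on V phi ->
  smooth_map_on U h -> Ck n U (phi \o h).
Proof.
move=> oU oV UV sphi sh; elim: n phi sphi => [|n IH] phi sphi; split => //.
- move=> x Ux; apply: continuous_comp; first exact: (smooth_map_cont sh Ux).
  exact: (smooth_cont sphi (UV x Ux)).
- move=> x Ux; apply: continuous_comp; first exact: (smooth_map_cont sh Ux).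
  exact: (smooth_cont sphi (UV x Ux)).
- move=> i; split=> [x Ux|].
    exact: (chain_rule oV (UV x Ux) sphi (fun k => smooth_derivable (sh k) Ux)).1.
  have H : Ck n U (fun x => \sum_k pd k phi (h x) * pd i (fun y => h y 0 k) x).
    elim: (index_enum _) => [|k r IHr].
      apply: (Ck_local oU _ (Ck_cst n U 0)) => y _; by rewrite big_nil.
    apply: (Ck_local oU _ (CkD oU (CkM oU (IH _ (smooth_pd k sphi)) _) IHr)) => [y Uy|].
      by rewrite big_cons.
    by apply: (iffLR (smooth_onP _ _)); exact: smooth_pd (sh k).
  apply: (Ck_local oU _ H) => x Ux.
  by rewrite (chain_rule oV (UV x Ux) sphi (fun k => smooth_derivable (sh k) Ux)).2.
Qed.

Lemma smooth_comp U V (phi : 'rV[R]_e -> R) (h : 'rV[R]_d -> 'rV[R]_e) :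
  open U -> open V -> (forall x, U x -> V (h x)) -> smooth_on V phi ->
  smooth_map_on U h -> smooth_on U (phi \o h).
Proof. by move=> *; apply/smooth_onP => n; exact: (@Ck_comp _ _ V). Qed.

Lemma pd_comp U V (phi : 'rV[R]_e -> R) (h : 'rV[R]_d -> 'rV[R]_e) i x :
  open V -> U x -> V (h x) -> smooth_on V phi -> smooth_map_on U h ->
  pd i (phi \o h) x = \sum_k pd k phi (h x) * pd i (fun y => h y 0 k) x.
Proof.
move=> oV Ux Vhx sphi sh.
exact: (chain_rule oV Vhx sphi (fun k => smooth_derivable (sh k) Ux)).2.
Qed.

End Composition.

(** * Symmetry of iterated partial derivatives *)

Section Schwarz.
Context {R : realType} {d : nat}.
Implicit Types (U : set 'rV[R]_d) (f g : 'rV[R]_d -> R) (x y z : 'rV[R]_d).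

Local Notation e_ i := (delta_mx 0 i : 'rV[R]_d).

Lemma continuous_near f x (r : R) : {for x, continuous f} -> 0 < r ->
  \forall y \near x, `|f x - f y| < r.
Proof. by move=> /(@cvgrPdist_lt _ _ _ (nbhs x) (nbhs_filter x)) H /H. Qed.

(** The mean value theorem is applied in the direction i to the difference of f in the direction j,
    then in the direction j to the i-th partial derivative. *)
Lemma second_difference U f x i j (a : R) : open U -> smooth_on U f ->
  (forall s r, 0 <= s <= a -> 0 <= r <= a -> U (x + s *: e_ i + r *: e_ j)) -> 0 < a ->
  exists s r, [/\ 0 <= s <= a, 0 <= r <= a &
    f (x + a *: e_ i + a *: e_ j) - f (x + a *: e_ i) - (f (x + a *: e_ j) - f x) =
    a * a * pd j (pd i f) (x + s *: e_ i + r *: e_ j)].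
Proof.
move=> oU sf HU a0; have a00 : 0 <= a <= a by rewrite ltW //=.
have z0 : 0 <= (0 : R) <= a by rewrite lexx ltW.
have sc c : 0 <= c <= 1 -> 0 <= c * a <= a.
  by move=> /andP[c0 c1]; apply/andP; split; [rewrite mulr_ge0 // ltW|rewrite ler_piMl // ltW].
pose g y := f (y + a *: e_ j) - f y.
have HU0 s : 0 <= s <= a -> U (x + s *: e_ i).
  by move=> sa; have := HU s 0 sa z0; rewrite scale0r addr0.
have dshift y : U (y + a *: e_ j) -> is_derive y (e_ i) (fun y => f (y + a *: e_ j))
    (pd i f (y + a *: e_ j)).
  move=> Uy; have Df := smooth_derivable (i := i) sf Uy.
  have E : (fun h : R => h^-1 *: (((fun y => f (y + a *: e_ j)) \o shift y) (h *: e_ i) -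
            f (y + a *: e_ j))) =
    (fun h : R => h^-1 *: ((f \o shift (y + a *: e_ j)) (h *: e_ i) - f (y + a *: e_ j))).
    by apply/funext => h /=; rewrite addrA.
  by apply: DeriveDef; rewrite /derivable /pd /derive E.
have dg s : 0 <= s <= a -> is_derive (x + s *: e_ i) (e_ i) g
    (pd i f (x + s *: e_ i + a *: e_ j) - pd i f (x + s *: e_ i)).
  move=> sa; apply: is_deriveB; first by apply: dshift; exact: HU.
  by apply: derivableP; apply: (smooth_derivable (i := i) sf); exact: HU0.
have [r|c c01 E1] := @mvt_line R d g x (e_ i) a.
  by move=> /sc /dg [].
have cdg := dg _ (sc _ c01).
rewrite -/(g x) -/(g (x + a *: e_ i)) E1 (@derive_val _ _ _ _ _ _ _ cdg).
have [r r01|c' c01' E2] := @mvt_line R d (pd i f) (x + (c * a) *: e_ i) (e_ j) a.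
  apply: (smooth_derivable (i := j) (smooth_pd i sf)).
  by apply: HU; exact: sc.
exists (c * a), (c' * a); split; [exact: sc|exact: sc|].
by rewrite E2 mulrA.
Qed.

(** The second difference is symmetric in i and j, so the two mixed derivatives share a value, taken
    at two points close to x; continuity concludes. *)
Lemma schwarz U f x i j : open U -> U x -> smooth_on U f ->
  pd i (pd j f) x = pd j (pd i f) x.
Proof.
move=> oU Ux sf; apply/eqP; rewrite -subr_eq0 -normr_le0.
apply/ler_addgt0Pl => r r0; rewrite addr0.
have r2 : 0 < r / 2 by rewrite divr_gt0.
have H : \forall y \near x, U y /\
    (`|pd i (pd j f) x - pd i (pd j f) y| < r / 2 /\
     `|pd j (pd i f) x - pd j (pd i f) y| < r / 2).
  have c1 := smooth_cont (smooth_pd i (smooth_pd j sf)) Ux.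
  have c2 := smooth_cont (smooth_pd j (smooth_pd i sf)) Ux.
  apply: filterI; first exact: open_nbhs_nbhs.
  by apply: filterI; [exact: (continuous_near c1 r2)|exact: (continuous_near c2 r2)].
case/nbhs_ballP: H => q /= q0 Hq.
(* Two coordinate steps of length at most a stay inside the ball of radius q. *)
pose a := q / 3.
have a0 : 0 < a by rewrite divr_gt0.
have inb k l s t : 0 <= s <= a -> 0 <= t <= a -> ball x q (x + s *: e_ k + t *: e_ l).
  move=> /andP[s0 sa] /andP[t0 ta]; rewrite -ball_normE /= -addrA opprD addNKr normrN.
  have nrm (u : R) m : 0 <= u <= a -> `|u *: e_ m| <= a.
    move=> /andP[u0 ua]; apply: normr_row_le; first exact: ltW.
    move=> b; rewrite !mxE; case: (_ && _).
      by rewrite mulr1 ger0_norm.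
    by rewrite mulr0 normr0 ltW.
  apply: le_lt_trans (ler_normD _ _) _.
  apply: le_lt_trans (lerD (nrm s k _) (nrm t l _)) _; rewrite ?s0 ?t0 //.
  by rewrite /a; lra.
have [|s1 [t1 [s1a t1a E1]]] := second_difference (i := i) (j := j) (x := x) oU sf _ a0.
  by move=> s t sa ta; have [] := Hq _ (inb i j s t sa ta).
have [|s2 [t2 [s2a t2a E2]]] := second_difference (i := j) (j := i) (x := x) oU sf _ a0.
  by move=> s t sa ta; have [] := Hq _ (inb j i s t sa ta).
have E : pd j (pd i f) (x + s1 *: e_ i + t1 *: e_ j) =
         pd i (pd j f) (x + s2 *: e_ j + t2 *: e_ i).
  apply: (mulfI (x := a * a)); first by rewrite mulf_neq0 ?gt_eqF.
  apply: etrans (esym E1) _; apply: etrans _ E2; rewrite (addrAC x (a *: e_ j)).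
  have swap (a1 b1 c1 d1 : R) : a1 - b1 - (c1 - d1) = a1 - c1 - (b1 - d1) by ring.
  exact: swap.
have [_ [_ B1]] := Hq _ (inb i j _ _ s1a t1a).
have [_ [B2 _]] := Hq _ (inb j i _ _ s2a t2a).
set A := pd i (pd j f) x in B2 *; set B := pd j (pd i f) x in B1 *.
rewrite E in B1; set C := pd i (pd j f) _ in B1 B2.
have -> : A - B = (A - C) - (B - C) by ring.
apply: le_trans (ler_normB _ _) _; rewrite (splitr r).
exact: (lerD (ltW B2) (ltW B1)).
Qed.

Lemma pds_perm U f w w' x : open U -> U x -> smooth_on U f -> perm_eq w w' ->
  pds w f x = pds w' f x.
Proof.
move=> oU Ux sf.
move: w w' x Ux; elim.
  by move=> w' x Ux; rewrite perm_sym => /perm_nilP ->.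
move=> i w IH w' x Ux; move=> pw.
have iw' : i \in w' by rewrite -(perm_mem pw) mem_head.
have [w1 [w2 w'E]] : exists w1 w2, w' = w1 ++ i :: w2.
  by case/splitPr: iw' => w1 w2; exists w1, w2.
have pw2 : perm_eq w (w1 ++ w2).
  rewrite w'E in pw; rewrite -(perm_cons i); apply: perm_trans pw _.
  exact: (permEl (perm_catCA w1 [:: i] w2)).
rewrite {}w'E {pw iw'} /= (pd_local i oU Ux (fun y Uy => IH _ y Uy pw2)).
elim: w1 x Ux {pw2} => [|j w1 IHw] x Ux //=.
rewrite (schwarz (U := U)) //; last exact: smooth_pds.
by apply: (pd_local j oU Ux) => y Uy; exact: IHw.
Qed.

End Schwarz.

(** * Sums over words and jets *)

Section WordSums.
Context {R : numFieldType} {d : nat}.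
Implicit Types (F : seq 'I_d -> R) (n : nat) (w : seq 'I_d).

Local Notation W := (words (enum 'I_d)).
Local Notation WL := (words_le (enum 'I_d)).

Lemma sum_wordsS (V : nmodType) (G : seq 'I_d -> V) n :
  \sum_(w <- W n.+1) G w = \sum_(x : 'I_d) \sum_(w <- W n) G (x :: w).
Proof. by rewrite /= big_allpairs_dep big_enum. Qed.

Lemma sum_words0 (V : nmodType) (G : seq 'I_d -> V) : \sum_(w <- W 0) G w = G [::].
Proof. by rewrite /= big_seq1. Qed.

Lemma mem_words n w : (w \in W n) = (size w == n).
Proof.
elim: n w => [|n IH] w /=; first by rewrite inE size_eq0.
apply/allpairsP/idP => [[[x v] /= [_ vW ->]]|]; first by rewrite /= eqSS -IH.
by case: w => // x w; rewrite eqSS -IH => wW; exists (x, w); split => //; rewrite mem_enum.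
Qed.

Lemma mem_words_le n w : (w \in WL n) = (size w <= n)%N.
Proof.
apply/flatten_mapP/idP => [[k]|wn].
  by rewrite mem_iota add0n ltnS mem_words => /andP[_ kn] /eqP ->.
by exists (size w); rewrite ?mem_words // mem_iota add0n ltnS.
Qed.

Lemma mem_newords_le n w : (w \in newords_le (enum 'I_d) n) = (0 < size w <= n)%N.
Proof.
apply/flatten_mapP/idP => [[k]|wn].
  by rewrite mem_iota add1n ltnS mem_words => kn /eqP ->.
by exists (size w); rewrite ?mem_words // mem_iota add1n ltnS.
Qed.

Lemma sum_words_le (V : nmodType) (G : seq 'I_d -> V) n :
  \sum_(w <- WL n) G w = \sum_(k < n.+1) \sum_(w <- W k) G w.
Proof. by rewrite /words_le big_flatten big_map -(big_mkord xpredT (fun k => \sum_(w <- W k) G w)). Qed.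

Lemma sum_newords_le (V : nmodType) (G : seq 'I_d -> V) n :
  \sum_(w <- newords_le (enum 'I_d) n) G w = \sum_(k < n) \sum_(w <- W k.+1) G w.
Proof.
rewrite /newords_le big_flatten big_map -(big_mkord xpredT (fun k => \sum_(w <- W k.+1) G w)).
have -> : iota 1 n = [seq k.+1 | k <- iota 0 n] by rewrite (iotaDl 1 0).
by rewrite big_map /index_iota subn0.
Qed.

Lemma sum_words_le_cond (V : nmodType) (G : seq 'I_d -> V) n :
  \sum_(w <- WL n) G w = G [::] + \sum_(w <- newords_le (enum 'I_d) n) G w.
Proof. by rewrite sum_words_le sum_newords_le big_ord_recl sum_words0. Qed.

Lemma sum_words_le_filter (V : nmodType) (G : seq 'I_d -> V) m n : (m <= n)%N ->
  \sum_(w <- WL n | (size w <= m)%N) G w = \sum_(w <- WL m) G w.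
Proof.
move=> mn; rewrite /words_le !big_flatten !big_map.
pose A k := \sum_(w <- W k | (size w <= m)%N) G w.
transitivity (\sum_(k <- iota 0 m.+1) A k + \sum_(k <- iota m.+1 (n - m)) A k).
  by rewrite -[LHS]/(\sum_(k <- iota 0 n.+1) A k) -big_cat -(iotaD 0) addSn subnKC.
rewrite [X in _ + X]big1_seq ?addr0.
  apply: eq_big_seq => k; rewrite mem_iota add0n ltnS => /andP[_ km].
  rewrite /A [LHS]big_seq_cond [RHS]big_seq_cond; apply: eq_bigl => w.
  by rewrite mem_words; case: eqP => //= ->.
move=> k; rewrite mem_iota => /andP[_ /andP[mk _]].
rewrite /A big_seq_cond big1 // => w; rewrite mem_words => /andP[/eqP -> km].
by rewrite ltnNge km in mk.
Qed.

(** The common shape of Taylor polynomials, Riemann terms and pushforward coefficients; the weight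
    1/|w|! is the one for which products of such sums correspond to splittings of words. *)
Definition wexp n F : R := \sum_(w <- WL n) (size w)`!%:R^-1 * F w.

Lemma wexpE n F : wexp n F = \sum_(k < n.+1) k`!%:R^-1 * \sum_(w <- W k) F w.
Proof.
rewrite /wexp sum_words_le; apply: eq_bigr => k _; rewrite mulr_sumr.
by apply: eq_big_seq => w; rewrite mem_words => /eqP ->.
Qed.

Lemma eq_wexp n F G : (forall w, (size w <= n)%N -> F w = G w) -> wexp n F = wexp n G.
Proof.
by move=> H; apply: eq_big_seq => w; rewrite mem_words_le => wn; rewrite H.
Qed.

Lemma wexpD n F G : wexp n (fun w => F w + G w) = wexp n F + wexp n G.
Proof. by rewrite -big_split; apply: eq_bigr => w _; rewrite mulrDr. Qed.

Lemma wexpZ n c F : wexp n (fun w => c * F w) = c * wexp n F.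
Proof. by rewrite /wexp mulr_sumr; apply: eq_bigr => w _; rewrite mulrCA. Qed.

Lemma wexpZr n c F : wexp n (fun w => F w * c) = wexp n F * c.
Proof. by rewrite /wexp mulr_suml; apply: eq_bigr => w _; rewrite mulrA. Qed.

Lemma wexp_sum (I : Type) (r : seq I) (P : pred I) n (F : I -> seq 'I_d -> R) :
  wexp n (fun w => \sum_(i <- r | P i) F i w) = \sum_(i <- r | P i) wexp n (F i).
Proof.
by rewrite /wexp exchange_big /=; apply: eq_bigr => w _; rewrite mulr_sumr.
Qed.

Lemma wexp0 n : wexp n (fun=> 0) = 0.
Proof. by rewrite /wexp big1 // => w _; rewrite mulr0. Qed.

Lemma wexp_nil n F : wexp n F = F [::] + wexp n (fun w => if w is [::] then 0 else F w).
Proof.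
rewrite {1}/wexp sum_words_le_cond /= fact0 invr1 mul1r; congr (_ + _).
rewrite /wexp sum_words_le_cond /= mulr0 add0r.
by apply: eq_big_seq => -[|x w]; rewrite mem_newords_le.
Qed.

Lemma wexp_newords n F : wexp n (fun w => if w is [::] then 0 else F w) =
  \sum_(w <- newords_le (enum 'I_d) n) (size w)`!%:R^-1 * F w.
Proof.
rewrite /wexp sum_words_le_cond /= mulr0 add0r.
by apply: eq_big_seq => -[|x w]; rewrite mem_newords_le.
Qed.

Lemma wexp_widen m n F : (m <= n)%N -> (forall w, (m < size w)%N -> F w = 0) ->
  wexp n F = wexp m F.
Proof.
move=> mn H; rewrite /wexp -(sum_words_le_filter _ mn) [LHS](bigID (fun w => (size w <= m)%N)) /=.
by rewrite [X in _ + X]big1 ?addr0 // => w; rewrite -ltnNge => /H ->; rewrite mulr0.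
Qed.

Lemma sum_splits (V : nmodType) (G : seq 'I_d -> seq 'I_d -> V) x w :
  \sum_(IJ <- splits (x :: w)) G IJ.1 IJ.2 =
  \sum_(IJ <- splits w) (G (x :: IJ.1) IJ.2 + G IJ.1 (x :: IJ.2)).
Proof.
rewrite /= big_flatten /= big_map; apply: eq_bigr => IJ _.
by rewrite !big_cons big_nil addr0.
Qed.

Lemma splits_perm w I J : (I, J) \in splits w -> perm_eq (I ++ J) w.
Proof.
elim: w I J => [|x w IH] I J; first by rewrite inE => /eqP[-> ->].
move=> /flatten_mapP[[I' J'] /IH pw]; rewrite !inE => /orP[] /eqP[-> ->].
  by rewrite cat_cons perm_cons.
apply: perm_trans (permEl (perm_catCA I' [:: x] J')) _.
by rewrite perm_cons.
Qed.

(** Words of lengths a and n - a interleave in binomially many ways; the recursion on the first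
    letter is Pascal's rule. *)
Lemma sum_words_splits (G : seq 'I_d -> seq 'I_d -> R) n :
  \sum_(w <- W n) \sum_(IJ <- splits w) G IJ.1 IJ.2 =
  \sum_(a < n.+1) 'C(n, a)%:R * \sum_(I <- W a) \sum_(J <- W (n - a)) G I J.
Proof.
elim: n G => [|n IH] G.
  by rewrite sum_words0 /= big_seq1 big_ord1 !sum_words0 bin0 mul1r.
rewrite sum_wordsS.
transitivity (\sum_(x : 'I_d)
  (\sum_(w <- W n) \sum_(IJ <- splits w) G (x :: IJ.1) IJ.2 +
   \sum_(w <- W n) \sum_(IJ <- splits w) G IJ.1 (x :: IJ.2))).
  apply: eq_bigr => x _; rewrite -big_split; apply: eq_bigr => w _.
  by rewrite sum_splits big_split.
rewrite big_split /=.
transitivity (\sum_(a < n.+1) 'C(n, a)%:R * \sum_(I <- W a.+1) \sum_(J <- W (n - a)) G I J +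
   \sum_(a < n.+1) 'C(n, a)%:R * \sum_(I <- W a) \sum_(J <- W (n - a).+1) G I J).
  congr (_ + _).
    rewrite (eq_bigr _ (fun x _ => IH (fun I J => G (x :: I) J))) exchange_big /=.
    by apply: eq_bigr => a _; rewrite sum_wordsS mulr_sumr.
  rewrite (eq_bigr _ (fun x _ => IH (fun I J => G I (x :: J)))) exchange_big /=.
  apply: eq_bigr => a _; rewrite -mulr_sumr; congr (_ * _).
  by rewrite exchange_big /=; apply: eq_bigr => I _; rewrite sum_wordsS.
rewrite [RHS]big_ord_recl /= bin0 ?subn0 mul1r.
rewrite [X in _ + X = _]big_ord_recl /= bin0 ?subn0 mul1r addrCA; congr (_ + _).
transitivity (\sum_(a < n.+1) ('C(n, a)%:R * \sum_(I <- W a.+1) \sum_(J <- W (n - a)) G I J +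
   'C(n, a.+1)%:R * \sum_(I <- W a.+1) \sum_(J <- W (n - a)) G I J)).
  rewrite big_split /=; congr (_ + _).
  rewrite [RHS]big_ord_recr /= bin_small // mul0r addr0.
  by apply: eq_bigr => a _; rewrite -(subnSK (ltn_ord a)).
by apply: eq_bigr => a _; rewrite -mulrDl -natrD addnC -binS.
Qed.

Lemma triangular_sum (V : nmodType) (G : nat -> nat -> V) n :
  \sum_(k < n.+1) \sum_(a < k.+1) G a (k - a)%N =
  \sum_(a < n.+1) \sum_(b < (n - a).+1) G a b.
Proof.
elim: n => [|n IH]; first by rewrite !big_ord1.
rewrite big_ord_recr /= IH [X in _ + X]big_ord_recr /= subnn.
rewrite [RHS]big_ord_recr /= subnn big_ord1 addrA -big_split /=; congr (_ + _).
by apply: eq_bigr => a _; rewrite (subSn (leq_ord a)) [RHS]big_ord_recr.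
Qed.

(** The number of interleavings turns 1/n! into 1/(a! (n - a)!), as in the product of two
    exponential series. *)
Lemma wexp_splits n (G : seq 'I_d -> seq 'I_d -> R) :
  wexp n (fun w => \sum_(IJ <- splits w) G IJ.1 IJ.2) =
  wexp n (fun I => wexp (n - size I) (G I)).
Proof.
rewrite wexpE.
transitivity (\sum_(k < n.+1) \sum_(a < k.+1) a`!%:R^-1 *
    ((k - a)`!%:R^-1 * \sum_(I <- W a) \sum_(J <- W (k - a)) G I J)).
  apply: eq_bigr => k _; rewrite sum_words_splits mulr_sumr; apply: eq_bigr => a _.
  rewrite !mulrA; congr (_ * _).
  have /bin_fact /(congr1 (fun m => m%:R : R)) : (a <= k)%N by rewrite -ltnS.
  rewrite !natrM => E.
  have nz m : m`!%:R != 0 :> R by rewrite pnatr_eq0 -lt0n fact_gt0.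
  rewrite -E; field; rewrite !nz /= pnatr_eq0 -lt0n.
  by rewrite bin_gt0 leq_ord.
rewrite (triangular_sum (fun a b => a`!%:R^-1 *
    (b`!%:R^-1 * \sum_(I <- W a) \sum_(J <- W b) G I J))) wexpE.
apply: eq_bigr => a _; rewrite -mulr_sumr; congr (_ * _).
transitivity (\sum_(I <- W a) wexp (n - a) (G I)).
  under [RHS]eq_bigr do rewrite wexpE.
  by rewrite exchange_big /=; apply: eq_bigr => b _; rewrite mulr_sumr.
by apply: eq_big_seq => I; rewrite mem_words => /eqP ->.
Qed.

End WordSums.

Definition symmetric_fun (T : eqType) (V : Type) (S : seq T -> V) :=
  forall w w', perm_eq w w' -> S w = S w'.

#[local] Opaque derive derivable.

Section Jets.
Context {R : realType} {d : nat}.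
Implicit Types (U : set 'rV[R]_d) (f g : 'rV[R]_d -> R) (x y z : 'rV[R]_d)
  (S t : seq 'I_d -> R).

Local Notation W := (words (enum 'I_d)).
Local Notation e_ i := (delta_mx 0 i : 'rV[R]_d).

Lemma pds_mul U f g w x : open U -> smooth_on U f -> smooth_on U g -> U x ->
  pds w (fun y => f y * g y) x = \sum_(IJ <- splits w) pds IJ.1 f x * pds IJ.2 g x.
Proof.
move=> oU sf sg; elim: w x => [|i w IH] x Ux; first by rewrite /= big_seq1.
rewrite (sum_splits (fun I J => pds I f x * pds J g x)).
rewrite [LHS]/= (pd_local i oU Ux IH) pd_sumE; last first.
  move=> IJ _; apply: derivableM; apply: smooth_derivable Ux; exact: smooth_pds.
apply: eq_bigr => IJ _; rewrite pdM //; apply: smooth_derivable Ux; exact: smooth_pds.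
Qed.

(** For S the products of increments this is a Taylor polynomial; for S the branches of a rough path
    it is a summand of a Riemann term; for S the indicator of a multiset it is a coefficient of the
    Ito integrand. *)
Definition jet n f x S : R := wexp n (fun w => pds w f x * S w).

Lemma jetD U n f g x S : open U -> smooth_on U f -> smooth_on U g -> U x ->
  jet n (fun y => f y + g y) x S = jet n f x S + jet n g x S.
Proof.
move=> oU sf sg Ux; rewrite /jet -wexpD; apply: eq_wexp => w _.
by rewrite (pdsD _ oU sf sg Ux) mulrDl.
Qed.

Lemma jetZ U n (c : R) f x S : open U -> smooth_on U f -> U x ->
  jet n (fun y => c * f y) x S = c * jet n f x S.
Proof.
move=> oU sf Ux; rewrite /jet -wexpZ; apply: eq_wexp => w _.
by rewrite (pdsZ _ _ oU sf Ux) mulrA.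
Qed.

Lemma jet_sum U n (I : Type) (r : seq I) (P : pred I) (F : I -> 'rV[R]_d -> R) x S :
  open U -> (forall i, P i -> smooth_on U (F i)) -> U x ->
  jet n (fun y => \sum_(i <- r | P i) F i y) x S = \sum_(i <- r | P i) jet n (F i) x S.
Proof.
move=> oU sF Ux; rewrite /jet -wexp_sum; apply: eq_wexp => w _.
by rewrite (pds_sum _ _ oU sF Ux) mulr_suml.
Qed.

Lemma jet_local U n f g x S : open U -> U x -> (forall y, U y -> f y = g y) ->
  jet n f x S = jet n g x S.
Proof. by move=> oU Ux H; apply: eq_wexp => w _; rewrite (pds_local w oU Ux H). Qed.

Lemma symmetric_cat (T : eqType) (V : Type) (F : seq T -> V) I :
  symmetric_fun F -> symmetric_fun (fun w => F (I ++ w)).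
Proof. by move=> sF w w' ww'; apply: sF; rewrite perm_cat2l. Qed.

(** By Leibniz the derivative along w spreads over the splittings (I, J) of w; symmetry of S
    replaces w by I ++ J and sets the two words free. *)
Lemma jet_mul U n f g x S : open U -> smooth_on U f -> smooth_on U g -> U x ->
  symmetric_fun S ->
  jet n (fun y => f y * g y) x S =
  wexp n (fun I => pds I f x * jet (n - size I) g x (fun w => S (I ++ w))).
Proof.
move=> oU sf sg Ux sS.
transitivity (wexp n (fun w => \sum_(IJ <- splits w)
    (pds IJ.1 f x * (pds IJ.2 g x * S (IJ.1 ++ IJ.2))))).
  apply: eq_wexp => w _; rewrite (pds_mul _ oU sf sg Ux) mulr_suml.
  apply: eq_big_seq => -[I J] /= /splits_perm pw; rewrite mulrA.
  by rewrite (sS _ _ pw).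
rewrite (wexp_splits n (fun I J => pds I f x * (pds J g x * S (I ++ J)))).
by apply: eq_wexp => I _; rewrite wexpZ.
Qed.

Definition mon z w : R := \prod_(i <- w) z 0 i.

Definition taypoly n t x : 'rV[R]_d -> R :=
  fun y => wexp n (fun w => t w * mon (y - x) w).

Lemma smooth_shift_coord U x j : open U -> smooth_on U (fun y => (y - x) 0 j).
Proof.
move=> oU; apply: (smooth_local oU _ (smoothD oU (smooth_coord j) (smooth_cst (- x 0 j)))).
by move=> y _; rewrite !mxE.
Qed.

Lemma smooth_mon U x w : open U -> smooth_on U (fun y => mon (y - x) w).
Proof. by move=> oU; apply: smooth_prod => // i _; exact: smooth_shift_coord. Qed.

Lemma smooth_taypoly U n t x : open U -> smooth_on U (taypoly n t x).
Proof.
move=> oU; apply: smooth_sum => // w _; apply: smoothZ => //; apply: smoothZ => //.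
exact: smooth_mon.
Qed.

Lemma pd_shift_coord x i j y : pd i (fun y => (y - x) 0 j) y = (i == j)%:R.
Proof.
have oT : open [set: 'rV[R]_d] by exact: openT.
rewrite (pd_local (U := setT) (g := fun y => y 0 j + - x 0 j)) //; last by move=> z _; rewrite !mxE.
have dc := smooth_derivable (U := setT) (i := i) (x := y) (smooth_coord j) I.
have dk := smooth_derivable (U := setT) (i := i) (x := y) (smooth_cst (- x 0 j)) I.
by rewrite (pdD dc dk) pd_coord pd_cst addr0.
Qed.

(** All n + 1 slots contribute equally because t is symmetric; the induction splits off the first
    slot. *)
Lemma pd_homogeneous n t x i y : symmetric_fun t ->
  pd i (fun y => \sum_(w <- W n.+1) t w * mon (y - x) w) y =
  n.+1%:R * \sum_(w <- W n) t (i :: w) * mon (y - x) w.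
Proof.
have oT : open [set: 'rV[R]_d] by exact: openT.
have sQ m (t' : seq 'I_d -> R) : smooth_on setT (fun y => \sum_(w <- W m) t' w * mon (y - x) w).
  by apply: smooth_sum => // w _; apply: smoothZ => //; exact: smooth_mon.
have QS m (t' : seq 'I_d -> R) z : \sum_(w <- W m.+1) t' w * mon (z - x) w =
    \sum_j (z - x) 0 j * \sum_(w <- W m) t' (j :: w) * mon (z - x) w.
  rewrite sum_wordsS; apply: eq_bigr => j _; rewrite mulr_sumr; apply: eq_bigr => w _.
  by rewrite /mon big_cons mulrCA.
have step m (t' : seq 'I_d -> R) z :
    pd i (fun y => \sum_(w <- W m.+1) t' w * mon (y - x) w) z =
    \sum_(w <- W m) t' (i :: w) * mon (z - x) w +
    \sum_j (z - x) 0 j * pd i (fun y => \sum_(w <- W m) t' (j :: w) * mon (y - x) w) z.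
  rewrite (pd_local (U := setT) i oT I (fun y _ => QS m t' y)).
  have dj j : derivable (fun y => (y - x) 0 j) z (e_ i).
    exact: (smooth_derivable (smooth_shift_coord x j oT)).
  have dQ j : derivable (fun y => \sum_(w <- W m) t' (j :: w) * mon (y - x) w) z (e_ i).
    exact: (smooth_derivable (sQ m (fun w => t' (j :: w)))).
  rewrite pd_sumE; last by move=> j _; exact: (derivableM (dj j) (dQ j)).
  under eq_bigr => j _ do rewrite (pdM (dj j) (dQ j)) pd_shift_coord.
  rewrite big_split /=; congr (_ + _).
  rewrite (bigD1 i) //= eqxx mul1r [X in _ + X]big1 ?addr0 // => j ji.
  by rewrite eq_sym (negPf ji) mul0r.
elim: n t y => [|n IH] t y st.
  rewrite step mul1r [X in _ + X]big1 ?addr0 // => j _.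
  rewrite (pd_local (U := setT) (g := fun=> t [:: j]) i oT I) ?pd_cst ?mulr0 //.
  by move=> z _; rewrite sum_words0 /mon big_nil mulr1.
rewrite step.
transitivity (\sum_(w <- W n.+1) t (i :: w) * mon (y - x) w +
   n.+1%:R * \sum_(w <- W n.+1) t (i :: w) * mon (y - x) w).
  congr (_ + _); rewrite (QS n (fun w => t (i :: w))) mulr_sumr; apply: eq_bigr => j _.
  rewrite IH; last by move=> w w' ww'; apply: st; rewrite perm_cons.
  rewrite mulrCA; congr (_ * (_ * _)); apply: eq_bigr => w _; congr (_ * _).
  by apply: st; exact: (permEl (perm_catCA [:: j] [:: i] w)).
by rewrite -[in RHS]natr1 mulrDl mul1r addrC.
Qed.

Lemma pd_taypoly n t x i y : symmetric_fun t ->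
  pd i (taypoly n.+1 t x) y = taypoly n (fun w => t (i :: w)) x y.
Proof.
move=> st; have oT : open [set: 'rV[R]_d] by exact: openT.
have sQ m (t' : seq 'I_d -> R) : smooth_on setT (fun y => \sum_(w <- W m) t' w * mon (y - x) w).
  by apply: smooth_sum => // w _; apply: smoothZ => //; exact: smooth_mon.
have E (z : 'rV[R]_d) : setT z -> taypoly n.+1 t x z =
    \sum_(k < n.+2) k`!%:R^-1 * \sum_(w <- W k) t w * mon (z - x) w.
  by move=> _; rewrite /taypoly wexpE.
rewrite (pd_local i oT I E) pd_sumE; last first.
  move=> k _.
  exact: (smooth_derivable (smoothM oT (smooth_cst _) (sQ k t))).
rewrite big_ord_recl [X in X + _](_ : _ = 0) ?add0r; last first.
  rewrite (pd_local (U := setT) (g := fun=> 0`!%:R^-1 * t [::]) i oT I) ?pd_cst //.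
  by move=> z _; rewrite sum_words0 /mon big_nil mulr1.
rewrite /taypoly wexpE; apply: eq_bigr => k _.
have dk := smooth_derivable (U := setT) (i := i) (x := y)
  (smooth_cst ((lift ord0 k)`!%:R^-1 : R)) I.
have dQ := smooth_derivable (U := setT) (i := i) (x := y) (sQ (lift ord0 k) t) I.
rewrite (pdM dk dQ) pd_cst mul0r add0r.
rewrite pd_homogeneous // mulrA; congr (_ * _).
by rewrite factS natrM invfM mulrAC mulVf ?mul1r // pnatr_eq0.
Qed.

Lemma taypoly_center n t x : taypoly n t x x = t [::].
Proof.
rewrite /taypoly subrr wexp_nil [X in _ + X](_ : _ = 0).
  by rewrite /mon big_nil mulr1 addr0.
rewrite -[RHS](wexp0 (d := d) n); apply: eq_wexp => -[//|i w] _.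
by rewrite /mon big_cons mxE mul0r mulr0.
Qed.

Lemma pds_taypoly n t x w : symmetric_fun t -> (size w <= n)%N ->
  pds w (taypoly n t x) x = t w.
Proof.
elim: n w t => [|n IH] w t st.
  by case: w => // _; exact: taypoly_center.
case/lastP: w => [|w i]; first by move=> _; exact: taypoly_center.
rewrite size_rcons ltnS pds_rcons => wn.
have oT : open [set: 'rV[R]_d] by exact: openT.
rewrite (pds_local (U := setT) w oT I (fun y _ => pd_taypoly n x i y st)).
rewrite IH //; last by move=> u u' uu'; apply: st; rewrite perm_cons.
by apply: st; rewrite perm_sym perm_rcons.
Qed.

Lemma symmetric_pds U f x : open U -> U x -> smooth_on U f ->
  symmetric_fun (fun w => pds w f x).
Proof. by move=> oU Ux sf w w'; exact: (pds_perm oU Ux sf). Qed.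

End Jets.

(** * The Faa di Bruno formula for jets *)

Section JetComposition.
Context {R : realType} {d e : nat}.
Variables (U : set 'rV[R]_d) (V : set 'rV[R]_e) (h : 'rV[R]_d -> 'rV[R]_e).
Hypotheses (oU : open U) (oV : open V) (UV : forall x, U x -> V (h x))
  (sh : smooth_map_on U h).
Implicit Types (phi : 'rV[R]_e -> R) (v : 'rV[R]_d -> R) (S : seq 'I_d -> R).

Lemma smooth_h_comp phi : smooth_on V phi -> smooth_on U (phi \o h).
Proof. by move=> sphi; exact: (smooth_comp oU oV UV sphi sh). Qed.

(** By the chain rule, the derivatives of the composite at x up to order n are combinations of those
    of phi at h x up to order n. The induction treats the innermost derivative first. *)
Lemma pds_comp_vanish n phi x w : smooth_on V phi -> U x ->
  (forall b, (size b <= n)%N -> pds b phi (h x) = 0) ->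
  (size w <= n)%N -> pds w (phi \o h) x = 0.
Proof.
elim: n w phi => [|n IH] w phi sphi Ux H.
  by case: w => // _; exact: (H [::]).
case/lastP: w => [|w i]; first by move=> _; exact: (H [::]).
rewrite size_rcons ltnS pds_rcons => wn.
rewrite (pds_local w oU Ux (fun y Uy => pd_comp i oV Uy (UV Uy) sphi sh)).
have s1 k : smooth_on U (fun y => pd k phi (h y)) by exact: smooth_h_comp (smooth_pd k sphi).
have s2 k : smooth_on U (pd i (fun y => h y 0 k)) by exact: smooth_pd (sh k).
rewrite (pds_sum _ _ oU _ Ux); last by move=> k _; exact: (smoothM oU (s1 k) (s2 k)).
rewrite big1 // => k _; rewrite (pds_mul _ oU (s1 k) (s2 k) Ux).
rewrite big1_seq // => -[I J] /= /splits_perm /perm_size; rewrite size_cat => IJ.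
have Hk b : (size b <= n)%N -> pds b (pd k phi) (h x) = 0.
  by move=> bn; rewrite -pds_rcons H // size_rcons ltnS.
have In : (size I <= n)%N by apply: leq_trans wn; rewrite -IJ leq_addr.
have E : pds I (fun y => pd k phi (h y)) x = 0.
  exact: (IH I (pd k phi) (smooth_pd k sphi) Ux Hk In).
by rewrite E mul0r.
Qed.

Lemma smooth_hprod x (b : seq 'I_e) :
  smooth_on U (fun y => \prod_(k <- b) (h y 0 k - h x 0 k)).
Proof.
by apply: smooth_prod => // k _; exact: (smoothB oU (sh k) (smooth_cst _)).
Qed.

(** This replaces sums over set partitions: phi is exchanged for its Taylor polynomial at h x, whose
    remainder has no jet up to order m. Any m >= n is allowed, since the rough integrand of a letter
    k is expanded to the order N - lwt k, which need not be the order of the jet on the other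
    side. *)
Lemma jet_comp m n phi v x S : smooth_on V phi -> smooth_on U v -> U x -> (n <= m)%N ->
  jet n (fun y => phi (h y) * v y) x S =
  \sum_(b <- words_le (enum 'I_e) m) (size b)`!%:R^-1 *
    (pds b phi (h x) * jet n (fun y => (\prod_(k <- b) (h y 0 k - h x 0 k)) * v y) x S).
Proof.
move=> sphi sv Ux nm; have Vhx := UV Ux.
pose t b := pds b phi (h x).
have st : symmetric_fun t := symmetric_pds oV Vhx sphi.
pose P := taypoly m t (h x); pose rho y := phi y - P y.
have sP : smooth_on V P := smooth_taypoly m t (h x) oV.
have srho : smooth_on V rho := smoothB oV sphi sP.
have rho0 b : (size b <= m)%N -> pds b rho (h x) = 0.
  by move=> bm; rewrite (pdsB _ oV sphi sP Vhx) (pds_taypoly _ st bm) subrr.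
have sPh := smooth_h_comp sP; have srh := smooth_h_comp srho.
transitivity (jet n (fun y => P (h y) * v y + rho (h y) * v y) x S).
  by apply: (jet_local _ _ oU Ux) => y _; rewrite /rho -mulrDl addrCA subrr addr0.
rewrite (jetD _ _ oU (smoothM oU sPh sv) (smoothM oU srh sv) Ux).
rewrite [X in _ + X](_ : _ = 0) ?addr0; last first.
  rewrite -[RHS](wexp0 (d := d) n); apply: eq_wexp => w wn.
  rewrite (pds_mul _ oU srh sv Ux) big1_seq ?mul0r // => -[I J] /= /splits_perm /perm_size.
  rewrite size_cat => IJ; rewrite (@pds_comp_vanish m rho) ?mul0r //.
  by apply: leq_trans nm; apply: leq_trans wn; rewrite -IJ leq_addr.
have sb b : smooth_on U (fun y => (\prod_(k <- b) (h y 0 k - h x 0 k)) * v y).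
  exact: (smoothM oU (smooth_hprod x b) sv).
transitivity (jet n (fun y => \sum_(b <- words_le (enum 'I_e) m)
   ((size b)`!%:R^-1 * t b) * ((\prod_(k <- b) (h y 0 k - h x 0 k)) * v y)) x S).
  apply: (jet_local _ _ oU Ux) => y _; rewrite /P /taypoly /wexp mulr_suml.
  apply: eq_bigr => b _; rewrite /mon !mulrA; congr (_ * _ * _).
  by apply: eq_bigr => k _; rewrite !mxE.
rewrite (jet_sum _ _ _ oU _ Ux); last by move=> b _; exact: (smoothZ _ oU (sb b)).
by apply: eq_bigr => b _; rewrite (jetZ _ _ _ oU (sb b) Ux) mulrA.
Qed.

(* The sum over non-empty words g_1, ..., g_m of the products of the
   (size g_j)!^-1 * pds g_j h^(b_j), against S (g_1 ++ ... ++ g_m ++ .). *)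
Fixpoint multi_jet v x (b : seq 'I_e) n S : R :=
  if b is k :: b' then
    \sum_(g <- newords_le (enum 'I_d) n) (size g)`!%:R^-1 *
      (pds g (fun y => h y 0 k) x * multi_jet v x b' (n - size g)%N (fun w => S (g ++ w)))
  else jet n v x S.

(** The product rule for jets, one factor at a time. Each factor vanishes at x, which removes the
    empty word; along non-empty words the constant h x 0 k is lost. *)
Lemma jet_hprod v x b n S : smooth_on U v -> U x -> symmetric_fun S ->
  jet n (fun y => (\prod_(k <- b) (h y 0 k - h x 0 k)) * v y) x S = multi_jet v x b n S.
Proof.
move=> sv Ux; elim: b n S => [|k b IH] n S sS /=.
  by apply: (jet_local _ _ oU Ux) => y _; rewrite big_nil mul1r.
have shk : smooth_on U (fun y => h y 0 k - h x 0 k).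
  exact: (smoothB oU (sh k) (smooth_cst _)).
have sb := smoothM oU (smooth_hprod x b) sv.
transitivity (jet n (fun y => (h y 0 k - h x 0 k) *
    ((\prod_(k <- b) (h y 0 k - h x 0 k)) * v y)) x S).
  by apply: (jet_local _ _ oU Ux) => y _; rewrite big_cons mulrA.
rewrite (jet_mul _ oU shk sb Ux sS) -wexp_newords; apply: eq_wexp => -[|i g] gn.
  by rewrite /= subrr mul0r.
rewrite IH; last exact: symmetric_cat.
congr (_ * _); rewrite (pdsB _ oU (sh k) (smooth_cst _) Ux) pds_cst.
by rewrite subr0.
Qed.

End JetComposition.

(** * Taylor's formula and realisation of jets *)

Section TaylorBound.
Context {R : realType} {d : nat}.
Implicit Types (U K : set 'rV[R]_d) (f g : 'rV[R]_d -> R) (x y z v : 'rV[R]_d).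

Lemma near0P (P : R -> Prop) :
  (\forall e \near 0^'+, P e) <-> exists2 r : R, 0 < r & forall e, 0 < e -> e < r -> P e.
Proof.
split=> [[r /= r0 H]|[r r0 H]].
  exists r => // e e0 er; apply: H => //=.
  by rewrite sub0r normrN gtr0_norm.
exists r => //= e /=; rewrite sub0r normrN => er e0.
by apply: H => //; rewrite gtr0_norm in er.
Qed.

Lemma mvt_smooth U g x v : open U -> smooth_on U g ->
  (forall c, 0 <= c <= 1 -> U (x + c *: v)) ->
  exists2 c, 0 <= c <= 1 & g (x + v) - g x = \sum_i v 0 i * pd i g (x + c *: v).
Proof.
move=> oU sg HU.
have D c : 0 <= c <= 1 -> differentiable g (x + c *: v) /\
    'D_v g (x + c *: v) = \sum_i v 0 i * pd i g (x + c *: v).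
  move=> /HU Uc; have [dg dgE] := smooth_diff oU Uc sg; split => //.
  by rewrite -dgE; exact: deriveE.
have [r r01|c c01] := @mvt_line R d g x v 1.
  by rewrite mulr1; apply: diff_derivable; exact: (D r r01).1.
by rewrite scale1r mul1r mulr1 (D c c01).2; exists c.
Qed.

Definition trem n f x y : R := f y - taypoly n (fun w => pds w f x) x y.

Lemma trem_self n f x : trem n f x x = 0.
Proof. by rewrite /trem taypoly_center subrr. Qed.

Lemma smooth_trem U n f x : open U -> smooth_on U f -> smooth_on U (trem n f x).
Proof. by move=> oU sf; exact: (smoothB oU sf (smooth_taypoly n _ x oU)). Qed.

Lemma pd_trem0 U f x i y : open U -> smooth_on U f -> U y ->
  pd i (trem 0 f x) y = pd i f y.
Proof.
move=> oU sf Uy.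
have E z : U z -> trem 0 f x z = f z + - f x.
  move=> _; rewrite /trem /taypoly wexp_nil /mon big_nil mulr1.
  by rewrite /wexp /words_le /= big_seq1 /= mulr0 addr0.
rewrite (pd_local i oU Uy E).
rewrite (pdD (smooth_derivable sf Uy) (smooth_derivable (smooth_cst (- f x)) Uy)).
by rewrite pd_cst addr0.
Qed.

Lemma pd_tremS U n f x i y : open U -> smooth_on U f -> U x -> U y ->
  pd i (trem n.+1 f x) y = trem n (pd i f) x y.
Proof.
move=> oU sf Ux Uy.
have sT := smooth_taypoly n.+1 (fun w => pds w f x) x oU.
rewrite /trem; have E := pdD (smooth_derivable sf Uy) (smooth_derivable (smoothN oU sT) Uy).
rewrite E; congr (_ + _).
rewrite (pdN (smooth_derivable sT Uy)) (pd_taypoly _ _ _ _ (symmetric_pds oU Ux sf)).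
congr (- _); rewrite /taypoly; apply: eq_wexp => w _; congr (_ * _).
rewrite -pds_rcons; apply: (pds_perm oU Ux sf).
by rewrite perm_sym perm_rcons.
Qed.

(** A single small parameter e is the radius and, inverted, the constant, so that both can be
    adjusted together. Using the hypothesis at e (d + 1) absorbs the factor d that arises from the
    sum over coordinates in the mean value theorem. *)
Lemma taylor_step U n f x0 : open U -> smooth_on U f -> U x0 ->
  (\forall e \near 0^'+, forall i x y, `|x - x0| < e -> `|y - x0| < e ->
    `|pd i (trem n f x) y| <= e^-1 * `|y - x| ^+ n) ->
  \forall e \near 0^'+, forall x y, `|x - x0| < e -> `|y - x0| < e ->
    `|trem n f x y| <= e^-1 * `|y - x| ^+ n.+1.
Proof.
move=> oU sf Ux0 /near0P[r rp Hr].
have /nbhs_ballP[r0 /= r0p Hr0] := open_nbhs_nbhs (conj oU Ux0).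
have ballU y : `|y - x0| < r0 -> U y.
  by move=> yr; apply: Hr0; rewrite -ball_normE /= distrC.
apply/near0P; pose m := Num.min r0 r; have m0 : 0 < m by rewrite lt_min r0p rp.
exists (m / d.+1%:R); first by rewrite divr_gt0.
move=> e e0 em x y xe ye; pose v := y - x.
have em' : e * d.+1%:R < m by rewrite -ltr_pdivlMr.
have ee : e <= e * d.+1%:R by rewrite ler_peMr ?ler1n // ltW.
have [mr0 mr] : e * d.+1%:R < r0 /\ e * d.+1%:R < r.
  by move: em'; rewrite /m lt_min => /andP[].
have ed0 : 0 < e * d.+1%:R by rewrite mulr_gt0.
have seg c : 0 <= c <= 1 -> `|x + c *: v - x0| < e.
  move=> /andP[c0 c1].
  have -> : x + c *: v - x0 = (1 - c) *: (x - x0) + c *: (y - x0).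
    by apply/rowP => j; rewrite !mxE; ring.
  apply: le_lt_trans (ler_normD _ _) _.
  rewrite !normrZ (ger0_norm c0) ger0_norm ?subr_ge0 //.
  have [->|cn0] := eqVneq c 0; first by rewrite subr0 mul1r mul0r addr0.
  have cp : 0 < c by rewrite lt_def cn0.
  rewrite [ltRHS](_ : e = (1 - c) * e + c * e); last by ring.
  apply: ler_ltD.
    by apply: ler_wpM2l; rewrite ?subr_ge0 // ltW.
  by rewrite ltr_pM2l.
have segU c : 0 <= c <= 1 -> U (x + c *: v).
  by move=> /seg cs; apply: ballU; apply: lt_trans cs _; exact: le_lt_trans mr0.
have [c c01] := mvt_smooth oU (smooth_trem n x oU sf) segU.
rewrite trem_self subr0 /v [x + _]addrC subrK -/v => ->.
have le1 i : `|v 0 i * pd i (trem n f x) (x + c *: v)| <=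
    `|v| * ((e * d.+1%:R)^-1 * `|v| ^+ n).
  rewrite normrM; apply: ler_pM => //; first exact: normr_row_ge.
  have h1 : `|x - x0| < e * d.+1%:R by exact: lt_le_trans ee.
  have h2 : `|x + c *: v - x0| < e * d.+1%:R by apply: lt_le_trans ee; exact: seg.
  apply: le_trans (Hr _ ed0 mr i x _ h1 h2) _.
  apply: ler_wpM2l; first by rewrite invr_ge0 ltW.
  rewrite addrAC subrr add0r normrZ; case/andP: c01 => c0 c1; rewrite (ger0_norm c0).
  by apply: lerXn2r; rewrite ?nnegrE ?mulr_ge0 // ler_piMl.
apply: le_trans (ler_norm_sum _ _ _) _; apply: le_trans (ler_sum _ (fun i _ => le1 i)) _.
rewrite sumr_const card_ord -[_ *+ d]mulr_natr mulrCA -exprS mulrAC.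
apply: ler_wpM2r; first exact: exprn_ge0.
rewrite invfM -mulrA ler_piMr ?invr_ge0 ?(ltW e0) //.
by rewrite mulrC ler_pdivrMr ?ltr0n // mul1r ler_nat.
Qed.

Lemma taylor_near U n f x0 : open U -> smooth_on U f -> U x0 ->
  \forall e \near 0^'+, forall x y, `|x - x0| < e -> `|y - x0| < e ->
    `|trem n f x y| <= e^-1 * `|y - x| ^+ n.+1.
Proof.
move=> oU + Ux0.
have /nbhs_ballP[r0 /= r0p Hr0] := open_nbhs_nbhs (conj oU Ux0).
have ballU y : `|y - x0| < r0 -> U y.
  by move=> yr; apply: Hr0; rewrite -ball_normE /= distrC.
elim: n f => [|n IH] f sf; apply: (taylor_step oU sf Ux0).
- apply: filter_forall => i; apply/near0P.
  have cp := smooth_cont (smooth_pd i sf) Ux0.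
  have /nbhs_ballP[r /= rp Hr] := continuous_near cp ltr01.
  pose B := `|pd i f x0| + 1.
  have B0 : 0 < B by rewrite ltr_wpDl.
  exists (Num.min r0 (Num.min r B^-1)); first by rewrite !lt_min r0p rp invr_gt0 B0.
  move=> e e0; rewrite !lt_min => /and3P[er0 er eB] x y xe ye.
  have Uy : U y by apply: ballU; exact: lt_trans er0.
  rewrite (pd_trem0 x i oU sf Uy) expr0 mulr1.
  apply: (@le_trans _ _ B); last by rewrite -[B]invrK lef_pV2 ?posrE ?invr_gt0 // ltW.
  have : `|pd i f x0 - pd i f y| < 1.
    by apply: Hr; rewrite -ball_normE /= distrC; exact: lt_trans er.
  move=> /ltW H; rewrite /B.
  have -> : pd i f y = pd i f x0 - (pd i f x0 - pd i f y) by rewrite opprB addrC subrK.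
  exact: le_trans (ler_normB _ _) (lerD (lexx _) H).
- apply: filter_forall => i.
  have /near0P[r rp Hr] := IH (pd i f) (smooth_pd i sf).
  apply/near0P; exists (Num.min r0 r); first by rewrite lt_min r0p.
  move=> e e0; rewrite lt_min => /andP[er0 er] x y xe ye.
  have Uy : U y by apply: ballU; exact: lt_trans er0.
  have Ux : U x by apply: ballU; exact: lt_trans er0.
  by rewrite (pd_tremS n i oU sf Ux Uy); exact: Hr.
Qed.

(** The bound e^-1, valid for all small e, is a form to which the near-covering property of compact
    sets applies. *)
Lemma compact_bounded_smooth U K f : compact K -> K `<=` U -> smooth_on U f ->
  exists2 B : R, 0 <= B & forall x, K x -> `|f x| <= B.
Proof.
move=> cK KU sf.
have H : \forall e \near (0 : R)^'+, K `<=` (fun x => `|f x| <= e^-1).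
  apply: (iffLR (compact_near_coveringP K) cK _ _ (fun e x => `|f x| <= e^-1)).
  move=> x Kx; have /nbhs_ballP[r /= rp Hr] := continuous_near (smooth_cont sf (KU x Kx)) ltr01.
  pose B : R := `|f x| + 1; have B0 : 0 < B by rewrite ltr_wpDl.
  exists (ball x r, [set e : R | 0 < e < B^-1]).
    split=> /=; first exact: nbhsx_ballx.
    by apply/near0P; exists B^-1; rewrite ?invr_gt0 // => e e0 eB; rewrite /= e0.
  move=> [y e] /= [/Hr yr /andP[e0 eB]].
  apply: (@le_trans _ _ B); last by rewrite -[B]invrK lef_pV2 ?posrE ?invr_gt0 // ltW.
  have -> : f y = f x - (f x - f y) by rewrite opprB addrC subrK.
  exact: le_trans (ler_normB _ _) (lerD (lexx _) (ltW yr)).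
case/near0P: H => r rp Hr; exists (r / 2)^-1; first by rewrite invr_ge0 ltW // divr_gt0.
by move=> x Kx; apply: Hr => //; [rewrite divr_gt0|rewrite ltr_pdivrMr // ltr_pMr // ltr1n].
Qed.

Lemma compact_bounded_seq (I : eqType) (r : seq I) U K (F : I -> 'rV[R]_d -> R) :
  compact K -> K `<=` U -> (forall i, smooth_on U (F i)) ->
  exists2 B : R, 0 <= B & forall i x, i \in r -> K x -> `|F i x| <= B.
Proof.
move=> cK KU sF; elim: r => [|i r [B B0 HB]]; first by exists 0.
have [C C0 HC] := compact_bounded_smooth cK KU (sF i).
exists (B + C); first exact: addr_ge0.
move=> j x; rewrite inE => /predU1P[->|jr] Kx.
  by apply: le_trans (HC x Kx) _; rewrite lerDr.
by apply: le_trans (HB _ _ jr Kx) _; rewrite lerDl.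
Qed.

Lemma normr_mon_le z w (D : R) : `|z| <= D -> `|mon z w| <= D ^+ size w.
Proof.
move=> zD; rewrite /mon normr_prod; elim: w => [|i w IH]; first by rewrite big_nil.
rewrite big_cons exprS; apply: ler_pM => //; first exact: prodr_ge0.
exact: le_trans (normr_row_ge z i) zD.
Qed.

(** K, later the trace of a path, need not be convex: segments are only used inside small balls in
    U, and distant pairs are covered by boundedness. *)
Lemma taylor_compact U K n f : open U -> compact K -> K `<=` U -> smooth_on U f ->
  exists2 C : R, 0 <= C &
    forall x y, K x -> K y -> `|trem n f x y| <= C * `|y - x| ^+ n.+1.
Proof.
move=> oU cK KU sf.
have H : \forall e \near (0 : R)^'+, K `<=` (fun x => forall y, `|y - x| < e ->
    `|trem n f x y| <= e^-1 * `|y - x| ^+ n.+1).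
  apply: (iffLR (compact_near_coveringP K) cK _ _ (fun e x => forall y, `|y - x| < e ->
    `|trem n f x y| <= e^-1 * `|y - x| ^+ n.+1)).
  move=> x0 Kx0; have /near0P[r rp Hr] := taylor_near n oU sf (KU x0 Kx0).
  pose q := r / 2; have q0 : 0 < q by rewrite divr_gt0.
  have qr : q < r by rewrite ltr_pdivrMr // ltr_pMr // ltr1n.
  exists (ball x0 (q / 2), [set e : R | 0 < e < q / 2]).
    split=> /=; first by apply: nbhsx_ballx; rewrite divr_gt0.
    by apply/near0P; exists (q / 2); rewrite ?divr_gt0 // => e e0 eq; rewrite /= e0.
  have q2 : q / 2 < q by rewrite ltr_pdivrMr // ltr_pMr // ltr1n.
  move=> [x e] /= []; rewrite -ball_normE /= distrC => xx0 /andP[e0 eq] y yx.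
  have h1 : `|x - x0| < q by exact: lt_trans q2.
  have h2 : `|y - x0| < q.
    have -> : y - x0 = (y - x) + (x - x0) by rewrite addrA subrK.
    apply: le_lt_trans (ler_normD _ _) _; rewrite (splitr q).
    by apply: ltrD => //; exact: lt_trans eq.
  apply: le_trans (Hr q q0 qr x y h1 h2) _; apply: ler_wpM2r; first exact: exprn_ge0.
  by rewrite lef_pV2 ?posrE // ltW // (lt_trans eq).
case/near0P: H => r0 r0p Hr0; pose r := r0 / 2.
have rp : 0 < r by rewrite divr_gt0.
have Hr : forall x, K x -> forall y, `|y - x| < r -> `|trem n f x y| <= r^-1 * `|y - x| ^+ n.+1.
  by apply: Hr0 => //; rewrite ltr_pdivrMr // ltr_pMr // ltr1n.
have [B B0 HB] := compact_bounded_seq (words_le (enum 'I_d) n) cK KU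
  (fun w => smooth_pds w sf).
have [B1 B10 HB1] := compact_bounded_smooth cK KU sf.
have [D D0 HD] : exists2 D, 0 <= D & forall x, K x -> `|x| <= D.
  have [D D0 HD] := compact_bounded_seq (enum 'I_d) cK (fun x _ => I : setT x)
    (fun j => smooth_coord (U := setT) j).
  exists D => // x Kx; apply: normr_row_le => // i.
  by apply: (HD i) => //; rewrite mem_enum.
pose M := B1 + \sum_(w <- words_le (enum 'I_d) n) `|(size w)`!%:R^-1| * (B * (D + D) ^+ size w).
have M0 : 0 <= M.
  apply: addr_ge0 => //; apply: sumr_ge0 => w _.
  by rewrite !mulr_ge0 ?exprn_ge0 ?addr_ge0.
have HM x y : K x -> K y -> `|trem n f x y| <= M.
  move=> Kx Ky; apply: le_trans (ler_normB _ _) _; apply: lerD; first exact: HB1.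
  apply: le_trans (ler_norm_sum _ _ _) _; rewrite big_seq [leRHS]big_seq.
  apply: ler_sum => w wn; rewrite !normrM; apply: ler_wpM2l => //.
  apply: ler_pM => //; first exact: HB.
  apply: normr_mon_le; apply: le_trans (ler_normB _ _) _.
  by apply: lerD; exact: HD.
(* The first summand serves pairs closer than r. For the other pairs |y - x| / r is at least 1, so
   its power can be inserted into the crude bound M. *)
exists (r^-1 + M * r^-1 ^+ n.+1).
  by rewrite addr_ge0 ?mulr_ge0 ?exprn_ge0 ?invr_ge0 // ltW.
move=> x y Kx Ky; have [yx|ryx] := ltP `|y - x| r.
  apply: le_trans (Hr x Kx y yx) _; apply: ler_wpM2r; first exact: exprn_ge0.
  by rewrite lerDl mulr_ge0 ?exprn_ge0 ?invr_ge0 // ltW.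
apply: le_trans (HM x y Kx Ky) _.
apply: (@le_trans _ _ (M * r^-1 ^+ n.+1 * `|y - x| ^+ n.+1)).
  rewrite -mulrA ler_peMr // -exprMn exprn_ege1 // mulrC ler_pdivlMr // mul1r //.
apply: ler_wpM2r; first exact: exprn_ge0.
by rewrite lerDr invr_ge0 ltW.
Qed.

End TaylorBound.

#[local] Transparent derive derivable.

(** * Smooth functions flat at the origin *)

Section FlatFunctions.
Context {R : realType}.
Implicit Types (P : {poly R}) (t h : R).

(** The functions P(1/t) exp(-1/t), extended by 0, are a family stable under differentiation: P
    becomes X^2 (P - P'). *)
Definition flat P t : R := if 0 < t then P.[t^-1] * expR (- t^-1) else 0.

Definition flat_deriv P : {poly R} := 'X^2 * (P - P^`()).

Lemma flat_le0 P t : t <= 0 -> flat P t = 0.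
Proof. by move=> t0; rewrite /flat ltNge t0. Qed.

(** With u = 1/t, the bound u^(i+1) / (i+1)! <= e^u gives u^i e^-u <= (i+1)! t. Applied to X P, it
    shows that the difference quotient of [flat P] at 0 tends to 0. *)
Lemma flat_bound P : exists2 C : R, 0 <= C & forall t, `|flat P t| <= C * `|t|.
Proof.
exists (\sum_(i < size P) `|P`_i| * i.+1`!%:R) => [|t].
  by apply: sumr_ge0 => i _; rewrite mulr_ge0.
rewrite /flat; case: ltP => t0; last first.
  by rewrite normr0 mulr_ge0 // sumr_ge0 // => i _; rewrite mulr_ge0.
rewrite horner_coef mulr_suml mulr_suml; apply: le_trans (ler_norm_sum _ _ _) _.
apply: ler_sum => i _; rewrite -!mulrA normrM; apply: ler_wpM2l => //.
have u0 : 0 < t^-1 by rewrite invr_gt0.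
rewrite ger0_norm ?(gtr0_norm t0); last by rewrite mulr_ge0 ?expR_ge0 ?exprn_ge0 ?ltW.
rewrite expRN ler_pdivrMr ?expR_gt0 //.
have f0 : 0 < i.+1`!%:R :> R by rewrite ltr0n fact_gt0.
have := expR_ge1Dxn i (ltW u0); move=> H.
have : t^-1 ^+ i.+1 / i.+1`!%:R <= expR t^-1 by apply: le_trans H; rewrite lerDr.
rewrite ler_pdivrMr // mulrC => H'.
by rewrite mulrAC -ler_pdivrMr // -exprSr.
Qed.

Lemma flat_mulX P h : 0 < h -> flat P h / h = flat ('X * P) h.
Proof. by move=> h0; rewrite /flat h0 hornerM hornerX mulrC mulrA. Qed.

Lemma is_derive_flat P t : is_derive t 1 (flat P) (flat (flat_deriv P) t).
Proof.
have [t0|t0|->] := ltgtP t 0.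
- rewrite (flat_le0 (flat_deriv P) (ltW t0)).
  apply: near_eq_is_derive (is_derive_cst (0 : R) t 1); near=> s.
  by rewrite flat_le0 // ltW //; near: s; exact: lt_nbhsl.
- have D : is_derive t 1 (fun s => P.[s^-1] * expR (- s^-1)) (flat (flat_deriv P) t).
    have DV : is_derive t 1 (fun s : R => s^-1) (- t ^- 2 *: 1).
      by apply: (@is_deriveV R id); rewrite gt_eqF.
    have DP := @is_derive1_comp _ (horner P) (fun s => s^-1) t _ _ (is_derive_poly P t^-1) DV.
    have DN : is_derive t 1 (fun s : R => - s^-1) (- (- t ^- 2 *: 1)) by exact: is_deriveN.
    have DE := @is_derive1_comp _ expR (fun s => - s^-1) t _ _ (is_derive_expR (- t^-1)) DN.
    have DM := is_deriveM DP DE.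
    apply: (is_derive_eq DM); rewrite /flat t0 /flat_deriv /=.
    rewrite hornerM hornerXn hornerD hornerN exprVn /GRing.scale /= !mulr1 opprK.
    by ring.
  apply: near_eq_is_derive D; near=> s; rewrite /flat ifT //; near: s.
  exact: lt_nbhsr.
- rewrite flat_le0 //.
  have [C C0 HC] := flat_bound ('X * P).
  have H : (fun h => h^-1 *: ((flat P \o shift 0) (h *: (1 : R)) - flat P 0)) @ 0^' --> (0 : R).
    apply/cvgrPdist_lt => e e0; exists (e / (C + 1)) => /=.
      by rewrite divr_gt0 // ltr_wpDl.
    move=> h /=; rewrite sub0r normrN => he h0.
    rewrite addr0 [_%:A]mulr1 (flat_le0 P (lexx 0)) subr0 /GRing.scale /= sub0r normrN.
    have [hp|hn] := ltP 0 h; last by rewrite (flat_le0 _ hn) mulr0 normr0.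
    rewrite mulrC flat_mulX //; apply: le_lt_trans (HC h) _.
    apply: (@le_lt_trans _ _ ((C + 1) * `|h|)).
      by apply: ler_wpM2r => //; rewrite lerDl.
    by rewrite mulrC -ltr_pdivlMr // ltr_wpDl.
  by apply: DeriveDef; [apply/cvg_ex; exists 0|exact: cvg_lim H].
Unshelve. all: by end_near. Qed.

(** [smooth_on] is about functions of row vectors, so the induction on the order runs over rows of
    length one, and F enters by composition. *)
Lemma flat_smooth {d : nat} (U : set 'rV[R]_d) P (F : 'rV[R]_d -> R) : open U ->
  smooth_on U F -> smooth_on U (fun y => flat P (F y)).
Proof.
move=> oU sF.
have oT : open [set: 'rV[R]_1] by exact: openT.
suff H : smooth_on setT (fun v : 'rV[R]_1 => flat P (v 0 0)).
  have sh : smooth_map_on U (fun y => \row_(i < 1) F y).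
    move=> k; apply: (smooth_local oU _ sF) => y _; by rewrite mxE.
  apply: (smooth_local oU _ (smooth_comp oU oT (fun _ _ => I) H sh)) => y _.
  by rewrite /= mxE.
have D Q x i : is_derive x (delta_mx 0 i) (fun v : 'rV[R]_1 => flat Q (v 0 0))
    (flat (flat_deriv Q) (x 0 0)).
  have E : (fun h : R => h^-1 *: (((fun v : 'rV[R]_1 => flat Q (v 0 0)) \o shift x)
      (h *: delta_mx 0 i) - flat Q (x 0 0))) =
    (fun h : R => h^-1 *: ((flat Q \o shift (x 0 0)) (h *: (1 : R)) - flat Q (x 0 0))).
    apply/funext => h /=; congr (_ *: (flat Q _ - _)).
    by rewrite !mxE (ord1 i) eqxx.
  have [D1 D2] := is_derive_flat Q (x 0 0).
  by apply: DeriveDef; [rewrite /derivable E|rewrite -D2 /derive E].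
apply/smooth_onP => n; elim: n P => [|n IH] P; split => //.
1,2: move=> x _; apply: (@continuous_comp _ _ _ (fun v : 'rV[R]_1 => v 0 0) (flat P));
  first exact: coord_continuous.
1,2: by apply/differentiable_continuous/derivable1_diffP; case: (is_derive_flat P (x 0 0)).
move=> i; split; first by move=> x _; case: (D P x i).
apply: (Ck_local oT _ (IH (flat_deriv P))) => y _.
by rewrite /pd (@derive_val _ _ _ _ _ _ _ (D P y i)).
Qed.

End FlatFunctions.

#[local] Opaque derive derivable.

(** * Bump functions and compactly supported jets *)

Section Bump.
Context {R : realType} {d : nat}.
Implicit Types (U K : set 'rV[R]_d) (f g : 'rV[R]_d -> R) (x y z : 'rV[R]_d).

Lemma Ck_inv n U f : open U -> (forall y, U y -> f y != 0) -> smooth_on U f ->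
  Ck n U (fun y => (f y)^-1).
Proof.
move=> oU f0 sf; elim: n => [|n IH]; split => //.
1,2: by move=> x Ux; apply: (@cvgV _ _ (nbhs x) (nbhs_filter x) f (f x) (f0 x Ux));
  exact: (smooth_cont sf Ux).
move=> i; split.
  by move=> x Ux; exact: (derivableV (f0 x Ux) (smooth_derivable sf Ux)).
have sd : Ck n U (pd i f) := iffLR (smooth_onP _ _) (smooth_pd i sf) n.
have H := CkM oU (CkM oU (Ck_cst n U (-1)) (CkM oU IH IH)) sd.
apply: (Ck_local oU _ H) => y Uy.
rewrite [RHS](deriveV (f0 y Uy) (smooth_derivable sf Uy)) mulN1r -/(pd i f y).
by rewrite expr2 invfM.
Qed.

Lemma smooth_inv U f : open U -> (forall y, U y -> f y != 0) -> smooth_on U f ->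
  smooth_on U (fun y => (f y)^-1).
Proof. by move=> *; apply/smooth_onP => n; exact: Ck_inv. Qed.

(** A smooth transition from 0 on t <= 0 to 1 on t >= 1; t and 1 - t are never both nonpositive, so
    the denominator does not vanish. *)
Definition step (t : R) : R := flat 1 t / (flat 1 t + flat 1 (1 - t)).

Lemma flat1_gt0 (t : R) : 0 < t -> 0 < flat 1 t.
Proof. by move=> t0; rewrite /flat t0 hornerE mul1r expR_gt0. Qed.

Lemma flat1_ge0 (t : R) : 0 <= flat 1 t.
Proof. by case: (ltP 0 t) => [/flat1_gt0/ltW|/flat_le0 ->]. Qed.

Lemma step_den (t : R) : flat 1 t + flat 1 (1 - t) != 0.
Proof.
rewrite gt_eqF //; case: (ltP 0 t) => t0.
  by rewrite ltr_pwDl ?flat1_gt0 ?flat1_ge0.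
by rewrite ltr_wpDl ?flat1_ge0 // flat1_gt0 // subr_gt0 (le_lt_trans t0).
Qed.

Lemma step_le0 t : t <= 0 -> step t = 0.
Proof. by move=> t0; rewrite /step flat_le0 // mul0r. Qed.

Lemma step_ge1 t : 1 <= t -> step t = 1.
Proof.
move=> t1; have H : flat 1 (1 - t) = 0 by rewrite flat_le0 // subr_le0.
by have := step_den t; rewrite /step H addr0 => /divff.
Qed.

Lemma step_smooth U f : open U -> smooth_on U f -> smooth_on U (fun y => step (f y)).
Proof.
move=> oU sf; have s1 := flat_smooth 1 oU sf.
have s2 := flat_smooth 1 oU (smoothB oU (smooth_cst (1 : R)) sf).
by apply: (smoothM oU s1); exact: (smooth_inv oU (fun y _ => step_den (f y)) (smoothD oU s1 s2)).
Qed.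

Lemma bump_function U x0 : open U -> U x0 ->
  exists (chi : 'rV[R]_d -> R) (K V : set 'rV[R]_d),
    [/\ smooth_on setT chi, compact K, K `<=` U, forall y, ~ K y -> chi y = 0 &
        [/\ open V, V x0 & forall y, V y -> chi y = 1]].
Proof.
move=> oU Ux0; have oT : open [set: 'rV[R]_d] by exact: openT.
have /nbhs_ballP[r /= rp Hr] := open_nbhs_nbhs (conj oU Ux0).
(* The supporting cube K has half-side 2 q = r / 2, so it lies inside the ball of radius r. *)
pose q := r / 4; have q0 : 0 < q by rewrite divr_gt0.
(* With u the rescaled coordinate, 2 - u^2 is at least 1 for |u| <= 1 and negative for |u| > 2. *)
pose chi y := \prod_i step (2 - ((y - x0) 0 i / q) * ((y - x0) 0 i / q)).
pose K := [set y : 'rV[R]_d | forall i, `[x0 0 i - q * 2, x0 0 i + q * 2]%classic (y 0 i)].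
have schi : smooth_on setT chi.
  apply: smooth_prod => // i _; apply: (step_smooth oT).
  have s1 := smoothM oT (smooth_shift_coord x0 i oT) (smooth_cst (q^-1 : R)).
  exact: (smoothB oT (smooth_cst (2 : R)) (smoothM oT s1 s1)).
exists chi, K, (ball x0 q); split.
- exact: schi.
- exact: (@rV_compact R d (fun i => `[x0 0 i - q * 2, x0 0 i + q * 2]%classic)
    (fun i => @segment_compact R _ _)).
- move=> y Ky; apply: Hr; rewrite -ball_normE /= distrC.
  apply: (@le_lt_trans _ _ (q * 2)); last by rewrite /q; lra.
  apply: normr_row_le => [|i]; first by rewrite mulr_ge0 // ltW.
  have := Ky i; rewrite /= in_itv /= !mxE ler_norml => /andP[? ?]; apply/andP; split; lra.
- move=> y /existsNP[i]; rewrite /= in_itv /= => /negP; rewrite negb_and -!ltNge => yi.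
  rewrite /chi (bigD1 i) //= step_le0 ?mul0r // !mxE.
  set u := (_ / q).
  have [u2|u2] : u < - 2 \/ 2 < u.
    by case/orP: yi => yi; [left; rewrite ltr_pdivrMr //|right; rewrite ltr_pdivlMr //]; lra.
  + by nra.
  + by nra.
- split; [exact: ball_open|exact: ballxx|].
  move=> y; rewrite -ball_normE /= distrC => yq; rewrite /chi big1 // => i _.
  rewrite step_ge1 //; set u := (_ / q).
  have /ler_normlP[u1 u2] : `|u| <= 1.
    rewrite normrM normfV (gtr0_norm q0) ler_pdivrMr // mul1r.
    by apply: le_trans (normr_row_ge _ _) (ltW yq).
  have {}u1 : -1 <= u by lra.
  by nra.
Qed.

(** A Taylor polynomial is cut off by a bump function; the compact support inside U later permits
    the extension by zero from a chart to the manifold. *)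
Lemma jet_realisation U x0 n (t : seq 'I_d -> R) : open U -> U x0 -> symmetric_fun t ->
  exists (g : 'rV[R]_d -> R) (K : set 'rV[R]_d),
    [/\ smooth_on setT g, compact K, K `<=` U, forall y, ~ K y -> g y = 0 &
        forall w, (size w <= n)%N -> pds w g x0 = t w].
Proof.
move=> oU Ux0 st; have oT : open [set: 'rV[R]_d] by exact: openT.
have [chi [K [V [schi cK KU chi0 [oV Vx0 chi1]]]]] := bump_function oU Ux0.
exists (fun y => chi y * taypoly n t x0 y), K; split.
- exact: (smoothM oT schi (smooth_taypoly n t x0 oT)).
- exact: cK.
- exact: KU.
- by move=> y /chi0 ->; rewrite mul0r.
- move=> w wn; rewrite -[RHS](pds_taypoly x0 st wn).
  by apply: (pds_local w oV Vx0) => y /chi1 ->; rewrite mul1r.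
Qed.

End Bump.

(** * Sewing *)

Section Sewing.
Context {R : realType}.
Variables (a b : R) (omega Xi : R -> R -> R) (C theta : R).
Hypotheses (omega_ge0 : forall s t, a <= s -> s <= t -> t <= b -> 0 <= omega s t)
  (omega_super : forall s u t, a <= s -> s <= u -> u <= t -> t <= b ->
     omega s u + omega u t <= omega s t)
  (C_ge0 : 0 <= C) (theta_gt1 : 1 < theta)
  (almost_additive : forall s u t, a <= s -> s <= u -> u <= t -> t <= b ->
     `|Xi s t - (Xi s u + Xi u t)| <= C * omega s t `^ theta).
Implicit Types (s t u v : R) (l : seq R).

Fixpoint psum (F : R -> R -> R) s l : R :=
  if l is u :: l' then F s u + psum F u l' else 0.

(** Weak inequalities admit repeated points, so that [:: t] is a partition even of a trivial
    interval. *)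
Definition wpart s t l := path <=%R s l && (last s l == t).

Lemma psum_cat F s l1 l2 : psum F s (l1 ++ l2) = psum F s l1 + psum F (last s l1) l2.
Proof. by elim: l1 s => [|u l1 IH] s /=; rewrite ?add0r // IH addrA. Qed.

Lemma wpart_le s t l : wpart s t l -> s <= t.
Proof.
elim: l s => [|u l IH] s; rewrite /wpart /=; first by move=> /eqP ->.
by move=> /andP[/andP[su pu] lt]; apply: le_trans su (IH _ _); rewrite /wpart pu.
Qed.

Lemma wpart1 s t : s <= t -> wpart s t [:: t].
Proof. by rewrite /wpart /= => ->; rewrite eqxx. Qed.

Lemma wpart_cat s u t l1 l2 : wpart s u l1 -> wpart u t l2 -> wpart s t (l1 ++ l2).
Proof.
rewrite /wpart cat_path last_cat => /andP[p1 /eqP ->] /andP[p2 lt].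
by rewrite p1 p2 lt.
Qed.

Lemma wpart_cons s t v l : wpart s t (v :: l) = (s <= v) && wpart v t l.
Proof. by rewrite /wpart /= andbA. Qed.

Lemma omega_mono s s' t' t : a <= s -> s <= s' -> s' <= t' -> t' <= t -> t <= b ->
  omega s' t' <= omega s t.
Proof.
move=> as_ ss' st' tt' tb.
have h1 := omega_super as_ ss' (le_trans st' tt') tb.
have h2 := omega_super (le_trans as_ ss') st' tt' tb.
have g1 := omega_ge0 as_ ss' (le_trans (le_trans st' tt') tb).
have g2 := omega_ge0 (le_trans (le_trans as_ ss') st') tt' tb.
by lra.
Qed.

Lemma omega_diag s : a <= s -> s <= b -> omega s s = 0.
Proof.
move=> as_ sb; have h := omega_super as_ (lexx s) (lexx s) sb.
have g := omega_ge0 as_ (lexx s) sb; lra.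
Qed.

(** Here u is the first point with [omega s u] above half of [omega s t]: minimality bounds the part
    before u, superadditivity the part after u. Without such a point [omega s t] is at most its own
    half, hence zero, and the first point of l serves as u. *)
Lemma halving s t l : a <= s -> t <= b -> wpart s t l -> l != [::] ->
  exists l1 u l2, [/\ l = l1 ++ u :: l2, omega s (last s l1) <= omega s t / 2 &
    omega u t <= omega s t / 2].
Proof.
move=> as_ tb; pose p v := omega s t / 2 < omega s v.
have [hp|/hasPn np] := boolP (has p l); move=> wl l0.
  case: (split_find hp) wl => u l1 l2 pu np; rewrite cat_rcons => wl.
  exists l1, u, l2; split => //.
    have : last s l1 \in s :: l1 by rewrite mem_last.
    rewrite inE => /predU1P[->|lin].
      have := wpart_le wl => st.
      by rewrite omega_diag ?(le_trans st) // divr_ge0 // omega_ge0.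
    rewrite leNgt; apply/negP => ul; move/negP: np; apply; apply/hasP.
    by exists (last s l1).
  have [su ut] : s <= u /\ u <= t.
    move: wl; rewrite /wpart cat_path last_cat /= => /andP[/and3P[p1 p2 p3] lt]; split.
      apply: (@wpart_le _ _ (rcons l1 u)).
      by rewrite /wpart rcons_path p1 p2 last_rcons eqxx.
    by apply: (@wpart_le _ _ l2); rewrite /wpart p3.
  have := omega_super as_ su ut tb; move: pu; rewrite /p => h1 h2; lra.
case: l wl np l0 => // u l wl np _.
have w0 : omega s t <= omega s t / 2.
  rewrite leNgt; apply: np; move: wl; rewrite /wpart /= => /andP[_ /eqP <-].
  by rewrite mem_last.
have st := wpart_le wl.
have g := omega_ge0 as_ st tb.
exists [::], u, l; split => //=.
  by rewrite omega_diag ?(le_trans st) // divr_ge0.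
move: wl; rewrite wpart_cons => /andP[su /wpart_le ut].
by have := omega_mono as_ su ut (lexx t) tb; lra.
Qed.

Lemma wpart_split s t l1 u l2 : wpart s t (l1 ++ u :: l2) ->
  [/\ wpart s (last s l1) l1, last s l1 <= u & wpart u t l2].
Proof.
rewrite /wpart cat_path last_cat /= => /andP[/and3P[p1 p2 p3] lt].
by rewrite p1 p2 p3 lt eqxx.
Qed.

Let q : R := 2 * (2^-1 `^ theta).

Let q_lt1 : q < 1.
Proof.
rewrite /q -[X in 2 * X]/(2^-1 `^ theta).
have -> : theta = 1 + (theta - 1) by rewrite addrCA subrr addr0.
rewrite powRD; last by rewrite invr_eq0 pnatr_eq0 implybT.
rewrite powRr1 ?invr_ge0 // mulrA divff ?pnatr_eq0 // mul1r.
rewrite /powR invr_eq0 pnatr_eq0 /= -[ltRHS]expR0 ltr_expR.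
by rewrite pmulr_rlt0 ?subr_gt0 // ln_lt0 // invr_gt0 ltr0n /= invf_lt1 ?ltr1n.
Qed.

(** The solution of K = K q + 2 C. In the induction the two halves cost K q together, each
    contributing a factor 2^-theta, and the two additivity defects cost 2 C. *)
Let K : R := 2 * C / (1 - q).

Let K_ge0 : 0 <= K.
Proof. by rewrite /K divr_ge0 ?mulr_ge0 // subr_ge0 ltW. Qed.

Lemma powR_half x y : 0 <= x -> 0 <= y -> x <= y / 2 ->
  x `^ theta <= y `^ theta * (2^-1 `^ theta).
Proof.
move=> x0 y0 xy; rewrite -powRM ?invr_ge0 //.
by apply: ge0_ler_powR; rewrite ?nnegrE ?mulr_ge0 ?invr_ge0 //; apply: ltW; apply: lt_trans theta_gt1.
Qed.

(** The partition falls into two halves and the single interval [m, u] between them. Both halves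
    have fewer points, and reassembling them costs two additivity defects. *)
Lemma psum_estimate s t l : a <= s -> t <= b -> wpart s t l ->
  `|psum Xi s l - Xi s t| <= K * omega s t `^ theta.
Proof.
move: {2}(size l) (leqnn (size l)) => n; elim: n s t l => [|n IH] s t l.
all: move=> ln as_ tb wl; have st := wpart_le wl.
  case: l ln wl => // _; rewrite /wpart /= => /eqP ts; subst t.
  have := almost_additive as_ (lexx s) (lexx s) tb.
  rewrite omega_diag // powR0 ?mulr0; last by rewrite gt_eqF // (lt_trans ltr01).
  by rewrite opprD addrA subrr !add0r.
have [l0|l0] := eqVneq l [::]; first by apply: IH => //; rewrite l0.
have [l1 [u [l2 [lE w1 w2]]]] := halving as_ tb wl l0.
rewrite lE in ln wl *; have [p1 mu p2] := wpart_split wl.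
set m := last s l1 in p1 mu w1 *.
have sm := wpart_le p1; have ut := wpart_le p2.
have ln' : (size l1 + size l2 <= n)%N by move: ln; rewrite size_cat /= addnS.
have mt := le_trans mu ut.
have mb := le_trans mt tb; have ub := le_trans ut tb.
have am := le_trans as_ sm; have au := le_trans am mu.
have E1 := IH s m l1 (leq_trans (leq_addr _ _) ln') as_ mb p1.
have E2 := IH u t l2 (leq_trans (leq_addl _ _) ln') au tb p2.
have A1 := almost_additive as_ sm mt tb.
have A2 := almost_additive am mu ut tb.
have g := omega_ge0 as_ st tb.
have A2' : `|Xi m t - (Xi m u + Xi u t)| <= C * omega s t `^ theta.
  apply: le_trans A2 _; apply: ler_wpM2l => //.
  apply: ge0_ler_powR; rewrite ?nnegrE ?omega_ge0 //; first by rewrite ltW // (lt_trans ltr01).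
  exact: omega_mono.
have P1 := powR_half (omega_ge0 as_ sm mb) g w1.
have P2 := powR_half (omega_ge0 au ut tb) g w2.
have {}E1 : `|psum Xi s l1 - Xi s m| <= K * (omega s t `^ theta * (2^-1 `^ theta)).
  by apply: le_trans E1 _; apply: ler_wpM2l.
have {}E2 : `|psum Xi u l2 - Xi u t| <= K * (omega s t `^ theta * (2^-1 `^ theta)).
  by apply: le_trans E2 _; apply: ler_wpM2l.
rewrite psum_cat /= -/m.
have -> : psum Xi s l1 + (Xi m u + psum Xi u l2) - Xi s t =
  (psum Xi s l1 - Xi s m) + (psum Xi u l2 - Xi u t)
  - (Xi s t - (Xi s m + Xi m t)) - (Xi m t - (Xi m u + Xi u t)) by ring.
apply: le_trans (ler_normB _ _) _; apply: le_trans (lerD (ler_normB _ _) A2') _.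
apply: le_trans (lerD (lerD (ler_normD _ _) A1) (lexx _)) _.
apply: le_trans (lerD (lerD (lerD E1 E2) (lexx _)) (lexx _)) _.
set W := omega s t `^ theta.
have -> : K * (W * 2^-1 `^ theta) + K * (W * 2^-1 `^ theta) + C * W + C * W =
  (K * q + 2 * C) * W by rewrite /q; ring.
apply: ler_wpM2r; first exact: powR_ge0.
have q1 : 1 - q != 0 by rewrite gt_eqF // subr_gt0.
have KE : K * (1 - q) = 2 * C by rewrite /K divfK.
by rewrite -KE mulrBr mulr1 addrC subrK.
Qed.

Let A s t : set R := [set x | exists2 l, wpart s t l & x = psum Xi s l].
(** The supremum over partitions is superadditive and stays within K omega^theta of Xi. The infimum
    F of its sums over partitions is additive, because refining a partition does not increase a sum
    of G. Thus no limit along partitions has to be taken. *)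
Let G s t : R := sup (A s t).

Let A_sup s t : a <= s -> s <= t -> t <= b -> has_sup (A s t).
Proof.
move=> as_ st tb; split; first by exists (psum Xi s [:: t]); exists [:: t] => //; exact: wpart1.
exists (Xi s t + K * omega s t `^ theta) => _ [l wl ->].
by have := psum_estimate as_ tb wl; rewrite ler_distl => /andP[].
Qed.

Let G_ge s t l : a <= s -> s <= t -> t <= b -> wpart s t l -> psum Xi s l <= G s t.
Proof. by move=> as_ st tb wl; apply: ub_le_sup; [exact: (A_sup as_ st tb).2|exists l]. Qed.

Let G_le s t : a <= s -> s <= t -> t <= b -> G s t <= Xi s t + K * omega s t `^ theta.
Proof.
move=> as_ st tb; apply: ge_sup; first exact: (A_sup as_ st tb).1.
move=> _ [l wl ->].
by have := psum_estimate as_ tb wl; rewrite ler_distl => /andP[].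
Qed.

Let G_super s u t : a <= s -> s <= u -> u <= t -> t <= b -> G s u + G u t <= G s t.
Proof.
move=> as_ su ut tb; have au := le_trans as_ su; have ub := le_trans ut tb.
rewrite -lerBrDr; apply: ge_sup; first exact: (A_sup as_ su ub).1.
move=> _ [l1 w1 ->]; rewrite lerBrDr addrC -lerBrDr.
apply: ge_sup; first exact: (A_sup au ut tb).1.
move=> _ [l2 w2 ->]; rewrite lerBrDr addrC.
have := w1 => /andP[_ /eqP l1u].
rewrite -{1}l1u -psum_cat; apply: G_ge => //; first exact: le_trans ut.
exact: wpart_cat w2.
Qed.

Let B s t : set R := [set x | exists2 l, wpart s t l & x = psum G s l].
Let F s t : R := inf (B s t).

Let psum_G s t l : a <= s -> t <= b -> wpart s t l -> psum Xi s l <= psum G s l.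
Proof.
elim: l s => [|u l IH] s //= as_ tb; rewrite wpart_cons => /andP[su wl].
have ut := wpart_le wl; apply: lerD; last by apply: IH => //; exact: le_trans su.
have := G_ge as_ su (le_trans ut tb) (wpart1 su).
by rewrite /= addr0.
Qed.

Let B_lb s t x : a <= s -> t <= b -> B s t x -> Xi s t - K * omega s t `^ theta <= x.
Proof.
move=> as_ tb [l wl ->]; apply: le_trans (psum_G as_ tb wl).
by have := psum_estimate as_ tb wl; rewrite ler_distl => /andP[].
Qed.

Let B_inf s t : a <= s -> s <= t -> t <= b -> has_inf (B s t).
Proof.
move=> as_ st tb; split; first by exists (psum G s [:: t]); exists [:: t] => //; exact: wpart1.
by exists (Xi s t - K * omega s t `^ theta) => x /(B_lb as_ tb).
Qed.

Let F_le s t l : a <= s -> s <= t -> t <= b -> wpart s t l -> F s t <= psum G s l.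
Proof. by move=> as_ st tb wl; apply: ge_inf; [exact: (B_inf as_ st tb).2|exists l]. Qed.

(** The interval of the partition that contains u is cut there; superadditivity of G makes the new
    sums no larger. *)
Let refine s u t l : a <= s -> s <= u -> u <= t -> t <= b -> wpart s t l ->
  exists l1 l2, [/\ wpart s u l1, wpart u t l2 & psum G s l1 + psum G u l2 <= psum G s l].
Proof.
elim: l s => [|v l IH] s as_ su ut tb.
  move=> /andP[_ /eqP /= st]; have us : u = s by apply/le_anti; rewrite su st ut.
  by exists [::], [::]; rewrite us /wpart /= st eqxx addr0.
rewrite wpart_cons => /andP[sv wl]; have vt := wpart_le wl.
case: (leP u v) => uv.
  exists [:: u], (v :: l); split; first exact: wpart1.
    by rewrite wpart_cons uv.
  rewrite /= addr0 addrA; apply: lerD => //; apply: G_super => //; exact: le_trans tb.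
have [l1 [l2 [w1 w2 le12]]] := IH v (le_trans as_ sv) (ltW uv) ut tb wl.
exists (v :: l1), l2; split => //; first by rewrite wpart_cons sv.
by rewrite /= -addrA lerD2l.
Qed.

Let F_additive s u t : a <= s -> s <= u -> u <= t -> t <= b -> F s t = F s u + F u t.
Proof.
move=> as_ su ut tb; have au := le_trans as_ su; have ub := le_trans ut tb.
have st := le_trans su ut; apply/le_anti/andP; split.
  rewrite -lerBlDr; apply: lb_le_inf; first exact: (B_inf as_ su ub).1.
  move=> _ [l1 w1 ->]; rewrite lerBlDr addrC -lerBlDr.
  apply: lb_le_inf; first exact: (B_inf au ut tb).1.
  move=> _ [l2 w2 ->]; rewrite lerBlDr addrC.
  have := w1 => /andP[_ /eqP l1u].
  rewrite -{1}l1u -psum_cat; apply: F_le => //.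
  exact: wpart_cat w2.
apply: lb_le_inf; first exact: (B_inf as_ st tb).1.
move=> _ [l wl ->]; have [l1 [l2 [w1 w2 le12]]] := refine as_ su ut tb wl.
by apply: le_trans le12; apply: lerD; apply: F_le.
Qed.

Lemma sewing : exists (J : R -> R) (K' : R), 0 <= K' /\
  forall s t, a <= s -> s <= t -> t <= b ->
    `|Xi s t - (J t - J s)| <= K' * omega s t `^ theta.
Proof.
exists (F a), K; split => // s t as_ st tb.
rewrite (F_additive (lexx a) as_ st tb) [F a s + _]addrC addrK distrC ler_distl.
apply/andP; split.
  by apply: lb_le_inf; [exact: (B_inf as_ st tb).1|move=> x; exact: B_lb].
apply: le_trans (F_le as_ st tb (wpart1 st)) _.
by rewrite /= addr0; exact: G_le.
Qed.

End Sewing.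

(** * Convergence of Riemann sums along fine partitions *)

Section RiemannSums.
Context {R : realType}.
Variables (T : R) (omega : R -> R -> R).
Hypothesis comega : control T omega.

(** The control is continuous and vanishes on the diagonal, hence is small near each (x, x),
    uniformly by compactness of [0, T]. *)
Lemma control_small (eta : R) : 0 < eta -> exists2 delta : R, 0 < delta &
  forall u v, 0 <= u -> u <= v -> v <= T -> v - u < delta -> omega u v < eta.
Proof.
move=> eta0; have [/subspace_continuousP oc _ od _] := comega.
have H : \forall e \near (0 : R)^'+, `[0, T]%classic `<=` (fun u => forall v, 0 <= u ->
    u <= v -> v <= T -> v - u < e -> omega u v < eta).
  apply: (iffLR (compact_near_coveringP _) (@segment_compact R 0 T) _ _
    (fun e u => forall v, 0 <= u -> u <= v -> v <= T -> v - u < e -> omega u v < eta)).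
  move=> x; rewrite /= in_itv /= => /andP[x0 xT].
  have sx : simplex 0 T (x, x) by split.
  have /cvgrPdist_lt /(_ _ eta0) := oc (x, x) sx.
  rewrite near_withinE => /nbhs_ballP[r /= rp Hr].
  pose r2 := r / 2; have r20 : 0 < r2 by rewrite divr_gt0.
  exists (ball x r2, [set e : R | 0 < e < r2]).
    split=> /=; first exact: nbhsx_ballx.
    by apply/near0P; exists r2 => // e e0 er; rewrite /= e0.
  move=> [u e] /= [ur /andP[e0 er]] v u0 uv vT vu.
  have r2r : r2 < r by rewrite /r2 ltr_pdivrMr // ltr_pMr // ltr1n.
  have Bu : ball x r u by exact: le_ball (ltW r2r) _ ur.
  have Bv : ball x r v.
    move: ur; rewrite -!ball_normE /= => ur.
    have -> : x - v = (x - u) - (v - u) by rewrite opprB addrA subrK.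
    apply: le_lt_trans (ler_normB _ _) _; rewrite (ger0_norm (_ : 0 <= v - u)) ?subr_ge0 //.
    have -> : r = r2 + r2 by rewrite /r2 -splitr.
    by apply: ltrD => //; exact: lt_trans er.
  have H : simplex 0 T (u, v) -> `|omega x x - omega u v| < eta := Hr (u, v) (conj Bu Bv).
  rewrite od ?x0 // sub0r normrN in H.
  by apply: le_lt_trans (ler_norm _) _; apply: H; split.
case/near0P: H => r rp Hr; exists (r / 2); first by rewrite divr_gt0.
move=> u v u0 uv vT vu; apply: (Hr (r / 2)) vu => //; first by rewrite divr_gt0.
  by rewrite ltr_pdivrMr // ltr_pMr // ltr1n.
by rewrite /= in_itv /= u0 (le_trans uv).
Qed.

Lemma itv_partition_wpart (s t : R) l : itv_partition s t l -> wpart s t l.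
Proof.
move=> [pl lt]; rewrite /wpart lt andbT.
by apply: sub_path pl => x y /ltW.
Qed.

Lemma sum_zip_psum (F : R -> R -> R) (s : R) l :
  \sum_(uv <- zip (s :: l) l) F uv.1 uv.2 = psum F s l.
Proof. by elim: l s => [|u l IH] s; rewrite ?big_nil //= big_cons IH. Qed.

Lemma psum_telescope (F : R -> R) (s t : R) l : wpart s t l ->
  psum (fun u v => F v - F u) s l = F t - F s.
Proof.
elim: l s => [|u l IH] s; first by rewrite /wpart /= => /eqP ->; rewrite subrr.
by rewrite wpart_cons => /andP[_ /IH /= ->]; rewrite addrC subrKA.
Qed.

Lemma psumB (F G : R -> R -> R) (s : R) l :
  psum (fun u v => F u v - G u v) s l = psum F s l - psum G s l.
Proof. by elim: l s => [|u l IH] s /=; rewrite ?subrr // IH; ring. Qed.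

(* Writing theta = 1 + (theta - 1), the errors omega^theta of a fine partition
   add up to at most sup(omega)^(theta - 1) * omega s t. *)
Lemma riemann_sums_cvg (a b theta K : R) (Xi : R -> R -> R) (J : R -> R) :
  0 <= a -> b <= T -> 1 < theta -> 0 <= K ->
  (forall s t, a <= s -> s <= t -> t <= b ->
     `|Xi s t - (J t - J s)| <= K * omega s t `^ theta) ->
  forall s t, a <= s -> t <= b -> forall eps, 0 < eps -> exists2 delta : R, 0 < delta &
    forall l, itv_partition s t l ->
      all (fun uv => uv.2 - uv.1 < delta) (zip (s :: l) l) ->
      `|\sum_(uv <- zip (s :: l) l) Xi uv.1 uv.2 - (J t - J s)| < eps.
Proof.
move=> a0 bT th1 K0 HX s t as_ tb eps eps0; have [_ og od os] := comega.
case: (leP s t) => st; last first.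
  exists 1 => // l /itv_partition_wpart /wpart_le; by rewrite leNgt st.
have s0 := le_trans a0 as_; have tT := le_trans tb bT.
(* The added 1 makes W positive and the final inequality strict. *)
pose W := K * omega s t + 1.
have W0 : 0 < W by rewrite ltr_wpDl // mulr_ge0 // og //; split.
(* Chosen such that omega < eta implies omega^(theta - 1) <= eps / W. *)
pose eta := (eps / W) `^ (theta - 1)^-1.
have eW : 0 < eps / W by rewrite divr_gt0.
have eta0 : 0 < eta by exact: powR_gt0.
have [delta d0 Hd] := control_small eta0; exists delta => // l pl ml.
have wl := itv_partition_wpart pl.
rewrite sum_zip_psum -(psum_telescope J wl) -psumB.
have key s' l' : a <= s' -> s' <= t -> wpart s' t l' ->
    all (fun uv => uv.2 - uv.1 < delta) (zip (s' :: l') l') ->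
    `|psum (fun u v => Xi u v - (J v - J u)) s' l'| <= eps / W * (K * omega s' t).
  elim: l' s' => [|u l' IH] s' as' st'.
    move=> _ _; rewrite /= normr0; apply: mulr_ge0; first exact: ltW.
    by apply: mulr_ge0 => //; apply: og; split => //; exact: le_trans as'.
  rewrite wpart_cons => /andP[su wl'] /= /andP[us ml'].
  have ut := wpart_le wl'; have au := le_trans as' su.
  have s'0 := le_trans a0 as'.
  apply: le_trans (ler_normD _ _) _; apply: le_trans (lerD (HX s' u as' su (le_trans ut tb)) (IH u au ut wl' ml')) _.
  have osu : 0 <= omega s' u by apply: og; split => //; exact: le_trans ut tT.
  have P : omega s' u `^ theta <= eps / W * omega s' u.
    have -> : theta = (theta - 1) + 1 by rewrite subrK.
    rewrite powRD; last by rewrite subrK gt_eqF // (lt_trans ltr01).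
    rewrite powRr1 //; apply: ler_wpM2r => //.
    have th0 : 0 < theta - 1 by rewrite subr_gt0.
    have -> : eps / W = eta `^ (theta - 1).
      by rewrite /eta -powRrM mulVf ?gt_eqF // powRr1 // ltW.
    apply: ge0_ler_powR; [exact: ltW|by rewrite nnegrE|by rewrite nnegrE ltW|].
    by apply/ltW/Hd => //; exact: le_trans ut tT.
  have S := os s' u t s'0 su ut tT.
  apply: (@le_trans _ _ (K * (eps / W * omega s' u) + eps / W * (K * omega u t))).
    by rewrite lerD2r; apply: ler_wpM2l.
  have -> : K * (eps / W * omega s' u) + eps / W * (K * omega u t) =
    eps / W * (K * (omega s' u + omega u t)) by ring.
  by apply: ler_wpM2l; [exact: ltW|apply: ler_wpM2l].
apply: le_lt_trans (key s l as_ st wl ml) _.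
rewrite mulrAC ltr_pdivrMr // ltr_pM2l //.
by rewrite /W ltrDl.
Qed.

End RiemannSums.

(** * Bracketed functionals on forests *)

Lemma wexp_filter {R : numFieldType} {d : nat} (F : seq 'I_d -> R) k m N : (m <= N)%N ->
  \sum_(w <- words_le (enum 'I_d) N | (size w + k <= m)%N) (size w)`!%:R^-1 * F w =
  if (k <= m)%N then wexp (m - k) F else 0.
Proof.
move=> mN; case: leqP => km.
  rewrite /wexp -(sum_words_le_filter _ (leq_trans (leq_subr k m) mN)).
  by apply: eq_bigl => w; rewrite leq_subRL // addnC.
rewrite big1 // => w wm; move: km; rewrite ltnNge.
by rewrite (leq_trans (leq_addl _ _) wm).
Qed.

(** Both sides run over the pairs of words of total length at most n. *)
Lemma wexp_swap {R : numFieldType} {d e : nat} n (G : seq 'I_d -> seq 'I_e -> R) :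
  wexp n (fun I => wexp (n - size I) (G I)) =
  wexp n (fun J => wexp (n - size J) (fun I => G I J)).
Proof.
have E (d' e' : nat) (H : seq 'I_d' -> seq 'I_e' -> R) :
    wexp n (fun I => wexp (n - size I) (H I)) =
    \sum_(I <- words_le (enum 'I_d') n) \sum_(J <- words_le (enum 'I_e') n | (size J + size I <= n)%N)
      (size I)`!%:R^-1 * ((size J)`!%:R^-1 * H I J).
  rewrite /wexp; apply: eq_big_seq => I; rewrite mem_words_le => In.
  rewrite -mulr_sumr; congr (_ * _).
  by have := wexp_filter (H I) (size I) (leqnn n); rewrite In => ->.
rewrite !E; under eq_bigr do rewrite big_mkcond; rewrite exchange_big /=.
apply: eq_bigr => J _; rewrite [RHS]big_mkcond; apply: eq_bigr => I _.
by rewrite addnC; case: ifP => // _; rewrite mulrCA.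
Qed.

Section Letters.
Context {d : nat}.
Implicit Types (c : letter d) (w b : seq 'I_d) (f g : forest (letter d)).

Lemma lwt_mset c w : seq_mset w = val c -> lwt c = size w.
Proof. by rewrite /lwt => <-; exact: perm_size (perm_eq_seq_mset w). Qed.

Lemma lwt_letter_of a w : lwt (letter_of a w) = (size w).+1.
Proof. exact: (@lwt_mset _ (a :: w)). Qed.

Lemma letter_ofP c : exists a w, c = letter_of a w.
Proof.
have E := seq_mset_id (val c).
case H : (enum_mset (val c)) => [|a w].
  have := valP c; rewrite -E H => /negP[]; apply/eqP/msetP => x.
  by rewrite mset_seqE mset0E.
by exists a, w; apply: val_inj; rewrite -[LHS]E H.
Qed.

Lemma lwt_gt0 c : (0 < lwt c)%N.
Proof. by have [a [w ->]] := letter_ofP c; rewrite lwt_letter_of. Qed.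

Lemma mem_letters_le n c : (c \in letters_le n) = (lwt c <= n)%N.
Proof.
rewrite mem_undup; apply/allpairsP/idP => [[[a w] /= [_ wn ->]]|cn].
  rewrite lwt_letter_of; case/flatten_mapP: wn => k.
  by rewrite mem_iota add0n mem_words => /andP[_ kn] /eqP ->.
have [a [w E]] := letter_ofP c; rewrite E lwt_letter_of in cn *.
exists (a, w); split => //=; first by rewrite mem_enum.
by apply/flatten_mapP; exists (size w); rewrite ?mem_words // mem_iota.
Qed.

Lemma sum_letters (V : nmodType) (G : letter d -> seq 'I_d -> V) m n : (m <= n)%N ->
  \sum_(c <- letters_le n) \sum_(b <- newords_le (enum 'I_d) m | seq_mset b == val c) G c b =
  \sum_(b <- newords_le (enum 'I_d) m) (if b is i :: b' then G (letter_of i b') b else 0).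
Proof.
move=> mn; under eq_bigr do rewrite big_mkcond.
rewrite exchange_big /=; apply: eq_big_seq => -[|i b]; first by rewrite mem_newords_le.
rewrite mem_newords_le /= => bm.
rewrite (bigD1_seq (letter_of i b)) ?undup_uniq //=; last first.
  by rewrite mem_letters_le lwt_letter_of; exact: leq_trans mn.
rewrite eqxx big1 ?addr0 // => c cb; case: eqP => // H.
by case/negP: cb; apply/eqP/val_inj; exact: esym H.
Qed.

(** All words with multiset c have length [lwt c]. The lemma reconciles the bound [lwt c] used in
    [Phi] with the level used in the integrands. *)
Lemma newords_mset_indep (V : nmodType) (G : seq 'I_d -> V) c M M' :
  (lwt c <= M)%N -> (lwt c <= M')%N ->
  \sum_(b <- newords_le (enum 'I_d) M | seq_mset b == val c) G b =
  \sum_(b <- newords_le (enum 'I_d) M' | seq_mset b == val c) G b.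
Proof.
suff H m : (lwt c <= m)%N ->
    \sum_(b <- newords_le (enum 'I_d) m | seq_mset b == val c) G b =
    \sum_(b <- words (enum 'I_d) (lwt c) | seq_mset b == val c) G b.
  by move=> /H -> /H ->.
move=> cm; rewrite big_mkcond sum_newords_le [RHS]big_mkcond.
have cm' : ((lwt c).-1 < m)%N by apply: leq_trans cm; rewrite prednK // lwt_gt0.
rewrite (bigD1 (Ordinal cm')) // -[RHS]addr0; congr (_ + _).
  by rewrite -[in RHS](prednK (lwt_gt0 c)).
rewrite big1 //.
move=> k /= kc; rewrite big1_seq // => b; rewrite (mem_words k.+1) => /andP[_ /eqP sb].
case: eqP => // /lwt_mset bc; case/eqP: kc; apply: val_inj => /=.
by rewrite bc sb.
Qed.

End Letters.

Section Forests.
Context {A : Type}.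
Implicit Types (t : tree A) (f g h : forest A).

(** Extending by t requires reflexivity on the children of t, which in turn extends by trees; hence
    the nested fixpoint. *)
Fixpoint iso_forest_cons t f g (fg : iso_forest f g) {struct t} :
    iso_forest (t :: f) (t :: g) :=
  let: Node a h := t in
  iso_node a ((fix refl h : iso_forest h h :=
    if h is u :: h' then iso_forest_cons u (refl h') else @iso_nil A) h) fg.

Lemma iso_forest_refl f : iso_forest f f.
Proof. by elim: f => [|t f IH]; [exact: iso_nil|exact: iso_forest_cons]. Qed.

Lemma iso_forest_cat h f g : iso_forest f g -> iso_forest (h ++ f) (h ++ g).
Proof. by move=> fg; elim: h => //= t h IH; exact: iso_forest_cons. Qed.

Lemma iso_forest_move f t g : iso_forest (f ++ t :: g) (t :: f ++ g).
Proof.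
elim: f => [|u f IH] /=; first exact: iso_forest_refl.
exact: iso_trans (iso_forest_cons u IH) (iso_swap _ _ _).
Qed.

Lemma iso_forest_catCA f g h : iso_forest (f ++ g ++ h) (g ++ f ++ h).
Proof.
elim: g => [|t g IH] /=; first exact: iso_forest_refl.
exact: iso_trans (iso_forest_move f t (g ++ h)) (iso_forest_cons t IH).
Qed.

Lemma fwt_cat (wt : A -> nat) f g : fwt wt (f ++ g) = (fwt wt f + fwt wt g)%N.
Proof. by rewrite /fwt map_cat sumn_cat. Qed.

Lemma fwt_cons (wt : A -> nat) t f : fwt wt (t :: f) = (twt wt t + fwt wt f)%N.
Proof. by []. Qed.

Lemma twt_node (wt : A -> nat) a f : twt wt (Node a f) = (wt a + fwt wt f)%N.
Proof. by []. Qed.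

End Forests.

Section ConsistentFunctionals.
Context {R : realType} {d : nat}.
Implicit Types (c : letter d) (w b : seq 'I_d) (f g : forest (letter d)).

Lemma bullets_cat w b : bullets (w ++ b) = bullets w ++ bullets b :> forest (letter d).
Proof. exact: map_cat. Qed.

Lemma iso_bullets w w' : perm_eq w w' -> iso_forest (bullets w) (bullets w').
Proof.
elim: w w' => [|i w IH] w'; first by rewrite perm_sym => /perm_nilP ->; exact: iso_nil.
move=> pw; have iw' : i \in w' by rewrite -(perm_mem pw) mem_head.
case/splitPr: iw' pw => w1 w2 pw.
have pw2 : perm_eq w (w1 ++ w2).
  rewrite -(perm_cons i); apply: perm_trans pw _.
  exact: (permEl (perm_catCA w1 [:: i] w2)).
rewrite bullets_cat /=; apply: iso_trans (iso_forest_cons _ (IH _ pw2)) _.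
rewrite bullets_cat.
exact: (iso_forest_catCA [:: bullet (letter1 i)] (bullets w1) (bullets w2)).
Qed.

Lemma fwt_bullets w : fwt lwt (bullets w : forest (letter d)) = size w.
Proof.
elim: w => //= i w IH; rewrite fwt_cons IH twt_node /letter1 lwt_letter_of.
by rewrite /fwt /= addn0.
Qed.

(** The bracket relation solved for the product of bullets. The forest f collects the other trees,
    and n is the weight up to which L is controlled. A rough path at fixed times is such a
    functional, and so is its restriction to the forests above a root labelled c. *)
Definition consistent_functional n (L : forest (letter d) -> R) : Prop :=
  (forall f g, (fwt lwt f <= n)%N -> iso_forest f g -> L f = L g) /\
  forall i w f, (size (i :: w) + fwt lwt f <= n)%N ->
    L (bullets (i :: w) ++ f) = \sum_(IJ <- splits (i :: w))
      (if IJ.2 is j :: J then L (Node (letter_of j J) (bullets IJ.1) :: f) else 0).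


(** The fixed factor [bullets b] is moved past the other trees by commutativity of forests, and uses
    up the weight |b|. *)
Lemma consistent_functional_shift n L b : (size b <= n)%N -> consistent_functional n L ->
  consistent_functional (n - size b) (fun f => L (bullets b ++ f)).
Proof.
move=> bn [iL cL]; split=> [f g fn fg|i w f wfn].
  apply: iL; last exact: iso_forest_cat.
  by rewrite fwt_cat fwt_bullets; move: fn; rewrite leq_subRL.
have wfn' : (size (i :: w) + fwt lwt (bullets b ++ f) <= n)%N.
  by rewrite fwt_cat fwt_bullets addnCA; move: wfn; rewrite leq_subRL.
rewrite (iL _ (bullets (i :: w) ++ bullets b ++ f)); last exact: iso_forest_catCA.
  rewrite cL //; apply: eq_big_seq => -[I [//|j J]] /= IJw.
  apply: iL; last first.
    apply: iso_trans (iso_forest_catCA [:: Node (letter_of j J) (bullets I)] (bullets b) f) _.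
    exact: iso_forest_refl.
  rewrite fwt_cons twt_node fwt_bullets lwt_letter_of.
  have := perm_size (splits_perm (w := i :: w) IJw); rewrite size_cat /= => E.
  by rewrite [((size J).+1 + _)%N]addnC E.
by rewrite !fwt_cat !fwt_bullets; move: wfn'; rewrite fwt_cat fwt_bullets addnCA.
Qed.

(* Every non-empty word g arises as a letter (J) with the bullets I on top,
   for all splittings of g into I and a non-empty J. *)
Lemma letter_sum (T : seq 'I_d -> R) (L : forest (letter d) -> R) (M : letter d -> nat) n N f :
  symmetric_fun T -> consistent_functional n L -> (n <= N)%N ->
  (forall c, (lwt c <= M c)%N) ->
  \sum_(c <- letters_le N)
    \sum_(w <- words_le (enum 'I_d) N | (size w + lwt c + fwt lwt f <= n)%N)
      (size w)`!%:R^-1 * (\sum_(b <- newords_le (enum 'I_d) (M c) | seq_mset b == val c)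
         (size b)`!%:R^-1 * T (w ++ b)) * L (Node c (bullets w) :: f) =
  \sum_(g <- newords_le (enum 'I_d) (n - fwt lwt f))
    (size g)`!%:R^-1 * (T g * L (bullets g ++ f)).
Proof.
move=> sT [iL cL] nN cM; case: (leqP (fwt lwt f) n) => fn; last first.
  have := ltnW fn; rewrite -subn_eq0 => /eqP ->; rewrite [RHS]big_nil big1 // => c _.
  rewrite big1 // => w H; move: fn; rewrite ltnNge.
  by rewrite (leq_trans (leq_addl _ _) H).
set m := (n - fwt lwt f)%N; have mN : (m <= N)%N by exact: leq_trans (leq_subr _ _) nN.
pose LL (w b : seq 'I_d) := if b is j :: J then L (Node (letter_of j J) (bullets w) :: f) else 0.
transitivity (\sum_(c <- letters_le N) \sum_(b <- newords_le (enum 'I_d) N | seq_mset b == val c)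
   \sum_(w <- words_le (enum 'I_d) N | (size w + lwt c <= m)%N)
   (size w)`!%:R^-1 * ((size b)`!%:R^-1 * T (w ++ b) * L (Node c (bullets w) :: f))).
  apply: eq_big_seq => c; rewrite mem_letters_le => cN.
  rewrite exchange_big /=; apply: eq_big => [w|w _].
    by rewrite /m leq_subRL // addnC.
  rewrite (newords_mset_indep _ (cM c) cN) mulr_sumr mulr_suml.
  by apply: eq_bigr => b _; rewrite !mulrA.
rewrite (sum_letters (fun c b => \sum_(w <- words_le (enum 'I_d) N | (size w + lwt c <= m)%N)
   (size w)`!%:R^-1 * ((size b)`!%:R^-1 * T (w ++ b) * L (Node c (bullets w) :: f))) (leqnn N)).
transitivity (wexp N (fun b => if (size b <= m)%N then
    wexp (m - size b) (fun w => T (w ++ b) * LL w b) else 0)).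
  rewrite wexp_nil /= /LL.
  have -> : wexp (m - 0) (fun w => T (w ++ [::]) * 0) = 0 :> R.
    by rewrite -[RHS](wexp0 (d := d) (m - 0)); apply: eq_wexp => w _; rewrite mulr0.
  rewrite add0r wexp_newords; apply: eq_big_seq => -[|j J]; first by rewrite mem_newords_le.
  move=> _; rewrite lwt_letter_of -(wexp_filter _ _ mN) mulr_sumr; apply: eq_bigr => w _.
  by rewrite -!mulrA mulrCA.
rewrite (wexp_widen mN); last by move=> w wm; rewrite leqNgt wm.
transitivity (wexp m (fun b => wexp (m - size b) (fun w => T (w ++ b) * LL w b))).
  by apply: eq_wexp => w ->.
rewrite (wexp_swap m (fun b w => T (w ++ b) * LL w b)).
rewrite -(wexp_splits m (fun w b => T (w ++ b) * LL w b)) -wexp_newords.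
apply: eq_wexp => -[|i w] wm; first by rewrite /= big_seq1 /= mulr0.
rewrite cL; last by move: wm; rewrite /m leq_subRL // addnC.
rewrite mulr_sumr; apply: eq_big_seq => -[I J] /splits_perm pw /=.
by rewrite (sT _ _ pw) /LL; case: J pw => //; rewrite mulr0.
Qed.

End ConsistentFunctionals.

Lemma newords_widen (V : nmodType) {d : nat} (F : seq 'I_d -> V) n M : (n <= M)%N ->
  (forall w, (n < size w)%N -> F w = 0) ->
  \sum_(w <- newords_le (enum 'I_d) M) F w = \sum_(w <- newords_le (enum 'I_d) n) F w.
Proof.
move=> nM H; rewrite !sum_newords_le.
pose A k := \sum_(w <- words (enum 'I_d) k.+1) F w.
rewrite -!(big_mkord xpredT A) (big_cat_nat (leq0n n) nM) /= [X in _ + X]big_nat_cond.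
rewrite [X in _ + X]big1 ?addr0 // => k /andP[/andP[nk _] _].
by rewrite /A big1_seq // => w; rewrite mem_words => /andP[_ /eqP wk]; rewrite H // wk ltnS.
Qed.

Lemma newords_filter (V : nmodType) {d : nat} (F : seq 'I_d -> V) m n : (m <= n)%N ->
  \sum_(w <- newords_le (enum 'I_d) n | (size w <= m)%N) F w =
  \sum_(w <- newords_le (enum 'I_d) m) F w.
Proof.
move=> mn; rewrite big_mkcond (newords_widen mn); last by move=> w; rewrite ltnNge => /negbTE ->.
by apply: eq_big_seq => w; rewrite mem_newords_le => /andP[_ ->].
Qed.

Lemma sum_words_cons (V : nmodType) (T : Type) (s : seq T) n (G : seq T -> V) :
  \sum_(w <- words s n.+1) G w = \sum_(x <- s) \sum_(w <- words s n) G (x :: w).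
Proof. by rewrite /= big_allpairs_dep. Qed.

Lemma weight_split (a b q n : nat) : (b <= n)%N ->
  (b + (a + q) <= n)%N = (a <= n - b)%N && (q <= n - b - a)%N.
Proof. by lia. Qed.

Lemma leq_sub_swap (a b n : nat) : (0 < a)%N -> (a <= n)%N ->
  (a <= n - b)%N = (b <= n - a)%N.
Proof. by lia. Qed.

(** * Sums over families of words, as in the pushforward *)

Section MultiSums.
Context {R : realType} {d e : nat}.
Variable H : 'I_e -> seq 'I_d -> R.
Implicit Types (b : seq 'I_e) (S : seq 'I_d -> R).

(* The sum of the products of the (size g_j)!^-1 * H b_j g_j over non-empty
   words g_1, ..., g_m of total length at most n, against S (g_1 ++ ... ++ g_m). *)
Fixpoint multi_sum b n S : R :=
  if b is k :: b' then
    \sum_(g <- newords_le (enum 'I_d) n) (size g)`!%:R^-1 *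
      (H k g * multi_sum b' (n - size g)%N (fun w => S (g ++ w)))
  else S [::].

Lemma eq_multi_sum b n S S' : (forall w, (size w <= n)%N -> S w = S' w) ->
  multi_sum b n S = multi_sum b n S'.
Proof.
elim: b n S S' => [|k b IH] n S S' SS' /=; first exact: SS'.
apply: eq_big_seq => g; rewrite mem_newords_le => /andP[_ gn]; congr (_ * (_ * _)).
by apply: IH => w wn; apply: SS'; rewrite size_cat; lia.
Qed.

(** This passes from nested sums, suited to induction, to the flat sum over families of words that
    defines [Phi]. The decreasing bounds of the nested sums may be dropped because S vanishes on
    long words. *)
Lemma multi_sum_words b n n0 M S : (forall w, (n < size w)%N -> S w = 0) ->
  (n <= n0)%N -> (n <= M)%N ->
  multi_sum b M S = \sum_(g <- words (newords_le (enum 'I_d) n0) (size b))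
    (\prod_(kg <- zip b g) ((size kg.2)`!%:R^-1 * H kg.1 kg.2)) * S (flatten g).
Proof.
elim: b n M S => [|k b IH] n M S S0 nn0 nM.
  by rewrite [LHS]/= /= big_seq1 big_nil mul1r.
rewrite [LHS]/= /= big_allpairs_dep /=.
pose F g := (size g)`!%:R^-1 * (H k g * multi_sum b (M - size g) (fun w => S (g ++ w))).
have FE g : F g = \sum_(g' <- words (newords_le (enum 'I_d) n0) (size b))
    (\prod_(kg <- zip (k :: b) (g :: g')) ((size kg.2)`!%:R^-1 * H kg.1 kg.2)) *
      S (flatten (g :: g')).
  rewrite /F (IH (n - size g)%N).
  - rewrite !mulr_sumr; apply: eq_bigr => g' _.
    by rewrite big_cons /= !mulrA.
  - by move=> w wn; apply: S0; rewrite size_cat; lia.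
  - exact: leq_trans (leq_subr _ _) nn0.
  - exact: leq_sub2r.
have F0 g : (n < size g)%N -> F g = 0.
  move=> gn; rewrite FE big1 // => g' _; rewrite S0 ?mulr0 //=.
  by rewrite size_cat; exact: leq_trans (leq_addr _ _).
rewrite -[LHS]/(\sum_(g <- newords_le (enum 'I_d) M) F g) (newords_widen nM F0).
rewrite -(newords_widen nn0 F0); apply: eq_bigr => g _; exact: FE.
Qed.

End MultiSums.

Section PushForest.
Context {R : realType} {d e : nat}.
Variables (U : set 'rV[R]_d) (h : 'rV[R]_d -> 'rV[R]_e) (x : 'rV[R]_d) (N : nat).
Hypotheses (oU : open U) (sh : smooth_map_on U h) (Ux : U x).
Implicit Types (b : seq 'I_e) (S : seq 'I_d -> R) (v : 'rV[R]_d -> R)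
  (L : forest (letter d) -> R).

Let H (k : 'I_e) (g : seq 'I_d) := pds g (fun y => h y 0 k) x.

(** The multiset constraint in [Phi] becomes the pairing with this functional, so the jet formulas
    apply to the coefficients of the pushforward as well as to the rough path. *)
Definition mset_ind (c : letter d) (w : seq 'I_d) : R := (seq_mset w == val c)%:R.

Lemma symmetric_mset_ind c : symmetric_fun (mset_ind c).
Proof. by move=> w w' /eq_seq_msetP ww'; rewrite /mset_ind ww'. Qed.

Lemma Phi_multi_sum ks c M : (lwt c <= M)%N ->
  Phi h ks c x = multi_sum H ks M (mset_ind c).
Proof.
move=> cM; rewrite (@multi_sum_words _ _ _ _ _ (lwt c) (lwt c)) //; last first.
  by move=> w wc; rewrite /mset_ind; case: eqP => // /lwt_mset E; rewrite E ltnn in wc.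
rewrite /Phi big_mkcond; apply: eq_bigr => g _; rewrite /mset_ind.
by case: eqP; rewrite ?mulr1 ?mulr0.
Qed.

Lemma multi_jet1 b n S : multi_jet h (fun=> 1) x b n S = multi_sum H b n S.
Proof.
elim: b n S => [|k b IH] n S /=.
  rewrite /jet wexp_nil pds_cst mul1r [X in _ + X](_ : _ = 0) ?addr0 //.
  rewrite -[RHS](wexp0 (d := d) n); apply: eq_wexp => -[//|i w] _.
  by rewrite pds_cst mul0r.
by apply: eq_bigr => g _; rewrite IH.
Qed.

Lemma smooth_Phi ks c : smooth_on U (Phi h ks c).
Proof.
apply: smooth_sum => // g _; apply: smooth_prod => // kg _.
exact: (smoothM oU (smooth_cst _) (smooth_pds _ (sh kg.1))).
Qed.

(** The word of derivatives of v, which comes from the tuple at the root, is moved behind the words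
    g_1, ..., g_m, where [multi_jet] has it; symmetry of S permits this. *)
Lemma wexp_multi_sum v b n S : symmetric_fun S ->
  wexp n (fun w => pds w v x * multi_sum H b (n - size w) (fun g => S (w ++ g))) =
  multi_jet h v x b n S.
Proof.
elim: b n S => [|k b IH] n S sS /=.
  by rewrite /jet; apply: eq_wexp => w _; rewrite cats0.
pose G (w g : seq 'I_d) := pds w v x * (H k g *
  multi_sum H b (n - size w - size g) (fun g' => S (w ++ g ++ g'))).
transitivity (wexp n (fun w => wexp (n - size w) (fun g => if g is [::] then 0 else G w g))).
  apply: eq_wexp => w _; rewrite (wexp_newords (n - size w) (G w)) mulr_sumr.
  by apply: eq_bigr => g _; rewrite /G mulrCA.
rewrite (wexp_swap n (fun w g => if g is [::] then 0 else G w g)).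
transitivity (wexp n (fun g => if g is [::] then 0 else
    H k g * multi_jet h v x b (n - size g) (fun w => S (g ++ w)))); last first.
  by rewrite wexp_newords.
apply: eq_wexp => -[|i g] gn; first exact: wexp0.
rewrite -(IH _ _ (symmetric_cat (i :: g) sS)) -wexpZ; apply: eq_wexp => w _.
rewrite /G mulrCA subnAC; congr (_ * (_ * _)).
apply: eq_multi_sum => g' _; apply: sS.
exact: (permEl (perm_catCA w (i :: g) g')).
Qed.

Definition push_leaves b : seq (R * forest (letter d)) :=
  foldr (fun u acc => [seq (y.1 * z.1, y.2 :: z.2) | y <- push_tree h N x u, z <- acc])
        [:: (1, [::])] (bullets b).

Lemma sum_push_tree (V : nmodType) (G : R * tree (letter d) -> V) k b :
  \sum_(q <- push_tree h N x (Node k (bullets b))) G q =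
  \sum_(c <- letters_le N) \sum_(w <- words_le (enum 'I_d) N) \sum_(q <- push_leaves b)
    G ((size w)`!%:R^-1 * pds w (Phi h (enum_mset (val k)) c) x * q.1,
       Node c (bullets w ++ q.2)).
Proof.
by rewrite big_flatten big_map; apply: eq_bigr => c _; rewrite big_allpairs_dep.
Qed.

Lemma enum_letter1 (k : 'I_e) : enum_mset (val (letter1 k)) = [:: k] :> seq 'I_e.
Proof. by apply: perm_small_eq => //; exact: perm_eq_seq_mset. Qed.

Lemma Phi1 (k : 'I_e) c y : Phi h [:: k] c y =
  \sum_(g <- newords_le (enum 'I_d) (lwt c) | seq_mset g == val c)
    (size g)`!%:R^-1 * pds g (fun y => h y 0 k) y.
Proof.
rewrite /Phi [size [:: k]]/= big_mkcond sum_words_cons [RHS]big_mkcond; apply: eq_bigr => g _.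
by rewrite /= big_seq1 cats0 big_seq1.
Qed.

Lemma pds_Phi1 (k : 'I_e) c w : pds w (Phi h [:: k] c) x =
  \sum_(g <- newords_le (enum 'I_d) (lwt c) | seq_mset g == val c)
    (size g)`!%:R^-1 * H k (w ++ g).
Proof.
rewrite (pds_local w oU Ux (fun y _ => Phi1 k c y)).
have s1 (g : seq 'I_d) : smooth_on U (pds g (fun y => h y 0 k)) := smooth_pds g (sh k).
rewrite (pds_sum _ _ oU _ Ux); last by move=> g _; exact: (smoothZ _ oU (s1 g)).
by apply: eq_bigr => g _; rewrite (pdsZ _ _ oU (s1 g) Ux) /H pds_cat.
Qed.

(** The derivative of [Phi] for the single index k along w sums those of h^k along w ++ g with (g) =
    c. The bracket relation, in the form of [letter_sum], then merges letter and bullets, and the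
    leaf turns into the Taylor expansion of h^k in bullets. *)
Lemma push_leaf k n L f : consistent_functional n L -> (n <= N)%N ->
  \sum_(y <- push_tree h N x (bullet (letter1 k)) | (twt lwt y.2 + fwt lwt f <= n)%N)
    y.1 * L (y.2 :: f) =
  \sum_(g <- newords_le (enum 'I_d) (n - fwt lwt f))
    (size g)`!%:R^-1 * (H k g * L (bullets g ++ f)).
Proof.
move=> cL nN; have sT : symmetric_fun (H k) := symmetric_pds oU Ux (sh k).
rewrite -(letter_sum (M := lwt) f sT cL nN) //.
rewrite big_mkcond (sum_push_tree _ _ [::]); apply: eq_bigr => c _.
rewrite [RHS]big_mkcond; apply: eq_bigr => w _; rewrite big_seq1.
have -> : (size w + lwt c + fwt lwt f)%N =
    (twt lwt (Node c (bullets w ++ [::])) + fwt lwt f)%N.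
  by rewrite cats0 twt_node fwt_bullets [(size w + _)%N]addnC.
by rewrite [_.2]/= cats0 enum_letter1 pds_Phi1 mulr1.
Qed.

(** Leaves are expanded one at a time; the bullets of the first are absorbed into the functional,
    which stays consistent after the shift. *)
Lemma push_leaves_sum b n L : consistent_functional n L -> (n <= N)%N ->
  \sum_(q <- push_leaves b | (fwt lwt q.2 <= n)%N) q.1 * L q.2 =
  multi_sum H b n (fun w => L (bullets w)).
Proof.
elim: b n L => [|k b IH] n L cL nN; first by rewrite /push_leaves /= big_mkcond big_seq1 mul1r.
rewrite /push_leaves [foldr _ _ _]/= -/(push_leaves b) big_mkcond big_allpairs_dep exchange_big /=.
transitivity (\sum_(z <- push_leaves b) z.1 *
    \sum_(g <- newords_le (enum 'I_d) (n - fwt lwt z.2))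
      (size g)`!%:R^-1 * (H k g * L (bullets g ++ z.2))).
  apply: eq_bigr => z _; rewrite -(push_leaf k z.2 cL nN) mulr_sumr [RHS]big_mkcond.
  apply: eq_bigr => y _; rewrite fwt_cons.
  by case: ifP => // _; rewrite mulrAC mulrC.
transitivity (\sum_(g <- newords_le (enum 'I_d) n) \sum_(z <- push_leaves b)
   (if (fwt lwt z.2 <= n - size g)%N then (size g)`!%:R^-1 * (H k g * (z.1 * L (bullets g ++ z.2)))
    else 0)).
  rewrite exchange_big; apply: eq_bigr => z _.
  rewrite -(newords_filter _ (leq_subr (fwt lwt z.2) n)) mulr_sumr big_mkcond.
  apply: eq_big_seq => g; rewrite mem_newords_le => /andP[g0 gn].
  rewrite (leq_sub_swap (fwt lwt z.2) g0 gn).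
  by case: ifP => // _; rewrite mulrCA; congr (_ * _); exact: mulrCA.
apply: eq_big_seq => g; rewrite mem_newords_le => /andP[g0 gn].
rewrite -big_mkcond /= -mulr_sumr -mulr_sumr; congr (_ * (_ * _)).
rewrite (IH _ _ (consistent_functional_shift gn cL)); last by lia.
by apply: eq_multi_sum => w _; rewrite bullets_cat.
Qed.

(* The branch [Node c (bullets w)] of the functional f |-> Z [:: Node c f], cut
   off at the weights where it is not controlled. *)
Definition branch (Z : forest (letter d) -> R) (c : letter d) (w : seq 'I_d) : R :=
  if (size w + lwt c <= N)%N then Z [:: Node c (bullets w)] else 0.

Definition consistent_branches (Z : forest (letter d) -> R) := forall c,
  (lwt c <= N)%N -> consistent_functional (N - lwt c) (fun f => Z [:: Node c f]).

Lemma symmetric_branch Z c : consistent_branches Z -> symmetric_fun (branch Z c).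
Proof.
move=> cZ w w' ww'; rewrite /branch (perm_size ww'); case: ifP => // wc.
have /cZ [iZ _] : (lwt c <= N)%N by apply: leq_trans wc; exact: leq_addl.
apply: iZ; last exact: iso_bullets.
by rewrite fwt_bullets (perm_size ww'); lia.
Qed.

(** Trees with a root and single-letter leaves are the only ones in a rough integral. Their leaves
    give a [multi_sum], and the derivatives at the root complete it to a [multi_jet]. *)
Lemma push_node (Z : forest (letter d) -> R) (k : letter e) b : consistent_branches Z ->
  \sum_(q <- push_tree h N x (Node k (bullets b)) | (twt lwt q.2 <= N)%N)
    q.1 * Z [:: q.2] =
  \sum_(c <- letters_le N)
    multi_jet h (Phi h (enum_mset (val k)) c) x b (N - lwt c) (branch Z c).
Proof.
move=> cZ; rewrite big_mkcond sum_push_tree; apply: eq_big_seq => c; rewrite mem_letters_le => cN.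
set v := Phi h (enum_mset (val k)) c.
rewrite -(wexp_multi_sum v _ _ (symmetric_branch c cZ)).
rewrite /wexp -(sum_words_le_filter _ (leq_subr (lwt c) N)) [RHS]big_mkcond.
apply: eq_bigr => w _.
case: ifP => wcN; last first.
  rewrite big1 // => q _.
  by rewrite [_.2]/= twt_node fwt_cat fwt_bullets (weight_split _ _ cN) wcN.
have H1 := consistent_functional_shift wcN (cZ c cN).
have H2 : (N - lwt c - size w <= N)%N := leq_trans (leq_subr _ _) (leq_subr _ _).
have E := push_leaves_sum b H1 H2.
transitivity ((size w)`!%:R^-1 * (pds w v x *
  \sum_(q <- push_leaves b | (fwt lwt q.2 <= N - lwt c - size w)%N)
    q.1 * Z [:: Node c (bullets w ++ q.2)])); last first.
  rewrite E; congr (_ * (_ * _)); apply: eq_multi_sum => g gn.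
  rewrite /branch size_cat ifT ?bullets_cat //.
  by rewrite addnC (weight_split _ _ cN) wcN.
rewrite !mulr_sumr [RHS]big_mkcond; apply: eq_bigr => q _.
rewrite [_.2]/= [_.1]/= twt_node fwt_cat fwt_bullets.
rewrite (weight_split _ _ cN) wcN /=.
by case: ifP => // _; rewrite -!mulrA.
Qed.

End PushForest.

(** * Calculus of uniform bounds *)

Section Dominated.
Context {R : realType} {T : Type}.
Implicit Types (P : T -> Prop) (F G B : T -> R).

(** The index type is arbitrary, so that pairs (s, t) and triples (s, u, t) share one calculus. The
    constant is nonnegative, as products of bounds require. *)
Definition dominated P F B := exists2 C : R, 0 <= C & forall x, P x -> `|F x| <= C * B x.

Lemma dominated_ext P F G B : (forall x, P x -> F x = G x) -> dominated P F B ->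
  dominated P G B.
Proof. by move=> FG [C C0 H]; exists C => // x Px; rewrite -FG //; exact: H. Qed.

Lemma dominatedD P F G B : dominated P F B -> dominated P G B ->
  dominated P (fun x => F x + G x) B.
Proof.
move=> [C C0 HC] [D D0 HD]; exists (C + D); first exact: addr_ge0.
move=> x Px; rewrite mulrDl; apply: le_trans (ler_normD _ _) _.
by apply: lerD; [exact: HC|exact: HD].
Qed.

Lemma dominatedN P F B : dominated P F B -> dominated P (fun x => - F x) B.
Proof. by move=> [C C0 HC]; exists C => // x Px; rewrite normrN; exact: HC. Qed.

Lemma dominatedM P F G B B' : dominated P F B -> dominated P G B' ->
  dominated P (fun x => F x * G x) (fun x => B x * B' x).
Proof.
move=> [C C0 HC] [D D0 HD]; exists (C * D); first exact: mulr_ge0.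
move=> x Px; rewrite normrM mulrACA; apply: ler_pM => //; [exact: HC|exact: HD].
Qed.

Lemma dominatedZ P c F B : dominated P F B -> dominated P (fun x => c * F x) B.
Proof.
move=> [C C0 HC]; exists (`|c| * C); first exact: mulr_ge0.
by move=> x Px; rewrite normrM -mulrA; apply: ler_wpM2l => //; exact: HC.
Qed.

Lemma dominated_bounded P F G B : dominated P F (fun=> 1) -> dominated P G B ->
  dominated P (fun x => F x * G x) B.
Proof.
move=> HF HG; have [C C0 HC] := dominatedM HF HG; exists C => // x /HC.
by rewrite mul1r.
Qed.

Lemma dominated0 P B : (forall x, P x -> 0 <= B x) -> dominated P (fun=> 0) B.
Proof. by move=> HB; exists 0 => // x _; rewrite normr0 mul0r. Qed.

Lemma dominated_sum (I : eqType) (r : seq I) P (F : I -> T -> R) B :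
  (forall i, i \in r -> dominated P (F i) B) -> (forall x, P x -> 0 <= B x) ->
  dominated P (fun x => \sum_(i <- r) F i x) B.
Proof.
move=> HF B0; elim: r HF => [|i r IH] HF.
  by apply: dominated_ext (dominated0 B0) => x _; rewrite big_nil.
apply: (@dominated_ext _ (fun x => F i x + \sum_(i <- r) F i x)) => [x _|].
  by rewrite big_cons.
apply: dominatedD; first by apply: HF; rewrite mem_head.
by apply: IH => j jr; apply: HF; rewrite inE jr orbT.
Qed.

Lemma dominated_wexp {d : nat} n P (F : seq 'I_d -> T -> R) B :
  (forall w, (size w <= n)%N -> dominated P (F w) B) -> (forall x, P x -> 0 <= B x) ->
  dominated P (fun x => wexp n (fun w => F w x)) B.
Proof.
move=> HF B0; apply: dominated_sum => // w; rewrite mem_words_le => wn.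
by apply: dominatedZ; exact: HF.
Qed.

End Dominated.

(** At base 0 the law of exponents can fail when the exponents cancel, since 0 to the power 0 is 1;
    nonnegative exponents exclude this. *)
Lemma powRD_ge0 {R : realType} (x r s : R) : 0 <= r -> 0 <= s ->
  x `^ r * x `^ s = x `^ (r + s).
Proof.
move=> r0 s0; have [->|rn0] := eqVneq r 0; first by rewrite powRr0 mul1r add0r.
have rp : 0 < r by rewrite lt_def rn0.
rewrite powRD //; apply/implyP => /eqP rs; move: rp; rewrite ltNge => /negP[].
by rewrite -rs lerDl.
Qed.

Section Brackets.
Context {R : realType} {d : nat}.
Implicit Types (c : letter d) (w : seq 'I_d) (f g : forest (letter d)).

Lemma splits_nil (V : nmodType) (F : seq 'I_d -> V) w :
  \sum_(IJ <- splits w) (if IJ.1 is [::] then F IJ.2 else 0) = F w.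
Proof.
elim: w F => [|x w IH] F; first by rewrite /= big_seq1.
rewrite (sum_splits (fun I J => if I is [::] then F J else 0)) -(IH (fun J => F (x :: J))).
by apply: eq_bigr => -[[|y I] J] _ /=; rewrite add0r.
Qed.

(** The terms subtracted in the bracket belong to the splittings with both parts non-empty; an empty
    I gives the bracket letter itself. *)
Lemma bracket_splits (L : forest (letter d) -> R) i w f :
  L (bullet (letter_of i w) :: f) = \sum_(q <- bracket i w) q.1 * L (q.2 ++ f) ->
  L (bullets (i :: w) ++ f) = \sum_(IJ <- splits (i :: w))
    (if IJ.2 is j :: J then L (Node (letter_of j J) (bullets IJ.1) :: f) else 0).
Proof.
rewrite /bracket big_cons mul1r [(1, _).2]/= big_flatten big_map => E.
pose F J := if J is j :: J' then L (bullet (letter_of j J') :: f) else 0.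
pose S := \sum_(IJ <- splits (i :: w)) (if (IJ.1, IJ.2) is (_ :: _, j :: J)
    then L (Node (letter_of j J) (bullets IJ.1) :: f) else 0).
have -> : \sum_(IJ <- splits (i :: w))
    (if IJ.2 is j :: J then L (Node (letter_of j J) (bullets IJ.1) :: f) else 0) =
    F (i :: w) + S.
  rewrite -(splits_nil F) /S -big_split; apply: eq_bigr => -[[|x I] [|j J]] _ /=;
  by rewrite ?addr0 ?add0r.
rewrite /F E -addrA -[LHS]addr0; congr (_ + _); rewrite /S -big_split big1 // => -[I J] _ /=.
case: I => [|x I]; first by rewrite big_nil addr0.
by case: J => [|j J]; rewrite ?big_nil ?addr0 // big_seq1 /= mulN1r addNr.
Qed.

Lemma sum_fcuts_bullets (V : nmodType) (F : forest (letter d) -> forest (letter d) -> V) w :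
  \sum_(q <- fcuts (bullets w)) F q.1 q.2 =
  \sum_(IJ <- splits w) F (bullets IJ.1) (bullets IJ.2).
Proof.
elim: w F => [|i w IH] F; first by rewrite /= !big_seq1.
rewrite (sum_splits (fun I J => F (bullets I) (bullets J))).
rewrite [fcuts _]/= -/(fcuts (bullets w)) !big_cat big_map /= big_map big_nil addr0.
rewrite (IH (fun f g => F (bullet (letter1 i) :: f) g)) (IH (fun f g => F f (bullet (letter1 i) :: g))).
by rewrite -big_split.
Qed.

(** An admissible cut here is the total cut or a set of edges below leaves, that is a splitting of
    w. *)
Lemma sum_fcuts_node (V : nmodType) (F : forest (letter d) -> forest (letter d) -> V) c w :
  \sum_(q <- fcuts [:: Node c (bullets w)]) F q.1 q.2 =
  F [:: Node c (bullets w)] [::] +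
  \sum_(IJ <- splits w) F (bullets IJ.1) [:: Node c (bullets IJ.2)].
Proof.
rewrite -(sum_fcuts_bullets (fun f g => F f [:: Node c g])).
rewrite [fcuts _]/= -/(fcuts (bullets w)) big_cons; congr (_ + _).
rewrite big_flatten big_map big_map; apply: eq_bigr => q _.
by rewrite big_seq1 /= cats0.
Qed.

End Brackets.

(** * Rough integrals *)

Lemma fwt1_node {d : nat} (c : letter d) f : fwt lwt [:: Node c f] = (lwt c + fwt lwt f)%N.
Proof. by rewrite fwt_cons twt_node addn0. Qed.

Lemma fwt1_bullet {d : nat} (i : 'I_d) : fwt lwt [:: bullet (letter1 i)] = 1%N.
Proof. by rewrite fwt1_node /letter1 lwt_letter_of. Qed.

Lemma weight_total (l j n : nat) : (l <= n)%N -> (j <= n - l)%N ->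
  n.+1 = ((n - l - j).+1 + (j + l))%N.
Proof. by lia. Qed.

Section RoughIntegral.
Context {R : realType} {d : nat}.
Variables (p T : R) (omega : R -> R -> R).
Hypotheses (hp : 1 <= p) (comega : control T omega).

Local Notation N := (Num.truncn p).
Local Notation theta := (N.+1%:R / p).

Lemma theta_gt1 : 1 < theta.
Proof.
have p0 : 0 < p by apply: lt_le_trans hp.
rewrite ltr_pdivlMr // mul1r.
by have /andP[] := truncn_itv (ltW p0).
Qed.

Lemma p_gt0 : 0 < p. Proof. exact: lt_le_trans hp. Qed.

Variables (a b : R) (X : srp R d).
Hypotheses (a0 : 0 <= a) (bT : b <= T) (sX : simple_brp p omega a b X).

Local Notation x := (srp_trace X).

Let simplexT s t : simplex a b (s, t) -> simplex 0 T (s, t).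
Proof. by move=> [/= as_ st tb]; split => //=; [exact: le_trans as_|exact: le_trans bT]. Qed.

Lemma omega_simplex_ge0 s t : simplex a b (s, t) -> 0 <= omega s t.
Proof. by move=> /simplexT; case: comega => _ og _ _; exact: og. Qed.

Lemma omega_simplex_super s u t : a <= s -> s <= u -> u <= t -> t <= b ->
  omega s u + omega u t <= omega s t.
Proof.
move=> as_ su ut tb; case: comega => _ _ _; apply => //; first exact: le_trans as_.
exact: le_trans bT.
Qed.

Lemma omega_simplex_mono s u v t : a <= s -> s <= u -> u <= v -> v <= t -> t <= b ->
  omega u v <= omega s t.
Proof.
apply: (@omega_mono _ a b) => [s' t' as_ st tb|s' u' t'].
  by apply: omega_simplex_ge0; split.
exact: omega_simplex_super.
Qed.

Lemma brp_functional s t : simplex a b (s, t) -> consistent_functional N (fun f => X f s t).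
Proof.
move=> st; have [[iX _ _ _ _] cX _] := sX; split=> [f g fN fg|i w f wfN]; first exact: iX.
apply: (bracket_splits (L := fun f => X f s t)).
exact: (cX i w f [::] isT wfN s t st).
Qed.

(** Consistency is used with the bracket grafted on the root of [Node c f], the position [[:: 0]];
    in [brp_functional] it was the position [[::]]. *)
Lemma brp_branches s t : simplex a b (s, t) -> consistent_branches N (fun f => X f s t).
Proof.
move=> st c cN; have [[iX _ _ _ _] cX _] := sX; split=> [f g fN fg|i w f wfN].
  apply: iX => //; last by apply: iso_node => //; exact: iso_nil.
  by rewrite fwt1_node -leq_subRL.
apply: (bracket_splits (L := fun f => X [:: Node c f] s t)).
apply: (cX i w [:: Node c f] [:: 0%N] isT _ s t st).
by rewrite fwt1_node addnCA -leq_subRL.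
Qed.

Lemma brp_bullets w s t : (size w <= N)%N -> simplex a b (s, t) ->
  X (bullets w) s t = mon (x t - x s) w.
Proof.
move=> + st; have [[_ _ X1 _ XM] _ Xtr] := sX.
elim: w => [|i w IH] wN; first by rewrite X1 // /mon big_nil.
have wN' : (size w <= N)%N := ltnW wN.
rewrite -[bullets (i :: w)]/([:: bullet (letter1 i)] ++ bullets w) XM //; last first.
  by rewrite fwt_bullets fwt1_bullet.
by rewrite IH // /mon big_cons -(Xtr i s t st) !mxE.
Qed.

(** The total cut gives the first summand. In the others the pruned part consists of bullets, on
    which the rough path is a product of increments of the trace. *)
Lemma brp_branch_chen c w s u t : (size w + lwt c <= N)%N ->
  a <= s -> s <= u -> u <= t -> t <= b ->
  X [:: Node c (bullets w)] s t = X [:: Node c (bullets w)] s u +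
  \sum_(IJ <- splits w) mon (x u - x s) IJ.1 * X [:: Node c (bullets IJ.2)] u t.
Proof.
move=> wN as_ su ut tb; have [[_ _ X1 chen _] _ _] := sX.
have wN' : (fwt lwt [:: Node c (bullets w)] <= N)%N.
  by rewrite fwt1_node fwt_bullets addnC.
have suS : simplex a b (s, u) by split => //=; exact: le_trans tb.
have utS : simplex a b (u, t) by split => //=; exact: le_trans su.
rewrite (chen _ _ _ _ wN' as_ su ut tb) (sum_fcuts_node (fun f g => X f s u * X g u t)).
rewrite X1 // mulr1; congr (_ + _); apply: eq_big_seq => -[I J] /splits_perm /perm_size E.
rewrite brp_bullets //=; apply: leq_trans wN; rewrite -E size_cat -addnA.
exact: leq_addr.
Qed.

Lemma trace_dominated : dominated (fun st => simplex a b st) (fun st => `|x st.2 - x st.1|)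
  (fun st => omega st.1 st.2 `^ p^-1).
Proof.
have [[_ Xb _ _ _] _ Xtr] := sX.
have N0 : (0 < N)%N by rewrite truncn_gt_nat.
have H : dominated (fun st => simplex a b st)
    (fun st => \sum_(i <- enum 'I_d) `|X [:: bullet (letter1 i)] st.1 st.2|)
    (fun st => omega st.1 st.2 `^ p^-1).
  apply: dominated_sum => [i _|st _]; last exact: powR_ge0.
  have w1 := fwt1_bullet i.
  have [|_ [C HC]] := Xb [:: bullet (letter1 i)]; first by rewrite w1.
  exists `|C| => // -[s t] st; rewrite normr_id; apply: le_trans (HC s t st) _.
  by rewrite w1 mul1r; apply: ler_wpM2r; rewrite ?powR_ge0 ?ler_norm.
have [C C0 HC] := H; exists C => // -[s t] st; apply: le_trans (HC (s, t) st).
rewrite normr_id ger0_norm; last by apply: sumr_ge0.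
apply: normr_row_le => [|i]; first exact: sumr_ge0.
rewrite (bigD1_seq i) ?enum_uniq ?mem_enum //= -(Xtr i s t st) !mxE.
by rewrite lerDl sumr_ge0.
Qed.

Lemma branch_dominated c w :
  dominated (fun st => simplex a b st) (fun st => branch N (fun f => X f st.1 st.2) c w)
    (fun st => omega st.1 st.2 `^ ((size w + lwt c)%:R / p)).
Proof.
have [wN|wN] := boolP (size w + lwt c <= N)%N; last first.
  apply: (@dominated_ext _ _ _ (fun=> 0)) => [st _|].
    by rewrite /branch (negbTE wN).
  by apply: dominated0 => st _; exact: powR_ge0.
have [[_ Xb _ _ _] _ _] := sX.
have wE : fwt lwt [:: Node c (bullets w)] = (size w + lwt c)%N.
  by rewrite fwt1_node fwt_bullets addnC.
have [|_ [C HC]] := Xb [:: Node c (bullets w)]; first by rewrite wE.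
exists `|C| => // -[s t] st; rewrite /branch wN; apply: le_trans (HC s t st) _.
by rewrite wE; apply: ler_wpM2r; rewrite ?powR_ge0 ?ler_norm.
Qed.

Definition trace_set : set 'rV[R]_d := x @` `[a, b].

(** The trace is continuous because its coordinates are, up to constants, the components on single
    bullets with the first time frozen at a. *)
Lemma trace_compact : compact trace_set.
Proof.
apply: continuous_compact; last exact: segment_compact.
apply/subspace_continuousP => u; rewrite /= in_itv /= => /andP[au ub].
have [[_ Xb _ _ _] _ Xtr] := sX.
have N0 : (0 < N)%N by rewrite truncn_gt_nat.
apply/cvgrPdist_lt => e e0; rewrite near_withinE.
have H i : \forall v \near u, a <= v <= b -> `|(x u - x v) 0 i| < e.
  have w1 := fwt1_bullet i.
  have [|/subspace_continuousP cX _] := Xb [:: bullet (letter1 i)]; first by rewrite w1.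
  have auS : simplex a b (a, u) by split.
  have /cvgrPdist_lt /(_ _ e0) := cX (a, u) auS.
  rewrite near_withinE => /nbhs_ballP[r /= rp Hr].
  apply/nbhs_ballP; exists r => // v uv /andP[av vb].
  have avS : simplex a b (a, v) by split.
  have H1 : `|X [:: bullet (letter1 i)] a u - X [:: bullet (letter1 i)] a v| < e.
    by apply: (Hr (a, v)) => //; split => //=; exact: ballxx.
  move: H1; rewrite -!Xtr // !mxE.
  by have -> : x u 0 i - x a 0 i - (x v 0 i - x a 0 i) = x u 0 i - x v 0 i by ring.
have H2 : \forall v \near u, forall i, a <= v <= b -> `|(x u - x v) 0 i| < e.
  exact: (@filter_forall _ _ (fun i v => a <= v <= b -> `|(x u - x v) 0 i| < e) (nbhs u) _ H).
near=> v; rewrite /= in_itv /= => avb.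
have Hv : forall i, a <= v <= b -> `|(x u - x v) 0 i| < e by near: v; exact: H2.
rewrite /Num.Def.normr /= mx_normrE bigmax_lt //= => -[i j] _ /=.
by rewrite ord1; exact: Hv.
Unshelve. all: by end_near. Qed.

Variables (U : set 'rV[R]_d).
Hypotheses (oU : open U) (xU : forall u, a <= u <= b -> U (x u)).

Lemma trace_sub : trace_set `<=` U.
Proof. by move=> _ [u + <-]; rewrite /= in_itv /=; exact: xU. Qed.

Lemma trace_setP u : a <= u <= b -> trace_set (x u).
Proof. by move=> aub; exists u => //; rewrite /= in_itv. Qed.

Lemma riemann_term_jet (phi : letter d -> 'rV[R]_d -> R) s t :
  riemann_term p X phi s t =
  \sum_(c <- letters_le N) jet (N - lwt c) (phi c) (x s) (branch N (fun f => X f s t) c).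
Proof.
apply: eq_big_seq => c; rewrite mem_letters_le => cN.
under eq_bigr do rewrite -mulrA.
rewrite (wexp_filter (fun w => pds w (phi c) (x s) * X [:: Node c (bullets w)] s t) _ (leqnn N)) cN.
apply: eq_wexp => w wn; rewrite /branch ifT //.
by rewrite addnC -leq_subRL.
Qed.

Lemma smooth_trace_bounded f : smooth_on U f ->
  dominated (fun st => simplex a b st) (fun st => f (x st.1)) (fun=> 1).
Proof.
move=> sf; have [B B0 HB] := compact_bounded_smooth trace_compact trace_sub sf.
exists B => // -[s t] [/= as_ st tb]; rewrite mulr1; apply: HB.
by apply: trace_setP; rewrite as_ (le_trans st).
Qed.

Lemma trem_dominated n f : smooth_on U f ->
  dominated (fun st => simplex a b st) (fun st => trem n f (x st.1) (x st.2))
    (fun st => omega st.1 st.2 `^ (n.+1%:R / p)).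
Proof.
move=> sf; have [C C0 HC] := taylor_compact n oU trace_compact trace_sub sf.
have [D D0 HD] := trace_dominated.
exists (C * D ^+ n.+1); first by rewrite mulr_ge0 ?exprn_ge0.
move=> [s t] st; have [/= as_ st' tb] := st.
have Ks : trace_set (x s) by apply: trace_setP; rewrite as_ (le_trans st').
have Kt : trace_set (x t) by apply: trace_setP; rewrite tb (le_trans as_).
apply: le_trans (HC _ _ Ks Kt) _; rewrite -mulrA; apply: ler_wpM2l => //.
have -> : n.+1%:R / p = p^-1 * n.+1%:R by rewrite mulrC.
rewrite powRrM powR_mulrn ?powR_ge0 // -exprMn.
apply: lerXn2r; rewrite ?nnegrE ?mulr_ge0 ?powR_ge0 //.
by have := HD (s, t) st; rewrite normr_id.
Qed.

(** Chen's relation regroups the terms by the branch J that remains over [u, t]. Its coefficient is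
    the Taylor polynomial at x_s of the J-th derivative of phi_c, evaluated at x_u, and is compared
    with the true derivative at x_u. *)
Lemma riemann_term_defect (phi : letter d -> 'rV[R]_d -> R) s u t :
  (forall c, smooth_on U (phi c)) -> a <= s -> s <= u -> u <= t -> t <= b ->
  riemann_term p X phi s t - (riemann_term p X phi s u + riemann_term p X phi u t) =
  - \sum_(c <- letters_le N) wexp (N - lwt c) (fun J =>
      trem (N - lwt c - size J) (pds J (phi c)) (x s) (x u) *
      branch N (fun f => X f u t) c J).
Proof.
move=> sphi as_ su ut tb; rewrite !riemann_term_jet -big_split -sumrB -sumrN /=.
apply: eq_big_seq => c; rewrite mem_letters_le => cN.
set n := (N - lwt c)%N.
have wcN (w : seq 'I_d) : (size w <= n)%N -> (size w + lwt c <= N)%N.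
  by rewrite /n [(size w + _)%N]addnC leq_subRL.
have usS : U (x s) by apply: xU; rewrite as_ (le_trans su) // (le_trans ut).
pose S := branch N (fun f => X f u t) c.
have E : jet n (phi c) (x s) (branch N (fun f => X f s t) c) =
   jet n (phi c) (x s) (branch N (fun f => X f s u) c) +
   wexp n (fun J => wexp (n - size J) (fun I =>
     pds I (pds J (phi c)) (x s) * mon (x u - x s) I) * S J).
  transitivity (jet n (phi c) (x s) (branch N (fun f => X f s u) c) +
    wexp n (fun w => \sum_(IJ <- splits w)
      pds (IJ.1 ++ IJ.2) (phi c) (x s) * (mon (x u - x s) IJ.1 * S IJ.2))).
    rewrite /jet -wexpD; apply: eq_wexp => w wn.
    rewrite {1 2}/branch (wcN w wn) (brp_branch_chen (wcN w wn) as_ su ut tb) mulrDr.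
    congr (_ + _); rewrite mulr_sumr; apply: eq_big_seq => -[I J] /splits_perm pw /=.
    rewrite (pds_perm oU usS (sphi c) pw); congr (_ * (_ * _)).
    rewrite /S /branch ifT //; have := wcN w wn; rewrite -(perm_size pw) size_cat.
    by apply: leq_trans; rewrite leq_add2r leq_addl.
  congr (_ + _).
  rewrite (wexp_splits n (fun I J => pds (I ++ J) (phi c) (x s) * (mon (x u - x s) I * S J))).
  rewrite (wexp_swap n (fun I J => pds (I ++ J) (phi c) (x s) * (mon (x u - x s) I * S J))).
  apply: eq_wexp => J _; rewrite -wexpZr; apply: eq_wexp => I _.
  by rewrite pds_cat mulrA.
rewrite E opprD addrACA subrr add0r.
have -> : jet n (phi c) (x u) S = wexp n (fun J => pds J (phi c) (x u) * S J) by [].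
rewrite -mulN1r -wexpZ -[- wexp _ _]mulN1r -wexpZ -wexpD; apply: eq_wexp => J _.
by rewrite /trem /taypoly /S; ring.
Qed.

(** With m = N - |c| - |J|, the remainder carries the exponent (m + 1) / p and the branch (|J| +
    |c|) / p; they add up to theta for every c and J. *)
Lemma riemann_term_almost_additive (phi : letter d -> 'rV[R]_d -> R) :
  (forall c, smooth_on U (phi c)) ->
  exists2 C : R, 0 <= C & forall s u t, a <= s -> s <= u -> u <= t -> t <= b ->
    `|riemann_term p X phi s t - (riemann_term p X phi s u + riemann_term p X phi u t)|
      <= C * omega s t `^ theta.
Proof.
move=> sphi.
pose P (sut : R * R * R) := [/\ a <= sut.1.1, sut.1.1 <= sut.1.2, sut.1.2 <= sut.2 & sut.2 <= b].
have [C C0 HC] : dominated P (fun sut => - \sum_(c <- letters_le N) wexp (N - lwt c) (fun J =>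
      trem (N - lwt c - size J) (pds J (phi c)) (x sut.1.1) (x sut.1.2) *
      branch N (fun f => X f sut.1.2 sut.2) c J)) (fun sut => omega sut.1.1 sut.2 `^ theta).
  apply: dominatedN; apply: dominated_sum => [c|sut _]; last exact: powR_ge0.
  rewrite mem_letters_le => cN; apply: dominated_wexp => [J Jn|sut _]; last exact: powR_ge0.
  set m := (N - lwt c - size J)%N.
  have [C C0 HC] := trem_dominated m (smooth_pds J (sphi c)).
  have [D D0 HD] := branch_dominated c J.
  exists (C * D); first exact: mulr_ge0.
  move=> [[s u] t] [/= as_ su ut tb].
  have suS : simplex a b (s, u) by split => //=; exact: le_trans tb.
  have utS : simplex a b (u, t) by split => //=; exact: le_trans su.
  have st := le_trans su ut.
  have os : omega s u <= omega s t := omega_simplex_mono as_ (lexx s) su ut tb.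
  have ot : omega u t <= omega s t := omega_simplex_mono as_ su ut (lexx t) tb.
  have p0 := p_gt0.
  have os0 := omega_simplex_ge0 suS; have ot0 := omega_simplex_ge0 utS.
  have e1 : 0 <= m.+1%:R / p by rewrite divr_ge0 // ltW.
  have e2 : 0 <= (size J + lwt c)%:R / p by rewrite divr_ge0 // ltW.
  have -> : theta = m.+1%:R / p + (size J + lwt c)%:R / p.
    rewrite -mulrDl -natrD; congr (_%:R * _).
    exact: weight_total cN Jn.
  rewrite -powRD_ge0 // normrM mulrACA; apply: ler_pM => //.
    apply: le_trans (HC (s, u) suS) _; apply: ler_wpM2l => //.
    by apply: ge0_ler_powR; rewrite ?nnegrE // (le_trans os0).
  apply: le_trans (HD (u, t) utS) _; apply: ler_wpM2l => //.
  by apply: ge0_ler_powR; rewrite ?nnegrE // (le_trans os0).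
exists C => // s u t as_ su ut tb; rewrite (riemann_term_defect sphi as_ su ut tb).
by apply: (HC ((s, u), t)).
Qed.

Definition integral_path (phi : letter d -> 'rV[R]_d -> R) (J : R -> R) :=
  dominated (fun st => simplex a b st)
    (fun st => riemann_term p X phi st.1 st.2 - (J st.2 - J st.1))
    (fun st => omega st.1 st.2 `^ theta).

Lemma integral_path_exists (phi : letter d -> 'rV[R]_d -> R) :
  (forall c, smooth_on U (phi c)) -> exists J, integral_path phi J.
Proof.
move=> /riemann_term_almost_additive[C C0 HC].
have [J [K [K0 HK]]] := @sewing _ a b omega (riemann_term p X phi) C theta
  (fun s t as_ st tb => omega_simplex_ge0 (And3 as_ st tb)) omega_simplex_super C0 theta_gt1 HC.
by exists J, K => // -[s t] [/= as_ st tb]; exact: HK.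
Qed.

Lemma integral_path_rough (phi : letter d -> 'rV[R]_d -> R) J s t :
  integral_path phi J -> a <= s -> t <= b -> rough_integral p X phi s t (J t - J s).
Proof.
move=> [K K0 HK] as_ tb; apply: (riemann_sums_cvg comega a0 bT theta_gt1 K0 _ as_ tb).
by move=> s' t' as' st' tb'; exact: (HK (s', t')).
Qed.

Definition ito_letter (G : 'rV[R]_d -> R) (c : letter d) (y : 'rV[R]_d) : R :=
  \sum_(g <- newords_le (enum 'I_d) N | seq_mset g == val c)
    (size g)`!%:R^-1 * pds g G y.

(** By [letter_sum] the Riemann term is a sum over non-empty words of derivatives of G against
    products of increments, that is a Taylor polynomial without its constant term; the error is the
    Taylor remainder. *)
Lemma ito_formula G : smooth_on U G -> integral_path (ito_letter G) (fun t => G (x t)).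
Proof.
move=> sG; apply: (@dominated_ext _ _ _ (fun st => - trem N G (x st.1) (x st.2))); last first.
  exact: dominatedN (trem_dominated N sG).
move=> [s t] st /=; have [/= as_ st' tb] := st.
have Us : U (x s) by apply: xU; rewrite as_ (le_trans st').
have sT : symmetric_fun (fun g => pds g G (x s)) := symmetric_pds oU Us sG.
suff -> : riemann_term p X (ito_letter G) s t =
    taypoly N (fun w => pds w G (x s)) (x s) (x t) - G (x s) by rewrite /trem; ring.
(* [letter_sum] requires a bound above [lwt c] for every letter; for the letters that occur it
   equals N. *)
pose M (c : letter d) := maxn N (lwt c).
transitivity (\sum_(g <- newords_le (enum 'I_d) (N - fwt lwt ([::] : forest (letter d))))
    (size g)`!%:R^-1 * (pds g G (x s) * X (bullets g ++ [::]) s t)).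
  rewrite -(letter_sum (M := M) [::] sT (brp_functional st) (leqnn N)); last first.
    by move=> c; rewrite leq_maxr.
  apply: eq_big_seq => c; rewrite mem_letters_le => cN; apply: eq_big => [w|w _].
    by rewrite [fwt _ _]/= addn0.
  congr (_ * _ * _); rewrite /M (maxn_idPl cN).
  rewrite (pds_sum _ _ oU _ Us); last by move=> g _; exact: (smoothZ _ oU (smooth_pds g sG)).
  apply: eq_bigr => g _.
  by rewrite (pdsZ _ _ oU (smooth_pds g sG) Us) pds_cat.
rewrite /taypoly wexp_nil /mon big_nil mulr1 addrC addKr -/(mon _ _).
rewrite (wexp_newords N (fun w => pds w G (x s) * \prod_(i <- w) (x t - x s) 0 i)).
rewrite [fwt _ _]/= subn0; apply: eq_big_seq => g; rewrite mem_newords_le => /andP[_ gN].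
by rewrite cats0 brp_bullets.
Qed.

End RoughIntegral.

(** * Riemann terms and integrals under pushforward *)

Section Pushforward.
Context {R : realType} {d e : nat}.
Variables (U : set 'rV[R]_d) (V : set 'rV[R]_e) (h : 'rV[R]_d -> 'rV[R]_e).
Hypotheses (oU : open U) (oV : open V) (UV : forall x, U x -> V (h x))
  (sh : smooth_map_on U h).

(** Every upper index takes a non-empty word, so c must have at least as many elements as there are
    indices. *)
Lemma Phi_eq0 ks (c : letter d) x : (lwt c < size ks)%N -> Phi h ks c x = 0.
Proof.
move=> cks; rewrite /Phi big_seq_cond big1 // => g /andP[gW /eqP /lwt_mset E].
suff : (size ks <= size (flatten g))%N by rewrite leqNgt -E cks.
elim: (size ks) g gW {E} => [//|n IH] g /allpairsP[[w g'] /= [ww gg ->]] /=.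
rewrite size_cat; move: ww; rewrite mem_newords_le => /andP[w0 _].
exact: leq_add w0 (IH _ gg).
Qed.

Lemma jet0 n (x : 'rV[R]_d) (S : seq 'I_d -> R) : jet n (fun=> 0) x S = 0.
Proof.
rewrite /jet -[RHS](wexp0 (d := d) n); apply: eq_wexp => w _.
by rewrite pds_cst; case: w => [|? ?]; rewrite mul0r.
Qed.

Lemma jet_mset_ind N (f : 'rV[R]_d -> R) x (c : letter d) : jet N f x (mset_ind c) =
  \sum_(g <- newords_le (enum 'I_d) N | seq_mset g == val c) (size g)`!%:R^-1 * pds g f x.
Proof.
rewrite /jet wexp_nil [X in X + _](_ : _ = 0) ?add0r; last first.
  rewrite /mset_ind; case: eqP => [/lwt_mset /= E|_]; last by rewrite mulr0.
  by have := lwt_gt0 c; rewrite E.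
rewrite (wexp_newords N (fun w => pds w f x * mset_ind c w)) [RHS]big_mkcond.
apply: eq_bigr => g _; rewrite /mset_ind.
by case: eqP; rewrite ?mulr1 ?mulr0.
Qed.

(** The Faa di Bruno formula paired with the indicator of the multiset l: the jets of products of
    increments of h are precisely the coefficients [Phi]. *)
Lemma ito_letter_push (p : R) (G : 'rV[R]_e -> R) (l : letter d) (x : 'rV[R]_d) : let N := Num.truncn p in
  smooth_on V G -> U x -> (lwt l <= N)%N ->
  ito_letter p (G \o h) l x =
  \sum_(k <- letters_le N) ito_letter p G k (h x) * Phi h (enum_mset (val k)) l x.
Proof.
move=> N sG Ux lN; have s1 : smooth_on U (fun=> (1 : R)) := smooth_cst 1.
have sS := symmetric_mset_ind (R := R) l.
rewrite /ito_letter -jet_mset_ind.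
transitivity (jet N (fun y => G (h y) * 1) x (mset_ind l)).
  by apply: (jet_local _ _ oU Ux) => y _; rewrite mulr1.
rewrite (jet_comp oU oV UV sh _ sG s1 Ux (leqnn N)).
pose F b := pds b G (h x) *
  jet N (fun y => (\prod_(k <- b) (h y 0 k - h x 0 k)) * 1) x (mset_ind l).
rewrite -[LHS]/(wexp N F) wexp_nil.
have -> : F [::] = 0.
  rewrite /F (jet_local (g := fun=> 1) _ _ oU Ux); last by move=> y _; rewrite big_nil mul1r.
  rewrite jet_mset_ind big1_seq ?mulr0 // => g; rewrite mem_newords_le => /andP[_ /andP[g0 _]].
  by rewrite pds_cst; case: g g0 => // *; rewrite mulr0.
rewrite add0r wexp_newords.
transitivity (\sum_(k <- letters_le N)
  \sum_(b <- newords_le (enum 'I_e) N | seq_mset b == val k)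
    (size b)`!%:R^-1 * pds b G (h x) * Phi h (enum_mset (val k)) l x); last first.
  by apply: eq_bigr => k _; rewrite mulr_suml.
rewrite (sum_letters (fun k b => (size b)`!%:R^-1 * pds b G (h x) *
  Phi h (enum_mset (val k)) l x) (leqnn N)).
apply: eq_big_seq => -[|i b]; first by rewrite mem_newords_le.
move=> _; rewrite /F -mulrA; congr (_ * (_ * _)).
rewrite (Phi_multi_sum _ _ _ lN) -multi_jet1 -(jet_hprod oU sh _ _ s1 Ux sS).
apply: (jet_local _ _ oU Ux) => y _; congr (_ * _).
by apply: perm_big; rewrite perm_sym; exact: perm_eq_seq_mset.
Qed.

Variables (p T : R) (omega : R -> R -> R) (a b : R) (X : srp R d) (Y : srp R e).
Hypotheses (hp : 1 <= p) (comega : control T omega) (a0 : 0 <= a) (bT : b <= T)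
  (sX : simple_brp p omega a b X) (xU : forall u, a <= u <= b -> U (srp_trace X u))
  (pushXY : is_pushforward h p omega a b X Y).

Local Notation N := (Num.truncn p).
Local Notation theta := (N.+1%:R / p).

Variable psi : letter e -> 'rV[R]_e -> R.
Hypothesis spsi : forall k, smooth_on V (psi k).

(** [form_integrand_change] states that the integrands of a one-form in two charts are related in
    this way. *)
Definition pullback (c : letter d) (y : 'rV[R]_d) : R :=
  \sum_(k <- letters_le N) psi k (h y) * Phi h (enum_mset (val k)) c y.

(** An exact equality: on the left each tree yields a [multi_jet] by [push_node], and [jet_hprod]
    with [jet_comp], read backwards, assemble these into the jet of a summand of the pullback. *)
Lemma riemann_term_pushforward s t : simplex a b (s, t) ->
  \sum_(k <- letters_le N) wexp (N - lwt k) (fun w =>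
    pds w (psi k) (h (srp_trace X s)) * push_almost h p X [:: Node k (bullets w)] s t) =
  riemann_term p X pullback s t.
Proof.
move=> st; have [/= as_ st' tb] := st; set x := srp_trace X s.
have Ux : U x by apply: xU; rewrite as_ (le_trans st').
have cX := brp_branches sX st.
pose S c := branch N (fun f => X f s t) c.
have sS c : symmetric_fun (S c) by apply: symmetric_branch.
have sPhi (k : letter e) c : smooth_on U (Phi h (enum_mset (val k)) c) := smooth_Phi oU sh _ c.
rewrite riemann_term_jet.
transitivity (\sum_(k <- letters_le N) \sum_(c <- letters_le N) wexp (N - lwt k) (fun w =>
   pds w (psi k) (h x) *
   multi_jet h (Phi h (enum_mset (val k)) c) x w (N - lwt c) (S c))).
  apply: eq_bigr => k _; rewrite -wexp_sum; apply: eq_wexp => w _.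
  rewrite -mulr_sumr; congr (_ * _).
  by rewrite /push_almost big_seq1 -/x (push_node oU sh Ux k w cX).
rewrite exchange_big; apply: eq_big_seq => c; rewrite mem_letters_le => cN.
pose F k y := psi k (h y) * Phi h (enum_mset (val k)) c y.
have sF k : true -> smooth_on U (F k).
  by move=> _; exact: (smoothM oU (smooth_comp oU oV UV (spsi k) sh) (sPhi k c)).
rewrite [RHS](@jet_sum _ _ U (N - lwt c) _ (letters_le N) xpredT F x (S c) oU sF Ux).
apply: eq_big_seq => k; rewrite mem_letters_le => kN.
transitivity (wexp (N - lwt k) (fun w => pds w (psi k) (h x) *
   jet (N - lwt c) (fun y => (\prod_(j <- w) (h y 0 j - h x 0 j)) *
     Phi h (enum_mset (val k)) c y) x (S c))).
  by apply: eq_wexp => w _; rewrite (jet_hprod oU sh _ _ (sPhi k c) Ux (sS c)).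
(* In the first case the expansion of psi_k to order N - lwt k covers the order N - lwt c of the
   jet; in the second the coefficient [Phi] vanishes. *)
have [kc|ck] := leqP (lwt k) (lwt c).
  by rewrite (jet_comp oU oV UV sh _ (spsi k) (sPhi k c) Ux (leq_sub2l N kc)).
have Phi0 y : Phi h (enum_mset (val k)) c y = 0 by exact: Phi_eq0.
rewrite (jet_local (g := fun=> 0) _ _ oU Ux) ?jet0; last by move=> y _; rewrite /F Phi0 mulr0.
rewrite -[RHS](wexp0 (d := e) (N - lwt k)); apply: eq_wexp => w _.
by rewrite (jet_local (g := fun=> 0) _ _ oU Ux) ?jet0 ?mulr0 // => y _; rewrite Phi0 mulr0.
Qed.

(** Y is only close to the almost rough path. The differences on the trees of the Riemann term are
    O(omega^theta), and their coefficients are bounded along the compact trace. *)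
Lemma integral_path_pushforward J :
  integral_path p omega a b X pullback J -> integral_path p omega a b Y psi J.
Proof.
move=> iX; have [bY cY trY] := pushXY.
pose Dif (st : R * R) := \sum_(k <- letters_le N) wexp (N - lwt k) (fun w =>
    pds w (psi k) (h (srp_trace X st.1)) *
    (Y [:: Node k (bullets w)] st.1 st.2 -
     push_almost h p X [:: Node k (bullets w)] st.1 st.2)).
have H : dominated (fun st => simplex a b st) Dif (fun st => omega st.1 st.2 `^ theta).
  apply: dominated_sum => [k|st _]; last exact: powR_ge0.
  rewrite mem_letters_le => kN; apply: dominated_wexp => [w wn|st _]; last exact: powR_ge0.
  apply: dominated_bounded.
    have sc := smooth_comp oU oV UV (smooth_pds w (spsi k)) sh.
    exact: (smooth_trace_bounded hp sX xU sc).
  have [|C HC] := cY [:: Node k (bullets w)].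
    by rewrite fwt1_node fwt_bullets -leq_subRL.
  exists `|C| => // -[s t] st; apply: le_trans (HC s t st) _.
  by apply: ler_wpM2r; rewrite ?powR_ge0 ?ler_norm.
apply: dominated_ext (dominatedD H iX) => -[s t] st /=; have [/= as_ st' tb] := st.
rewrite addrA; congr (_ - _); rewrite -(riemann_term_pushforward st) -big_split /=.
rewrite riemann_term_jet; apply: eq_big_seq => k; rewrite mem_letters_le => kN.
rewrite -wexpD; apply: eq_wexp => w wn; rewrite -mulrDr subrK.
rewrite trY; last by rewrite as_ (le_trans st').
by rewrite /branch ifT // addnC -leq_subRL.
Qed.

End Pushforward.

(** * Tensors *)

Section Tensors.
Context {R : realType}.

(** The transformation of the components F of a covariant tensor under the Jacobian D. *)
Fixpoint contract {d e : nat} (D : 'I_d -> 'I_e -> R) (F : seq 'I_e -> R) (w : seq 'I_d) : R :=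
  if w is i :: w' then \sum_j D i j * contract D (fun v => F (j :: v)) w' else F [::].

(* The derivative of [contract D F w] when D has derivative E and F is constant. *)
Fixpoint dcontract {d e : nat} (D E : 'I_d -> 'I_e -> R) (F : seq 'I_e -> R)
    (w : seq 'I_d) : R :=
  if w is i :: w' then
    \sum_j (E i j * contract D (fun v => F (j :: v)) w' +
            D i j * dcontract D E (fun v => F (j :: v)) w')
  else 0.

(* The matrix A acts as a derivation on the indices of F. *)
Fixpoint act {d : nat} (A : 'I_d -> 'I_d -> R) (F : seq 'I_d -> R) (w : seq 'I_d) : R :=
  if w is i :: w' then
    \sum_j A i j * F (j :: w') + act A (fun v => F (i :: v)) w'
  else 0.

Lemma eq_contract {d e : nat} (D : 'I_d -> 'I_e -> R) F F' w :
  (forall v, size v = size w -> F v = F' v) -> contract D F w = contract D F' w.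
Proof.
elim: w F F' => [|i w IH] F F' FF' /=; first exact: FF'.
by apply: eq_bigr => j _; congr (_ * _); apply: IH => v vw; apply: FF'; rewrite /= vw.
Qed.

Lemma contractD {d e : nat} (D : 'I_d -> 'I_e -> R) F F' w :
  contract D (fun v => F v + F' v) w = contract D F w + contract D F' w.
Proof.
elim: w F F' => [|i w IH] F F' //=; rewrite -big_split; apply: eq_bigr => j _.
by rewrite IH mulrDr.
Qed.

Lemma contractZ {d e : nat} (D : 'I_d -> 'I_e -> R) c F w :
  contract D (fun v => c * F v) w = c * contract D F w.
Proof.
elim: w F => [|i w IH] F //=; rewrite mulr_sumr; apply: eq_bigr => j _.
by rewrite IH mulrCA.
Qed.

Lemma contract_sum {d e : nat} (D : 'I_d -> 'I_e -> R) (I : Type) (r : seq I)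
    (F : I -> seq 'I_e -> R) w :
  contract D (fun v => \sum_(i <- r) F i v) w = \sum_(i <- r) contract D (F i) w.
Proof.
elim: w F => [|k w IH] F //=; rewrite exchange_big /=; apply: eq_bigr => j _.
by rewrite IH mulr_sumr.
Qed.

(** The left side is the form of the Christoffel terms in [covd_rec]; [act] is its version for
    induction on the tuple. *)
Lemma act_sum {d : nat} (A : 'I_d -> 'I_d -> R) (i : 'I_d) F w :
  \sum_(k < size w) \sum_j A (nth i w k) j * F (set_nth i w k j) = act A F w.
Proof.
elim: w F => [|x w IH] F; first by rewrite big_ord0.
by rewrite big_ord_recl /= -(IH (fun v => F (x :: v))).
Qed.

Lemma eq_act {d : nat} (A : 'I_d -> 'I_d -> R) F F' w :
  (forall v, size v = size w -> F v = F' v) -> act A F w = act A F' w.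
Proof.
elim: w F F' => [//|i w IH] F F' FF' /=; congr (_ + _).
  by apply: eq_bigr => j _; rewrite FF'.
by apply: IH => v vw; apply: FF'; rewrite /= vw.
Qed.

Lemma actZ {d : nat} (A : 'I_d -> 'I_d -> R) c F w :
  act A (fun v => c * F v) w = c * act A F w.
Proof.
elim: w F => [|i w IH] F /=; first by rewrite mulr0.
rewrite IH mulrDr mulr_sumr; congr (_ + _); apply: eq_bigr => j _; exact: mulrCA.
Qed.

(* If A D = E + D B, as for the Christoffel symbols A, B of two charts with
   Jacobian D, then A acts on a contraction as B does up to the derivative of D. *)
Lemma act_contract {d e : nat} (A : 'I_d -> 'I_d -> R) (B : 'I_e -> 'I_e -> R)
    (D E : 'I_d -> 'I_e -> R) F w :
  (forall i m, \sum_j A i j * D j m = E i m + \sum_b D i b * B b m) ->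
  act A (contract D F) w = dcontract D E F w + contract D (act B F) w.
Proof.
move=> H; elim: w F => [|i w IH] F; first by rewrite /= addr0.
pose c m := contract D (fun v => F (m :: v)) w.
pose q m := dcontract D E (fun v => F (m :: v)) w.
pose r m := contract D (act B (fun v => F (m :: v))) w.
pose S2 := \sum_m (\sum_b D i b * B b m) * c m.
transitivity ((\sum_m E i m * c m + S2) + (\sum_j D i j * q j + \sum_j D i j * r j)).
  rewrite [LHS]/=; congr (_ + _).
    rewrite (eq_bigr _ (fun j _ => mulr_sumr _ _ _ _)) exchange_big /= -big_split.
    apply: eq_bigr => m _ /=; rewrite -mulrDl -H mulr_suml.
    by apply: eq_bigr => j _; exact: mulrA.
  have act_sumr (I : Type) (s : seq I) (G : I -> seq 'I_d -> R) :
      act A (fun v => \sum_(k <- s) G k v) w = \sum_(k <- s) act A (G k) w.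
    elim: w G {IH c q r S2} => [|x w IH] G /=; first by rewrite big1.
    rewrite IH [RHS]big_split /=; congr (_ + _).
    by rewrite exchange_big /=; apply: eq_bigr => j _; rewrite mulr_sumr.
  by rewrite act_sumr -big_split; apply: eq_bigr => j _; rewrite actZ IH mulrDr.
rewrite addrACA; congr (_ + _); first by rewrite [RHS]/= big_split.
rewrite [RHS]/=; transitivity (\sum_j (D i j * (\sum_m B j m * c m) + D i j * r j)).
  rewrite big_split; congr (_ + _); rewrite /S2.
  rewrite (eq_bigr _ (fun m _ => mulr_suml _ _ _ _)) exchange_big; apply: eq_bigr => j _ /=.
  by rewrite mulr_sumr; apply: eq_bigr => m _; rewrite mulrA.
apply: eq_bigr => j _; rewrite -mulrDr contractD contract_sum; congr (_ * (_ + _)).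
by apply: eq_bigr => m _; rewrite contractZ.
Qed.

(** Exchanging the summations moves the Jacobian from F to S, where it preserves symmetry. *)
Lemma contract_transpose {d e : nat} (D : 'I_d -> 'I_e -> R) (S : seq 'I_d -> R) F n :
  \sum_(w <- words (enum 'I_d) n) S w * contract D F w =
  \sum_(v <- words (enum 'I_e) n) contract (fun j i => D i j) S v * F v.
Proof.
elim: n S F => [|n IH] S F; first by rewrite !sum_words0.
rewrite !sum_wordsS.
transitivity (\sum_i \sum_j D i j * \sum_(w <- words (enum 'I_d) n)
    S (i :: w) * contract D (fun v => F (j :: v)) w).
  apply: eq_bigr => i _; rewrite /= (eq_bigr _ (fun w _ => mulr_sumr _ _ _ _)) exchange_big /=.
  by apply: eq_bigr => j _; rewrite mulr_sumr; apply: eq_bigr => w _; rewrite mulrCA.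
rewrite exchange_big /=; apply: eq_bigr => j _.
rewrite [RHS](eq_bigr _ (fun v _ => mulr_suml _ _ _ _)) exchange_big /=; apply: eq_bigr => i _.
by rewrite IH mulr_sumr; apply: eq_bigr => v _; rewrite mulrA.
Qed.

(** Moves of one letter to the front generate all permutations. *)
Lemma symmetric_move (I : eqType) (V : Type) (F : seq I -> V) :
  (forall w1 i w2, F (w1 ++ i :: w2) = F (i :: w1 ++ w2)) -> symmetric_fun F.
Proof.
move=> HF w; elim: w F HF => [|i w IH] F HF w'; first by rewrite perm_sym => /perm_nilP ->.
move=> pw; have iw' : i \in w' by rewrite -(perm_mem pw) mem_head.
case/splitPr: iw' pw => w1 w2 pw.
have pw2 : perm_eq w (w1 ++ w2).
  rewrite -(perm_cons i); apply: perm_trans pw _.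
  exact: (permEl (perm_catCA w1 [:: i] w2)).
rewrite HF; apply: (IH (fun v => F (i :: v))) => // v1 j v2.
by rewrite -cat_cons HF /= (HF [:: i]).
Qed.

Lemma symmetric_contract {d e : nat} (D : 'I_d -> 'I_e -> R) F :
  symmetric_fun F -> symmetric_fun (contract D F).
Proof.
move=> sF; apply: symmetric_move => w1 i w2; elim: w1 F sF => [//|j w1 IH] F sF /=.
have sF' m : symmetric_fun (fun v => F (m :: v)).
  by move=> v v' vv'; apply: sF; rewrite perm_cons.
transitivity (\sum_m D j m * \sum_k D i k * contract D (fun v => F (m :: k :: v)) (w1 ++ w2)).
  by apply: eq_bigr => m _; rewrite IH.
rewrite (eq_bigr _ (fun m _ => mulr_sumr _ _ _ _)) exchange_big /=.
apply: eq_bigr => k _; rewrite mulr_sumr; apply: eq_bigr => m _; rewrite mulrCA.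
congr (_ * (_ * _)); apply: eq_contract => v _; apply: sF.
exact: (permEl (perm_catCA [:: m] [:: k] v)).
Qed.

Lemma words_uniq (T : eqType) (s : seq T) n : uniq s -> uniq (words s n).
Proof.
move=> us; elim: n => //= n IH; apply: allpairs_uniq => //.
by move=> [x w] [y v] _ _ /= [-> ->].
Qed.

(** The symmetric part of F. [permutations w] lists distinct words, each of which arises equally
    often from the symmetric group, so this mean is the usual symmetrisation. *)
Definition avg {d : nat} (F : seq 'I_d -> R) (w : seq 'I_d) : R :=
  (size (permutations w))%:R^-1 * \sum_(v <- permutations w) F v.

Lemma symmetric_avg {d : nat} (F : seq 'I_d -> R) : symmetric_fun (avg F).
Proof.
move=> w w' /perm_permutations pw; rewrite /avg (perm_size pw); congr (_ * _).
exact: (perm_big _ pw).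
Qed.

Lemma size_permutations_neq0 {d : nat} (w : seq 'I_d) : (size (permutations w))%:R != 0 :> R.
Proof.
rewrite pnatr_eq0 size_eq0; apply/eqP => E.
by have := mem_permutations w w; rewrite E perm_refl.
Qed.

Lemma avg_symmetric {d : nat} (F : seq 'I_d -> R) w : symmetric_fun F -> avg F w = F w.
Proof.
move=> sF; rewrite /avg (eq_big_seq (fun=> F w)) => [|v]; last first.
  by rewrite mem_permutations => /sF.
rewrite big_const_seq count_predT iter_addr_0 -[F w *+ _]mulr_natl mulrA mulVf ?mul1r //.
exact: size_permutations_neq0.
Qed.

Lemma eq_avg {d : nat} (F F' : seq 'I_d -> R) w :
  (forall v, perm_eq v w -> F v = F' v) -> avg F w = avg F' w.
Proof.
by move=> H; congr (_ * _); apply: eq_big_seq => v; rewrite mem_permutations; exact: H.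
Qed.

Lemma avgD {d : nat} (F F' : seq 'I_d -> R) w :
  avg (fun v => F v + F' v) w = avg F w + avg F' w.
Proof. by rewrite /avg big_split mulrDr. Qed.

Lemma sum_permutations {d : nat} (F : seq 'I_d -> R) w :
  \sum_(v <- permutations w) F v =
  \sum_(v <- words (enum 'I_d) (size w) | perm_eq v w) F v.
Proof.
rewrite -[RHS]big_filter; apply: perm_big; apply: uniq_perm.
- exact: permutations_uniq.
- exact: filter_uniq (words_uniq _ (enum_uniq _)).
- move=> v; rewrite mem_filter mem_permutations mem_words.
  by case: (boolP (perm_eq v w)) => //= /perm_size ->; rewrite eqxx.
Qed.

(** S is constant on each class of permuted words, and averaging keeps the sum of F over the
    class. *)
Lemma sum_symmetric_avg {d : nat} (S F : seq 'I_d -> R) n : symmetric_fun S ->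
  \sum_(w <- words (enum 'I_d) n) S w * F w = \sum_(w <- words (enum 'I_d) n) S w * avg F w.
Proof.
move=> sS.
transitivity (\sum_(w <- words (enum 'I_d) n) \sum_(v <- words (enum 'I_d) n | perm_eq v w)
    (size (permutations w))%:R^-1 * (S v * F v)); last first.
  apply: eq_big_seq => w; rewrite mem_words => /eqP wn.
  rewrite /avg mulrCA sum_permutations wn !mulr_sumr; apply: eq_bigr => v vw.
  by rewrite (sS _ _ vw).
under [RHS]eq_bigr do rewrite big_mkcond.
rewrite exchange_big /=; apply: eq_big_seq => v; rewrite mem_words => /eqP vn.
rewrite -big_mkcond /= -mulr_suml.
suff -> : \sum_(w <- words (enum 'I_d) n | perm_eq v w) (size (permutations w))%:R^-1 = 1 :> R.
  by rewrite mul1r.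
transitivity (\sum_(w <- permutations v) (size (permutations v))%:R^-1 : R).
  rewrite sum_permutations vn; apply: eq_big => [w|w]; first exact: perm_sym.
  by rewrite perm_sym => /perm_permutations /perm_size ->.
rewrite big_const_seq count_predT iter_addr_0 -[_ *+ _]mulr_natl divff //.
exact: size_permutations_neq0.
Qed.

End Tensors.

(** * Charts and connections *)

Section Charts.
Context {R : realType} {d : nat} {M : manifold R d}.
Implicit Types (c : chart R d M) (m : M) (W : set M) (g : M -> R).

Definition overlap c c' : set 'rV[R]_d := cdom c `&` cpar c @^-1` cim c'.

Lemma chart_preimage_open c W : smooth_chart c -> open W -> open (cdom c `&` cpar c @^-1` W).
Proof.
move=> [[oc _ _ cc _] _]; rewrite (continuous_open_subspace _ oc) in cc.
by move: W; apply/(continuous_inP _ oc).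
Qed.

Lemma open_cdom c : smooth_chart c -> open (cdom c).
Proof. by move=> [[]]. Qed.

Lemma open_cim c : smooth_chart c -> open (cim c).
Proof. by move=> [[]]. Qed.

Lemma open_overlap c c' : smooth_chart c -> smooth_chart c' -> open (overlap c c').
Proof. by move=> sc sc'; apply: chart_preimage_open => //; exact: open_cim. Qed.

Lemma cinvK c x : smooth_chart c -> cdom c x -> cinv c (cpar c x) = x.
Proof. by move=> [[_ _ K _ _] _]; exact: K. Qed.

Lemma cparK c m : smooth_chart c -> cim c m -> cpar c (cinv c m) = m.
Proof. by move=> sc [x cx <-]; rewrite cinvK. Qed.

Lemma cinv_dom c m : smooth_chart c -> cim c m -> cdom c (cinv c m).
Proof. by move=> sc [x cx <-]; rewrite cinvK. Qed.

Lemma cim_par c x : cdom c x -> cim c (cpar c x).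
Proof. by move=> cx; exists x. Qed.

Lemma transition_par c c' x : smooth_chart c' -> overlap c c' x ->
  cpar c' (transition c c' x) = cpar c x.
Proof. by move=> sc' [_ ?]; exact: cparK. Qed.

Lemma transition_dom c c' x : smooth_chart c' -> overlap c c' x ->
  cdom c' (transition c c' x).
Proof. by move=> sc' [_ ?]; exact: cinv_dom. Qed.

Lemma smooth_preimage_open {e : nat} (U : set 'rV[R]_d) (h : 'rV[R]_d -> 'rV[R]_e) (V : set 'rV[R]_e) :
  open U -> smooth_map_on U h -> open V -> open (U `&` h @^-1` V).
Proof.
move=> oU sh; apply: (iffLR (continuous_inP h oU)).
by move=> x; rewrite in_setE => Ux; exact: smooth_map_cont sh Ux.
Qed.

(** Charts of the maximal atlas are compatible with the atlas by definition, but not with each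
    other; near each point the transition factors through a chart b of the atlas. *)
Lemma smooth_transition c c' : smooth_chart c -> smooth_chart c' ->
  smooth_map_on (overlap c c') (transition c c').
Proof.
move=> sc sc' k; apply: smooth_pointwise; first exact: open_overlap.
move=> x [cx cx'].
have [b ab bx] := atlas_cover (cpar c x).
have sb : smooth_chart b.
  by split; [exact: atlas_chart|move=> c2 ac2; exact: atlas_compatible].
have [scb _] := (sc.2 b ab : compatible c b); have [_ sbc'] := (sc'.2 b ab : compatible c' b).
pose O := cdom c `&` cpar c @^-1` (cim c' `&` cim b).
have oO : open O.
  by apply: chart_preimage_open => //; apply: openI; exact: open_cim.
exists O; split=> //.
have Ob : O `<=` overlap c b by move=> y [Oy1 [Oy2 Oy3]]; split.
have mapO y : O y -> overlap b c' (transition c b y).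
  move=> Oy; split; first exact: (transition_dom sb (Ob y Oy)).
  rewrite /preimage /= (transition_par sb (Ob y Oy)).
  by case: Oy => Oy1 [Oy2 Oy3].
have s1 : smooth_map_on O (transition c b) by move=> j; exact: smooth_onS Ob (scb j).
have := smooth_comp oO (open_overlap sb sc') mapO (sbc' k) s1.
apply: smooth_local => // y Oy /=; rewrite /transition /=.
by rewrite cparK //; case: Oy => _ [].
Qed.

(** Smoothness in one chart around each point suffices, as it is carried to any other chart by a
    smooth transition. *)
Lemma smooth_fun_local W g : open W ->
  (forall m, W m -> exists c (O : set 'rV[R]_d), [/\ smooth_chart c, cim c m, open O,
     O `<=` cdom c & O (cinv c m) /\ smooth_on O (g \o cpar c)]) -> smooth_fun W g.
Proof.
move=> oW H c' sc'; apply: smooth_pointwise; first exact: chart_preimage_open.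
move=> x [cx Wx]; have {H} [c [V0 H]] := H _ Wx.
move: V0 H => O [sc cm oO Oc [Om sO]].
have oo := open_overlap sc' sc.
pose V := overlap c' c `&` transition c' c @^-1` O.
have oV : open V by apply: smooth_preimage_open => //; exact: smooth_transition.
exists V; split=> //.
have s1 : smooth_map_on V (transition c' c).
  by move=> k; apply: smooth_onS (smooth_transition sc' sc k) => y [].
have mapO y : V y -> O (transition c' c y) by case.
apply: (smooth_local oV _ (smooth_comp oV oO mapO sO s1)) => y [yo _] /=.
by rewrite (transition_par sc yo).
Qed.

Lemma smooth_funS W W' g : W' `<=` W -> smooth_fun W g -> smooth_fun W' g.
Proof. by move=> WW' sg c sc; apply: smooth_onS (sg c sc) => x [cx /WW']. Qed.

Lemma smooth_fun_chart c g : smooth_chart c -> smooth_fun setT g ->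
  smooth_on (cdom c) (g \o cpar c).
Proof. by move=> sc sg; apply: smooth_onS (sg c sc) => x cx; split. Qed.

Lemma smooth_fun_coord c k : smooth_chart c -> smooth_fun (cim c) (fun m => cinv c m 0 k).
Proof. by move=> sc c' sc'; exact: smooth_transition. Qed.

Lemma smooth_fun_pull c W (phi : 'rV[R]_d -> R) : smooth_chart c -> open W -> W `<=` cim c ->
  smooth_on (cdom c `&` cpar c @^-1` W) phi -> smooth_fun W (fun m => phi (cinv c m)).
Proof.
move=> sc oW Wc sphi; apply: smooth_fun_local => // m Wm.
have oV := chart_preimage_open sc oW.
have cm := Wc _ Wm.
exists c, (cdom c `&` cpar c @^-1` W); split; [exact: sc|exact: cm|exact: oV|by move=> x []|].
split; first by split; [exact: cinv_dom|rewrite /preimage /= cparK].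
apply: (smooth_local oV _ sphi) => x [cx _] /=.
by rewrite cinvK.
Qed.

Lemma smooth_fun_pd c W g i : smooth_chart c -> open W -> W `<=` cim c -> smooth_fun W g ->
  smooth_fun W (fun m => pd i (g \o cpar c) (cinv c m)).
Proof.
by move=> sc oW Wc sg; apply: smooth_fun_pull => //; apply: smooth_pd; exact: sg.
Qed.

Lemma smooth_funM W g g' : open W -> smooth_fun W g -> smooth_fun W g' ->
  smooth_fun W (fun m => g m * g' m).
Proof.
move=> oW sg sg' c sc.
exact: (smoothM (chart_preimage_open sc oW) (sg c sc) (sg' c sc)).
Qed.

Lemma smooth_fun_cst W (k : R) : smooth_fun W (fun=> k).
Proof. by move=> c sc; exact: (smooth_cst k). Qed.

Lemma smooth_fun_sum (I : Type) (r : seq I) W (F : I -> M -> R) : open W ->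
  (forall i, smooth_fun W (F i)) -> smooth_fun W (fun m => \sum_(i <- r) F i m).
Proof.
move=> oW sF c sc.
exact: (smooth_sum r (chart_preimage_open sc oW) (fun i _ => sF i c sc)).
Qed.

Lemma smooth_nearI W m g : open W -> W m -> smooth_fun W g -> smooth_near m g.
Proof. by move=> oW Wm sg; exists W. Qed.

Lemma cvecE c i m g : smooth_near m g -> cvec c i m g = pd i (g \o cpar c) (cinv c m).
Proof. by move=> sg; rewrite /cvec asboolT. Qed.

Lemma cvecN c i m g : ~ smooth_near m g -> cvec c i m g = 0.
Proof. by move=> sg; rewrite /cvec asboolF. Qed.

Lemma smooth_near_coord c m k : smooth_chart c -> cim c m -> smooth_near m (fun n => cinv c n 0 k).
Proof.
by move=> sc cm; apply: smooth_nearI (open_cim sc) cm _; exact: smooth_fun_coord.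
Qed.

Lemma pd_coord_chart c x i k : smooth_chart c -> cdom c x ->
  pd i ((fun m => cinv c m 0 k) \o cpar c) x = (i == k)%:R.
Proof.
move=> sc cx; rewrite (pd_local (g := fun y => y 0 k) i (open_cdom sc) cx).
  by rewrite pd_coord.
by move=> y cy /=; rewrite cinvK.
Qed.

Lemma pd_chart_change c c' g W i x : smooth_chart c -> smooth_chart c' -> open W ->
  smooth_fun W g -> overlap c c' x -> W (cpar c x) ->
  pd i (g \o cpar c) x = \sum_k pd k (g \o cpar c') (transition c c' x) *
    pd i (fun y => transition c c' y 0 k) x.
Proof.
move=> sc sc' oW sg xo Wx.
have oo := open_overlap sc sc'.
pose V := cdom c' `&` cpar c' @^-1` W.
have oV : open V := chart_preimage_open sc' oW.
have Vx : V (transition c c' x).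
  by split; [exact: transition_dom|rewrite /preimage /= (transition_par sc' xo)].
rewrite -(pd_comp i oV xo Vx (sg c' sc') (smooth_transition sc sc')).
apply: (pd_local i oo xo) => y yo /=.
by rewrite (transition_par sc' yo).
Qed.

(** Tangent vectors vanish by convention on functions that are not smooth near m, so equality as
    functions has a second, trivial case. *)
Lemma cvec_change c c' i m : smooth_chart c -> smooth_chart c' -> cim c m -> cim c' m ->
  cvec c i m = fun g => \sum_k pd i (fun y => transition c c' y 0 k) (cinv c m) *
    cvec c' k m g.
Proof.
move=> sc sc' cm cm'; apply/funext => g.
have [sg|sg] := pselect (smooth_near m g); last first.
  by rewrite cvecN // big1 // => k _; rewrite cvecN // mulr0.
rewrite cvecE //; have [W [oW Wm sgW]] := sg.
have mE := cparK sc cm.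
have xo : overlap c c' (cinv c m).
  by split; [exact: cinv_dom|rewrite /preimage /= mE].
rewrite (pd_chart_change i sc sc' oW sgW xo); last by rewrite mE.
by apply: eq_bigr => k _; rewrite cvecE // mulrC /transition /= mE.
Qed.

Lemma cvec_coord c i k m : smooth_chart c -> cim c m ->
  cvec c i m (fun n => cinv c n 0 k) = (i == k)%:R.
Proof.
move=> sc cm; rewrite cvecE; last exact: smooth_near_coord.
by rewrite pd_coord_chart //; exact: cinv_dom.
Qed.

Lemma sum_delta (I : finType) (F : I -> R) i : \sum_k (i == k)%:R * F k = F i.
Proof.
rewrite (bigD1 i) //= eqxx mul1r big1 ?addr0 // => k ki.
by rewrite eq_sym (negbTE ki) mul0r.
Qed.

Lemma tangent_expand c m v : smooth_chart c -> cim c m -> tangent m v ->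
  v = fun g => \sum_k v (fun n => cinv c n 0 k) * cvec c k m g.
Proof.
move=> sc cm [c' [sc' cm' [a ->]]]; apply/funext => g.
transitivity (\sum_k \sum_i a i * cvec c' i m (fun n => cinv c n 0 k) * cvec c k m g);
  last by apply: eq_bigr => k _; rewrite mulr_suml.
rewrite exchange_big /=; apply: eq_bigr => i _ /=.
rewrite [in LHS](cvec_change i sc' sc cm' cm) mulr_sumr; apply: eq_bigr => k _.
rewrite mulrA; congr (_ * _ * _).
rewrite (cvec_change i sc' sc cm' cm).
rewrite (eq_bigr (fun j => (k == j)%:R * pd i (fun y => transition c' c y 0 j) (cinv c' m))).
  by rewrite sum_delta.
by move=> j _; rewrite cvec_coord // mulrC eq_sym.
Qed.

Lemma tangent_cvec c i m : smooth_chart c -> cim c m -> tangent m (cvec c i m).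
Proof.
move=> sc cm; exists c; split => //; exists (fun k => (i == k)%:R).
by apply/funext => g; rewrite sum_delta.
Qed.

Lemma tangent_sum c m (I : Type) (r : seq I) (a : I -> 'I_d -> R) :
  smooth_chart c -> cim c m ->
  tangent m (fun g => \sum_(i <- r) \sum_k a i k * cvec c k m g).
Proof.
move=> sc cm; exists c; split => //; exists (fun k => \sum_(i <- r) a i k).
by apply/funext => g; rewrite exchange_big /=; apply: eq_bigr => k _; rewrite [RHS]mulr_suml.
Qed.

Lemma smooth_vf_comb c W (r : seq 'I_d) (k : 'I_d -> M -> R) : smooth_chart c -> open W ->
  W `<=` cim c -> (forall b, smooth_fun W (k b)) ->
  smooth_vf W (fun n g => \sum_(b <- r) k b n * cvec c b n g).
Proof.
move=> sc oW Wc sk; split=> [m Wm|W' g oW' W'W sg].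
  have := tangent_sum r (fun b j => (b == j)%:R * k b m) sc (Wc m Wm).
  congr (tangent m _); apply/funext => g; apply: eq_bigr => b _.
  rewrite (eq_bigr (fun j => (b == j)%:R * (k b m * cvec c j m g))) ?sum_delta //.
  by move=> j _; rewrite mulrA.
have s1 b : smooth_fun W' (fun m => k b m * pd b (g \o cpar c) (cinv c m)).
  apply: (smooth_funM oW' (smooth_funS W'W (sk b))).
  exact: (smooth_fun_pd b sc oW' (subset_trans W'W Wc) sg).
have := smooth_fun_sum r oW' s1.
have E (m : M) : W' m -> \sum_(b <- r) k b m * pd b (g \o cpar c) (cinv c m) =
    \sum_(b <- r) k b m * cvec c b m g.
  move=> W'm; apply: eq_bigr => b _; rewrite cvecE //.
  exact: smooth_nearI oW' W'm sg.
move=> sS c2 sc2; apply: smooth_local (sS c2 sc2); first exact: chart_preimage_open.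
by move=> x [_ W'x] /=; exact: E.
Qed.

Lemma smooth_vf_cvec c W i : smooth_chart c -> open W -> W `<=` cim c ->
  smooth_vf W (fun m => cvec c i m).
Proof.
move=> sc oW Wc; split=> [m Wm|W' g oW' W'W sg]; first by apply: tangent_cvec => //; exact: Wc.
have s1 : smooth_fun W' (fun m => pd i (g \o cpar c) (cinv c m)).
  by apply: smooth_fun_pd => // m /W'W; exact: Wc.
move=> c2 sc2; apply: smooth_local (s1 c2 sc2); first exact: chart_preimage_open.
move=> x [_ W'x] /=; rewrite cvecE //.
exact: smooth_nearI oW' W'x sg.
Qed.

End Charts.

Section DerivativeOfContraction.
Context {R : realType} {d e : nat}.
Variable U : set 'rV[R]_d.
Hypothesis oU : open U.
Implicit Types (D : 'rV[R]_d -> 'I_d -> 'I_e -> R) (F : seq 'I_e -> 'rV[R]_d -> R).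

Lemma smooth_contract D F w : (forall i j, smooth_on U (fun y => D y i j)) ->
  (forall v, smooth_on U (F v)) ->
  smooth_on U (fun y => contract (D y) (fun v => F v y) w).
Proof.
move=> sD; elim: w F => [|i w IH] F sF /=; first exact: sF.
apply: (smooth_sum _ oU) => j _; apply: (smoothM oU (sD i j)).
exact: (IH (fun v => F (j :: v)) (fun v => sF (j :: v))).
Qed.

Lemma pd_contract D F w k x : U x -> (forall i j, smooth_on U (fun y => D y i j)) ->
  (forall v, smooth_on U (F v)) ->
  pd k (fun y => contract (D y) (fun v => F v y) w) x =
  dcontract (D x) (fun i j => pd k (fun y => D y i j) x) (fun v => F v x) w +
  contract (D x) (fun v => pd k (F v) x) w.
Proof.
move=> Ux sD; elim: w F => [|i w IH] F sF /=; first by rewrite add0r.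
have sC j := smooth_contract w sD (fun v => sF (j :: v)).
rewrite pd_sumE; last by move=> j _; exact: smooth_derivable (smoothM oU (sD i j) (sC j)) Ux.
rewrite -big_split; apply: eq_bigr => j _ /=.
rewrite (pdM (smooth_derivable (sD i j) Ux) (smooth_derivable (sC j) Ux)).
by rewrite (IH (fun v => F (j :: v)) (fun v => sF (j :: v))) mulrDr addrA.
Qed.

End DerivativeOfContraction.

Lemma act_comb {R : realType} {d : nat} (I : Type) (r : seq I) (a : I -> R)
    (B : I -> 'I_d -> 'I_d -> R) F w :
  act (fun i j => \sum_(k <- r) a k * B k i j) F w = \sum_(k <- r) a k * act (B k) F w.
Proof.
elim: w F => [|i w IH] F /=; first by rewrite big1 // => k _; rewrite mulr0.
rewrite IH (eq_bigr _ (fun j _ => mulr_suml _ _ _ _)) exchange_big -big_split.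
apply: eq_bigr => k _ /=; rewrite mulrDr mulr_sumr; congr (_ + _).
by apply: eq_bigr => j _; rewrite mulrA.
Qed.

(** * Christoffel symbols and covariant derivatives under a change of chart *)

Section ConnectionTheory.
Context {R : realType} {d : nat} {M : manifold R d}.
Implicit Types (c : chart R d M) (m : M) (W : set M) (g : M -> R).
Variable nabla : M -> tvec M -> (M -> tvec M) -> tvec M.
Hypothesis hN : is_connection nabla.

Lemma smooth_vf_near_cvec c i m : smooth_chart c -> cim c m -> smooth_vf_near m (cvec c i).
Proof.
move=> sc cm; exists (cim c); split; [exact: open_cim|exact: cm|].
exact: (smooth_vf_cvec i sc (open_cim sc) (@subset_refl _ _)).
Qed.

Lemma tangent0 m c : smooth_chart c -> cim c m -> tangent m (fun=> 0 : R).
Proof.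
move=> sc cm; exists c; split => //; exists (fun=> 0).
by apply/funext => g; rewrite big1 // => i _; rewrite mul0r.
Qed.

Lemma conn0 c m v : smooth_chart c -> cim c m -> tangent m v ->
  nabla m v (fun _ _ => 0) = (fun=> 0).
Proof.
move=> sc cm tv.
have s0 : smooth_vf_near m (fun (_ : M) (_ : M -> R) => 0 : R).
  exists (cim c); split; [exact: open_cim|exact: cm|].
  split=> [n cn|W g oW Wc sg]; first exact: (tangent0 sc cn).
  exact: smooth_fun_cst.
have E := conn_add hN tv s0 s0.
apply/funext => g; have := congr1 (fun t : tvec M => t g) E => /=.
have -> : (fun (_ : M) (_ : M -> R) => 0 + 0 : R) = (fun _ _ => 0).
  by apply/funext => n; apply/funext => k; rewrite addr0.
by move=> H; apply: (addrI (nabla m v (fun _ _ => 0) g)); rewrite addr0 -H.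
Qed.

Lemma conn0l c m Y : smooth_chart c -> cim c m -> smooth_vf_near m Y ->
  nabla m (fun=> 0) Y = (fun=> 0).
Proof.
move=> sc cm sY; have t0 := tangent0 sc cm.
have E := conn_linear hN 1 t0 t0 sY.
apply/funext => g; have := congr1 (fun t : tvec M => t g) E => /=.
have -> : (fun _ : M -> R => 1 * 0 + 0 : R) = (fun=> 0).
  by apply/funext => n; rewrite mulr0 addr0.
by rewrite mul1r => H; apply: (addrI (nabla m (fun=> 0) Y g)); rewrite addr0 -H.
Qed.

Lemma conn_comb c W (r : seq 'I_d) (k : 'I_d -> M -> R) m v : smooth_chart c -> open W ->
  W `<=` cim c -> W m -> (forall b, smooth_fun W (k b)) -> tangent m v ->
  nabla m v (fun n g => \sum_(b <- r) k b n * cvec c b n g) =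
  fun g => \sum_(b <- r) (v (k b) * cvec c b m g + k b m * nabla m v (cvec c b) g).
Proof.
move=> sc oW Wc Wm sk tv; have cm := Wc m Wm.
elim: r => [|b r IH].
  have -> : (fun n g => \sum_(b <- [::]) k b n * cvec c b n g) = (fun (_ : M) (_ : M -> R) => 0).
    by apply/funext => n; apply/funext => g; rewrite big_nil.
  by rewrite (conn0 sc cm tv); apply/funext => g; rewrite big_nil.
have -> : (fun n g => \sum_(b <- b :: r) k b n * cvec c b n g) =
    (fun n g => (fun n g => k b n * cvec c b n g) n g +
       (fun n g => \sum_(b <- r) k b n * cvec c b n g) n g).
  by apply/funext => n; apply/funext => g; rewrite big_cons.
have s1 : smooth_vf_near m (fun n g => k b n * cvec c b n g).
  exists W; split; [exact: oW|exact: Wm|]; have := smooth_vf_comb [:: b] sc oW Wc sk.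
  by congr (smooth_vf W _); apply/funext => n; apply/funext => g; rewrite big_seq1.
have s2 : smooth_vf_near m (fun n g => \sum_(b <- r) k b n * cvec c b n g).
  by exists W; split; [exact: oW|exact: Wm|exact: smooth_vf_comb].
have E := conn_add hN tv s1 s2; rewrite E IH.
have E' := conn_leibniz hN tv (smooth_nearI oW Wm (sk b)) (smooth_vf_near_cvec b sc cm).
by rewrite E'; apply/funext => g; rewrite big_cons.
Qed.

Lemma conn_comb_l c m (r : seq 'I_d) (a : 'I_d -> R) Y : smooth_chart c -> cim c m ->
  smooth_vf_near m Y ->
  nabla m (fun g => \sum_(b <- r) a b * cvec c b m g) Y =
  fun g => \sum_(b <- r) a b * nabla m (cvec c b m) Y g.
Proof.
move=> sc cm sY; elim: r => [|b r IH].
  have -> : (fun g => \sum_(b <- [::]) a b * cvec c b m g) = (fun _ : M -> R => 0).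
    by apply/funext => g; rewrite big_nil.
  by rewrite (conn0l sc cm sY); apply/funext => g; rewrite big_nil.
have -> : (fun g => \sum_(b <- b :: r) a b * cvec c b m g) =
    (fun g => a b * cvec c b m g + (fun g => \sum_(b <- r) a b * cvec c b m g) g).
  by apply/funext => g; rewrite big_cons.
have t2 : tangent m (fun g => \sum_(b <- r) a b * cvec c b m g).
  have := tangent_sum r (fun b j => (b == j)%:R * a b) sc cm.
  congr (tangent m _); apply/funext => g; apply: eq_bigr => j _.
  transitivity (\sum_k (j == k)%:R * (a j * cvec c k m g)); last exact: sum_delta.
  by apply: eq_bigr => k _; rewrite mulrA.
have E := conn_linear hN (a b) (tangent_cvec b sc cm) t2 sY.
by rewrite E IH; apply/funext => g; rewrite big_cons.
Qed.

Lemma conn_christoffel c i j x : smooth_chart c -> cdom c x ->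
  nabla (cpar c x) (cvec c i (cpar c x)) (cvec c j) =
  fun g => \sum_k christoffel nabla c i j k x * cvec c k (cpar c x) g.
Proof.
move=> sc cx; have cm := cim_par cx.
rewrite {1}(tangent_expand sc cm (conn_tangent hN (tangent_cvec i sc cm) (smooth_vf_near_cvec j sc cm))).
by [].
Qed.

Definition jac c c' (x : 'rV[R]_d) (i k : 'I_d) : R := pd i (fun y => transition c c' y 0 k) x.

Lemma smooth_jac c c' i k : smooth_chart c -> smooth_chart c' ->
  smooth_on (overlap c c') (fun y => jac c c' y i k).
Proof. by move=> sc sc'; apply: smooth_pd; exact: smooth_transition. Qed.

(** Near m the coordinate field of c is expanded in the frame of c', with the Jacobian as
    coefficients. Leibniz produces the derivative of the Jacobian, and evaluation on the q-th
    coordinate function of c' reads off the component. *)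
Lemma christoffel_change c c' i j q x : smooth_chart c -> smooth_chart c' -> overlap c c' x ->
  \sum_k christoffel nabla c i j k x * jac c c' x k q =
  pd i (fun y => jac c c' y j q) x +
  \sum_b jac c c' x j b * \sum_a jac c c' x i a *
    christoffel nabla c' a b q (transition c c' x).
Proof.
move=> sc sc' xo; set m := cpar c x; set x' := transition c c' x.
have cx := xo.1; have cm : cim c m := cim_par cx; have cm' : cim c' m := xo.2.
have x'E : cpar c' x' = m := transition_par sc' xo.
pose W := cim c `&` cim c'.
have oW : open W by apply: openI; exact: open_cim.
have Wm : W m by split.
have Wc : W `<=` cim c by move=> n [].
have Wc' : W `<=` cim c' by move=> n [].
pose k (b : 'I_d) (n : M) := jac c c' (cinv c n) j b.
have sk b : smooth_fun W (k b).
  apply: (smooth_fun_pull sc oW Wc); apply: smooth_onS (smooth_jac j b sc sc').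
  by move=> y [cy [_ Wy]].
have vE n : W n -> cvec c j n = (fun g => \sum_b k b n * cvec c' b n g).
  by move=> [cn cn']; exact: (cvec_change j sc sc' cn cn').
have tv := tangent_cvec i sc cm.
have sj : smooth_vf W (fun n => cvec c j n) := smooth_vf_cvec j sc oW Wc.
have E1 := conn_local hN tv oW Wm sj vE.
have E2 := conn_comb (index_enum 'I_d) sc' oW Wc' Wm sk tv.
have E := congr1 (fun t : tvec M => t (fun n => cinv c' n 0 q)) (etrans E1 E2).
rewrite /= (conn_christoffel i j sc cx) in E.
have jE b : cvec c b m (fun n => cinv c' n 0 q) = jac c c' x b q.
  rewrite (cvec_change b sc sc' cm cm').
  transitivity (\sum_a (q == a)%:R * jac c c' x b a); last exact: sum_delta.
  apply: eq_bigr => a _; rewrite (cvec_coord a q sc' cm') mulrC eq_sym.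
  by rewrite /jac /m cinvK.
transitivity (\sum_b christoffel nabla c i j b x * cvec c b m (fun n => cinv c' n 0 q)).
  by apply: eq_bigr => b _; rewrite jE.
rewrite E big_split /=; congr (_ + _).
  transitivity (\sum_b (q == b)%:R * cvec c i m (k b)).
    by apply: eq_bigr => b _; rewrite (cvec_coord b q sc' cm') mulrC eq_sym.
  rewrite sum_delta cvecE; last exact: smooth_nearI oW Wm (sk q).
  rewrite /m (cinvK sc cx).
  apply: (pd_local (g := fun y => jac c c' y j q) i (open_cdom sc) cx) => y cy.
  by rewrite /k /= (cinvK sc cy).
apply: eq_bigr => b _; rewrite {1}/k /m cinvK //; congr (_ * _).
rewrite -/m.
have F := cvec_change i sc sc' cm cm'; rewrite F.
have G := conn_comb_l (index_enum 'I_d) (fun a => jac c c' (cinv c m) i a) sc' cm'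
  (smooth_vf_near_cvec b sc' cm').
rewrite /jac in G; rewrite G; apply: eq_bigr => a _; rewrite {1}/m cinvK //.
by rewrite /christoffel x'E.
Qed.

Lemma smooth_christoffel c i j k : smooth_chart c ->
  smooth_on (cdom c) (christoffel nabla c i j k).
Proof.
move=> sc; have oc := open_cim sc.
have si := smooth_vf_cvec i sc oc (@subset_refl _ _).
have sj := smooth_vf_cvec j sc oc (@subset_refl _ _).
have [_ H] := conn_smooth hN oc si sj.
have := H _ _ oc (@subset_refl _ _) (smooth_fun_coord k sc) c sc.
by apply: smooth_onS => x cx; split => //; exact: cim_par.
Qed.

Lemma smooth_covd_rec c g n w : smooth_chart c -> smooth_fun setT g ->
  smooth_on (cdom c) (covd_rec nabla c g n w).
Proof.
move=> sc sg; elim: n w => [|n IH] w; first exact: smooth_fun_chart.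
have oc := open_cdom sc.
case: w => [|i w] /=; first exact: (smooth_cst 0).
apply: (smoothB oc); first exact: (smooth_pd _ (IH w)).
apply: (smooth_sum _ oc) => k _; apply: (smooth_sum _ oc) => j _.
exact: (smoothM oc (smooth_christoffel _ _ _ sc) (IH _)).
Qed.

Lemma covd_rec_cons c g n i w x : size w = n ->
  covd_rec nabla c g n.+1 (i :: w) x = pd i (covd_rec nabla c g n w) x -
  act (fun a j => christoffel nabla c i a j x) (fun v => covd_rec nabla c g n v x) w.
Proof. by move=> <-; rewrite -(act_sum _ i). Qed.

(** Induction on the order: differentiating the transformed tensor also differentiates the
    Jacobians, and these extra terms are what the inhomogeneous part of the Christoffel symbols
    removes. *)
Lemma covd_tensor c c' g n w x : smooth_chart c -> smooth_chart c' -> smooth_fun setT g ->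
  overlap c c' x -> size w = n ->
  covd_rec nabla c g n w x =
  contract (jac c c' x) (fun v => covd_rec nabla c' g n v (transition c c' x)) w.
Proof.
move=> sc sc' sg; elim: n w x => [|n IH] w x xo.
  by move=> /size0nil -> /=; rewrite (transition_par sc' xo).
case: w => [//|i w] [wn]; rewrite covd_rec_cons //.
have oo := open_overlap sc sc'; have oc' := open_cdom sc'.
pose F v y := covd_rec nabla c' g n v (transition c c' y).
have sF v : smooth_on (overlap c c') (F v).
  apply: (smooth_comp oo oc' _ (smooth_covd_rec n v sc' sg) (smooth_transition sc sc')).
  by move=> y yo; exact: transition_dom.
have sJ i' j : smooth_on (overlap c c') (fun y => jac c c' y i' j) := smooth_jac i' j sc sc'.
rewrite (pd_local (g := fun y => contract (jac c c' y) (fun v => F v y) w) i oo xo);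
  last by move=> y yo; exact: IH.
rewrite (pd_contract oo w i xo sJ sF).
have E v : size v = size w -> covd_rec nabla c g n v x = contract (jac c c' x) (fun v => F v x) v.
  by move=> vw; apply: IH => //; rewrite vw.
rewrite (eq_act _ E).
rewrite (act_contract (B := fun b q => \sum_a jac c c' x i a *
    christoffel nabla c' a b q (transition c c' x))
  (E := fun i' j => pd i (fun y => jac c c' y i' j) x)); last first.
  by move=> a q; exact: christoffel_change.
(* The two occurrences of [dcontract] cancel here. *)
rewrite opprD addrACA subrr add0r.
rewrite -[X in _ - X]mul1r -mulNr -contractZ -contractD.
transitivity (contract (jac c c' x) (fun v => \sum_a jac c c' x i a *
    covd_rec nabla c' g n.+1 (a :: v) (transition c c' x)) w).
  apply: eq_contract => v vw; rewrite act_comb mulr_sumr.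
  rewrite (pd_comp i oc' xo (transition_dom sc' xo) (smooth_covd_rec n v sc' sg)
    (smooth_transition sc sc')) -big_split; apply: eq_bigr => a _ /=.
  rewrite -[in RHS]/(covd_rec nabla c' g n.+1 (a :: v) (transition c c' x)).
  rewrite covd_rec_cons ?vw // mulN1r mulrBr; congr (_ - _); exact: mulrC.
by rewrite contract_sum; apply: eq_bigr => a _; rewrite contractZ.
Qed.

End ConnectionTheory.

(** * Transfer symbols and adapted functions *)

Section Transfer.
Context {R : realType} {d : nat} {M : manifold R d}.
Implicit Types (c : chart R d M) (m : M) (W : set M) (g : M -> R).
Variable nabla : M -> tvec M -> (M -> tvec M) -> tvec M.
Hypothesis hN : is_connection nabla.
Local Notation WS n := (words (enum 'I_d) n).
Local Notation NW n := (newords_le (enum 'I_d) n).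

Section Combinations.
Variable c : chart R d M.
Hypothesis sc : smooth_chart c.
Let oc : open (cdom c) := open_cdom sc.

(* The coefficients A do not depend on g; the proposition sym switches on their
   symmetry, which transfer symbols have in the upper tuple. *)
Definition smooth_comb (Q : seq 'I_d -> (M -> R) -> 'rV[R]_d -> R)
    (sym : Prop) n (Phi : (M -> R) -> 'rV[R]_d -> R) :=
  exists A : seq 'I_d -> 'rV[R]_d -> R, [/\ forall a, smooth_on (cdom c) (A a),
    (sym -> forall x, symmetric_fun (fun a => A a x)) &
    forall g x, smooth_fun setT g -> cdom c x ->
      Phi g x = \sum_(a <- NW n) A a x * Q a g x].

Variables (Q : seq 'I_d -> (M -> R) -> 'rV[R]_d -> R) (sym : Prop).
Local Notation comb := (smooth_comb Q sym).

Lemma comb_ext n Phi Phi' : (forall g x, smooth_fun setT g -> cdom c x -> Phi g x = Phi' g x) ->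
  comb n Phi -> comb n Phi'.
Proof.
by move=> E [A [sA yA HA]]; exists A; split => // g x sg cx; rewrite -E // HA.
Qed.

Lemma comb0 n : comb n (fun _ _ => 0).
Proof.
exists (fun _ _ => 0); split => [a||g x _ _]; [exact: (smooth_cst 0)|by []|].
by rewrite big1 // => a _; rewrite mul0r.
Qed.

Lemma combD n Phi Psi : comb n Phi -> comb n Psi -> comb n (fun g x => Phi g x + Psi g x).
Proof.
move=> [A [sA yA HA]] [B [sB yB HB]]; exists (fun a x => A a x + B a x); split.
- by move=> a; exact: (smoothD oc (sA a) (sB a)).
- by move=> y x a a' aa'; rewrite (yA y x _ _ aa') (yB y x _ _ aa').
- move=> g x sg cx; rewrite HA // HB // -big_split.
  by apply: eq_bigr => a _; rewrite mulrDl.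
Qed.

Lemma combM n (k : 'rV[R]_d -> R) Phi : smooth_on (cdom c) k -> comb n Phi ->
  comb n (fun g x => k x * Phi g x).
Proof.
move=> sk [A [sA yA HA]]; exists (fun a x => k x * A a x); split.
- by move=> a; exact: (smoothM oc sk (sA a)).
- by move=> y x a a' aa'; rewrite (yA y x _ _ aa').
- by move=> g x sg cx; rewrite HA // mulr_sumr; apply: eq_bigr => a _; rewrite mulrA.
Qed.

Lemma combN n Phi : comb n Phi -> comb n (fun g x => - Phi g x).
Proof.
move=> H; apply: comb_ext (combM (smooth_cst (-1)) H) => g x _ _; exact: mulN1r.
Qed.

Lemma comb_sum n (I : Type) (r : seq I) (P : pred I) (Phi : I -> (M -> R) -> 'rV[R]_d -> R) :
  (forall i, P i -> comb n (Phi i)) -> comb n (fun g x => \sum_(i <- r | P i) Phi i g x).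
Proof.
move=> H; elim: r => [|i r IH].
  by apply: comb_ext (comb0 n) => g x _ _; rewrite big_nil.
have [Pi|Pi] := boolP (P i).
  by apply: comb_ext (combD (H i Pi) IH) => g x _ _; rewrite big_cons Pi.
by apply: comb_ext IH => g x _ _; rewrite big_cons (negbTE Pi).
Qed.

Lemma sum_newords_widen (V : nmodType) (m n : nat) (G : seq 'I_d -> V) : (m <= n)%N ->
  \sum_(a <- NW m) G a = \sum_(a <- NW n) if (size a <= m)%N then G a else 0.
Proof.
move=> mn; rewrite !sum_newords_le.
rewrite [RHS](eq_bigr (fun k : 'I_n => if (k < m)%N then \sum_(w <- WS k.+1) G w else 0)).
  rewrite -big_mkcond /=.
  by rewrite (big_ord_widen n (fun k => \sum_(w <- WS k.+1) G w) mn).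
move=> k _; case: ifP => km.
  by apply: eq_big_seq => w; rewrite mem_words => /eqP ->; rewrite km.
by rewrite big_seq big1 // => w; rewrite mem_words => /eqP ->; rewrite km.
Qed.

Lemma comb_widen (m n : nat) Phi : (m <= n)%N -> comb m Phi -> comb n Phi.
Proof.
move=> mn [A [sA yA HA]]; exists (fun a x => if (size a <= m)%N then A a x else 0); split.
- by move=> a; case: (size a <= m)%N => //; exact: (smooth_cst 0).
- by move=> y x a a' aa'; rewrite (perm_size aa') (yA y x _ _ aa').
- move=> g x sg cx; rewrite HA // (sum_newords_widen _ mn); apply: eq_bigr => a _.
  by case: (size a <= m)%N => //; rewrite mul0r.
Qed.

Lemma sum_newords_size (V : nmodType) n k (G : seq 'I_d -> V) : (0 < k <= n)%N ->
  \sum_(a <- NW n) (if size a == k then G a else 0) = \sum_(a <- WS k) G a.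
Proof.
case: k => [//|k] kn; have {}kn : (k < n)%N by case/andP: kn.
rewrite sum_newords_le (bigD1 (Ordinal kn)) // -[RHS]addr0; congr (_ + _).
  by apply: eq_big_seq => w; rewrite mem_words => ->.
apply: big1 => i ik; rewrite big_seq big1 // => w; rewrite mem_words => /eqP ->.
by rewrite eqSS (negbTE ik : (i == k :> nat) = false).
Qed.

(** The coefficients are constant on the class of w. This is the source of the symmetry of transfer
    symbols in the upper tuple. *)
Lemma comb_avg n w : (0 < size w <= n)%N -> comb n (fun g x => avg (fun v => Q v g x) w).
Proof.
move=> wn; exists (fun v _ => if perm_eq v w then (size (permutations w))%:R^-1 else 0); split.
- by move=> v; case: (perm_eq v w); exact: smooth_cst.
- by move=> _ x v v' vv'; rewrite (permPl vv').
- move=> g x _ _; rewrite /avg sum_permutations mulr_sumr big_mkcond /=.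
  rewrite -(sum_newords_size _ wn); apply: eq_bigr => v _.
  case: (boolP (perm_eq v w)) => pv; first by rewrite (perm_size pv) eqxx.
  by rewrite mul0r; case: ifP.
Qed.

End Combinations.

Section InChart.
Variable c : chart R d M.
Hypothesis sc : smooth_chart c.
Let oc : open (cdom c) := open_cdom sc.
Local Notation pdcomb := (smooth_comb c (fun a g x => pds a (g \o cpar c) x) False).
Local Notation cvcomb := (smooth_comb c (fun a g x => covd nabla c g a x) True).

Lemma pdcomb_pds n w : (0 < size w <= n)%N -> pdcomb n (fun g x => pds w (g \o cpar c) x).
Proof.
move=> wn; exists (fun v _ => if v == w then 1 else 0); split => //.
- by move=> v; case: (v == w); exact: smooth_cst.
- move=> g x sg cx; rewrite -[LHS]mul1r.
  transitivity (\sum_(a <- NW n) if size a == size w then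
      (if a == w then 1 else 0) * pds a (g \o cpar c) x else 0).
    rewrite (sum_newords_size _ wn) (bigD1_seq w) ?mem_words ?words_uniq ?enum_uniq //=.
    rewrite eqxx big1 ?addr0 // => v /negbTE ->; exact: mul0r.
  apply: eq_bigr => a _; case: ifP => // /negP sa; case: eqP => [E|_].
    by case: sa; rewrite E.
  by rewrite mul0r.
Qed.

Lemma pdcomb_pd n i Phi : pdcomb n Phi ->
  pdcomb n.+1 (fun g x => pd i (fun y => Phi g y) x).
Proof.
move=> [A [sA _ HA]].
(* The bounds on a follow from membership and are repeated as a predicate so that [comb_sum] can use
   them. *)
have H : pdcomb n.+1 (fun g x => \sum_(a <- NW n | (0 < size a <= n)%N)
    (pd i (A a) x * pds a (g \o cpar c) x + A a x * pds (i :: a) (g \o cpar c) x)).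
  apply: (comb_sum sc) => a an; apply: (combD sc).
    apply: (combM sc); first exact: smooth_pd.
    by apply: pdcomb_pds; case/andP: an => -> /leqW.
  by apply: (combM sc) => //; apply: pdcomb_pds; case/andP: an.
apply: comb_ext H => g x sg cx.
have sG := smooth_fun_chart sc sg.
rewrite (pd_local (g := fun y => \sum_(a <- NW n) A a y * pds a (g \o cpar c) y) i oc cx);
  last by move=> y cy; exact: HA.
rewrite pd_sumE; last first.
  by move=> a _; exact: (smooth_derivable (smoothM oc (sA a) (smooth_pds a sG)) cx).
rewrite -big_filter (_ : [seq a <- NW n | _] = NW n).
  apply: eq_bigr => a _.
  by rewrite (pdM (smooth_derivable (sA a) cx) (smooth_derivable (smooth_pds a sG) cx)).
by apply/all_filterP/allP => a; rewrite mem_newords_le.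
Qed.

(** The leading part of an iterated covariant derivative is the ordinary derivative; a Christoffel
    term involves one derivative less. *)
Lemma covd_expand n w : size w = n.+1 ->
  pdcomb n (fun g x => covd_rec nabla c g n.+1 w x - pds w (g \o cpar c) x).
Proof.
elim: n w => [|n IH] w wn.
  apply: comb_ext (comb0 _ _ _ 0) => g x sg cx.
  by case: w wn => [//|i [|//]] _; rewrite /= big_ord0 subr0 subrr.
case: w wn => [//|i w] [wn].
(* In the Christoffel terms the covariant derivative is written as its lower-order remainder plus
   the ordinary derivative, so that the induction hypothesis applies to it. *)
pose Phi g x := pd i (fun y => covd_rec nabla c g n.+1 w y - pds w (g \o cpar c) y) x -
  \sum_(k < n.+1) \sum_(j < d) christoffel nabla c i (nth i w k) j x *
    ((covd_rec nabla c g n.+1 (set_nth i w k j) x - pds (set_nth i w k j) (g \o cpar c) x)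
     + pds (set_nth i w k j) (g \o cpar c) x).
have H : pdcomb n.+1 Phi.
  apply: (combD sc); first by apply: pdcomb_pd; exact: IH.
  apply: (combN sc); apply: (comb_sum sc) => k _; apply: (comb_sum sc) => j _.
  have sz : size (set_nth i w k j) = n.+1.
    by rewrite size_set_nth wn; apply/maxn_idPr; exact: ltn_ord.
  apply: (combM sc); first exact: (smooth_christoffel hN).
  apply: (combD sc); last by apply: pdcomb_pds; rewrite sz leqnn.
  by apply: (comb_widen (leqnSn n)); exact: IH.
apply: comb_ext H => g x sg cx; rewrite /Phi.
have sG := smooth_fun_chart sc sg.
have s1 := smooth_derivable (smooth_covd_rec hN n.+1 w sc sg) cx.
have s2 := smooth_derivable (smooth_pds w sG) cx.
rewrite (pdD (s1 i) (derivableN (s2 i))) (pdN (s2 i)) addrAC; congr (_ - _).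
rewrite [RHS]/=; congr (_ - _); apply: eq_bigr => k _; apply: eq_bigr => j _.
by rewrite subrK.
Qed.

Lemma covd_avg_expand w : (0 < size w)%N ->
  pdcomb (size w).-1 (fun g x => avg (fun v => covd nabla c g v x) w - pds w (g \o cpar c) x).
Proof.
move=> w0.
have H : pdcomb (size w).-1 (fun g x => \sum_(v <- permutations w | perm_eq v w)
    (size (permutations w))%:R^-1 * (covd nabla c g v x - pds v (g \o cpar c) x)).
  apply: (comb_sum sc) => v vw; apply: (combM sc (smooth_cst _)).
  have sv : size v = (size w).-1.+1 by rewrite prednK // (perm_size vw).
  by rewrite /covd sv; exact: covd_expand sv.
apply: comb_ext H => g x sg cx; rewrite -big_filter.
rewrite (_ : [seq v <- _ | _] = permutations w); last first.
  by apply/all_filterP/allP => v; rewrite mem_permutations.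
rewrite -mulr_sumr big_split sumrN mulrBr; congr (_ - _).
exact: (avg_symmetric w (symmetric_pds oc cx (smooth_fun_chart sc sg))).
Qed.

(** Strong induction on |w|: the relation of [covd_avg_expand] is solved for the ordinary
    derivative, the lower-order ones being known. Averages in place of single covariant derivatives
    keep the coefficients symmetric. *)
Lemma cvcomb_pds N w : (0 < size w <= N)%N -> cvcomb N (fun g x => pds w (g \o cpar c) x).
Proof.
have [n] := ubnP (size w); elim: n w => [//|n IH] w wn /andP[w0 wN].
have [A [sA _ HA]] := covd_avg_expand w0.
have H : cvcomb N (fun g x => avg (fun v => covd nabla c g v x) w -
    \sum_(a <- NW (size w).-1 | (0 < size a <= (size w).-1)%N) A a x * pds a (g \o cpar c) x).
  apply: (combD sc); first by apply: comb_avg; rewrite w0.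
  apply: (combN sc); apply: (comb_sum sc) => a /andP[a0 aw]; apply: (combM sc (sA a)).
  have aw' : (size a < size w)%N by rewrite -(prednK w0) ltnS.
  apply: IH; first exact: leq_trans aw' wn.
  by rewrite a0; exact: leq_trans (ltnW aw') wN.
apply: comb_ext H => g x sg cx.
rewrite -big_filter (_ : [seq a <- NW _ | _] = NW (size w).-1); last first.
  by apply/all_filterP/allP => a; rewrite mem_newords_le.
by rewrite -HA // subKr.
Qed.

(** Coefficients are found for each lower tuple separately and then averaged over its permutations;
    the expansion survives because ordinary derivatives are symmetric. *)
Lemma transfer_exists N : exists G, is_transfer nabla N c G.
Proof.
have /choice[B HB] (w : seq 'I_d) : exists A : seq 'I_d -> 'rV[R]_d -> R,
    (0 < size w <= N)%N -> [/\ forall a, smooth_on (cdom c) (A a),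
      (forall x, symmetric_fun (fun a => A a x)) &
      forall g x, smooth_fun setT g -> cdom c x ->
        pds w (g \o cpar c) x = \sum_(a <- NW N) A a x * covd nabla c g a x].
  have [wN|wN] := boolP (0 < size w <= N)%N; last by exists (fun _ _ => 0).
  by have [A [sA yA HA]] := cvcomb_pds wN; exists A; split => //; exact: yA.
exists (fun b a x => avg (fun v => B v b x) a); split.
- move=> b a bN; rewrite mem_newords_le => aN.
  rewrite /avg; apply: (smoothZ _ oc).
  rewrite (_ : (fun y => \sum_(v <- permutations a) B v b y) =
    (fun y => \sum_(v <- permutations a | perm_eq v a) B v b y)); last first.
    apply/funext => y; rewrite -[RHS]big_filter; congr (\sum_(v <- _) _).
    by apply/esym/all_filterP/allP => v; rewrite mem_permutations.
  apply: (smooth_sum _ oc) => v va.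
  have vN : (0 < size v <= N)%N by rewrite (perm_size va).
  by have [sB _ _] := HB v vN.
- move=> b b' a x bN; rewrite mem_newords_le => aN cx bb'.
  apply: eq_avg => v va.
  have vN : (0 < size v <= N)%N by rewrite (perm_size va).
  by have [_ yB _] := HB v vN; exact: yB.
- by move=> b a a' x _ _ _ aa'; exact: (symmetric_avg (fun v => B v b x) aa').
- move=> g a x sg; rewrite mem_newords_le => aN cx.
  rewrite -(avg_symmetric a (symmetric_pds oc cx (smooth_fun_chart sc sg))).
  rewrite (eq_avg (F' := fun v => \sum_(b <- NW N) B v b x * covd nabla c g b x)); last first.
    move=> v va; have vN : (0 < size v <= N)%N by rewrite (perm_size va).
    by have [_ _ HBv] := HB v vN; exact: HBv.
  rewrite /avg exchange_big mulr_sumr; apply: eq_bigr => b _ /=.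
  by rewrite -mulr_suml mulrA.
Qed.

Lemma transferP N : is_transfer nabla N c (transfer nabla N c).
Proof. exact: getPex (transfer_exists N). Qed.

End InChart.
End Transfer.

(** * Adapted functions and the change of the integrand *)

Section AdaptedFunctions.
Context {R : realType} {d : nat} {M : manifold R d}.
Implicit Types (c : chart R d M) (m : M) (W : set M) (g : M -> R).
Local Notation WS n := (words (enum 'I_d) n).
Local Notation NW n := (newords_le (enum 'I_d) n).

(** The manifold is Hausdorff, so the compact image of K is closed and the extension vanishes near
    every point outside the chart. *)
Lemma extend_by_zero c (g0 : 'rV[R]_d -> R) (K : set 'rV[R]_d) : smooth_chart c ->
  smooth_on setT g0 -> compact K -> K `<=` cdom c -> (forall y, ~ K y -> g0 y = 0) ->
  exists g, smooth_fun setT g /\ forall x, cdom c x -> g (cpar c x) = g0 x.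
Proof.
move=> sc sg0 cK Kc g0K.
pose g m := if `[< cim c m >] then g0 (cinv c m) else 0.
have gE x : cdom c x -> g (cpar c x) = g0 x.
  by move=> cx; rewrite /g asboolT ?cinvK //; exact: cim_par.
exists g; split=> //; apply: smooth_fun_local; first exact: openT.
move=> m _; have [cm|cm] := pselect (cim c m).
  exists c, (cdom c); split; [exact: sc|exact: cm|exact: open_cdom|by []|].
  split; first exact: cinv_dom.
  apply: (smooth_local (open_cdom sc) (f := g0)); last exact: smooth_onS (@subsetT _ _) sg0.
  by move=> y cy; rewrite -gE.
have cK' : compact (cpar c @` K).
  apply: continuous_compact cK; apply: continuous_subspaceW Kc _.
  by case: sc => [[]].
pose W := ~` (cpar c @` K).
have oW : open W by apply: closed_openC; apply: compact_closed cK'; exact: manifold_hausdorff.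
have Wm : W m by move=> [y Ky ym]; apply: cm; rewrite -ym; exact: cim_par (Kc _ Ky).
have gW n : W n -> g n = 0.
  move=> Wn; rewrite /g; case: asboolP => // -[y cy yn].
  rewrite -yn cinvK //; apply: g0K => Ky; apply: Wn; by exists y.
have [c2 ac2 c2m] := atlas_cover m.
have sc2 : smooth_chart c2.
  by split; [exact: atlas_chart|move=> c3 ac3; exact: atlas_compatible].
exists c2, (cdom c2 `&` cpar c2 @^-1` W).
have oV := chart_preimage_open sc2 oW.
split; [exact: sc2|exact: c2m|exact: oV|by move=> y []|].
split; first by split; [exact: cinv_dom|rewrite /preimage /= cparK].
apply: (smooth_local oV (f := fun=> 0)); last exact: (smooth_cst 0).
by move=> y [_ Wy] /=; rewrite gW.
Qed.

(* The right-hand side involves t only in degrees below |b|, so that t is found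
   degree by degree. *)
Lemma triangular_solution (E : seq 'I_d -> seq 'I_d -> R) (v : 'I_d -> R) N :
  exists t : seq 'I_d -> R, [/\ symmetric_fun t, forall i, t [:: i] = v i &
    forall b, (1 < size b <= N)%N ->
      t b = - avg (fun b => \sum_(a <- NW (size b).-1) E b a * t a) b].
Proof.
elim: N => [|N [t [yt t1 tN]]].
  exists (fun b => if b is [:: i] then v i else 0); split=> //.
    move=> b b' bb'; have := perm_size bb'.
    case: b bb' => [|i [|j b]] bb'; case: b' bb' => [|i' [|j' b']] //= bb' _.
    by move/perm_mem: bb' => /(_ i'); rewrite !inE eqxx => /eqP ->.
  by move=> b /andP[b1 /(leq_trans b1)].
(* The second condition matters for N = 0, where degree N + 1 = 1 must keep the prescribed values
   v. *)
pose t' b := if (size b == N.+1) && (1 < size b)%N then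
  - avg (fun b => \sum_(a <- NW (size b).-1) E b a * t a) b else t b.
have t'E b : (size b <= N)%N -> t' b = t b.
  by move=> bN; rewrite /t' ltn_eqF.
exists t'; split.
- move=> b b' bb'; rewrite /t' (perm_size bb'); case: ifP => _; last exact: yt.
  by congr (- _); exact: symmetric_avg.
- by move=> i; rewrite /t' andbF.
- move=> b /andP[b1 bN].
  transitivity (- avg (fun b => \sum_(a <- NW (size b).-1) E b a * t a) b); last first.
    congr (- _); apply: eq_avg => b' bb'; apply: eq_big_seq => a; rewrite mem_newords_le.
    move=> /andP[_ aN]; rewrite t'E //; apply: leq_trans aN _.
    by rewrite (perm_size bb') -ltnS (ltn_predK b1).
  rewrite {1}/t' b1 andbT; case: eqP => [//|/eqP bN'].
  by apply: tN; rewrite b1 -ltnS ltn_neqAle bN' bN.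
Qed.

Variable nabla : M -> tvec M -> (M -> tvec M) -> tvec M.
Hypothesis hN : is_connection nabla.

Lemma avg_covd_jet c : smooth_chart c ->
  exists E : seq 'I_d -> seq 'I_d -> 'rV[R]_d -> R, forall w g x, smooth_fun setT g -> cdom c x ->
    (0 < size w)%N -> avg (fun v => covd nabla c g v x) w = pds w (g \o cpar c) x +
      \sum_(a <- NW (size w).-1) E w a x * pds a (g \o cpar c) x.
Proof.
move=> sc.
have /choice[E HE] (w : seq 'I_d) : exists A : seq 'I_d -> 'rV[R]_d -> R,
    forall g x, smooth_fun setT g -> cdom c x -> (0 < size w)%N ->
    avg (fun v => covd nabla c g v x) w - pds w (g \o cpar c) x =
      \sum_(a <- NW (size w).-1) A a x * pds a (g \o cpar c) x.
  have [w0|w0] := boolP (0 < size w)%N; last by exists (fun _ _ => 0).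
  by have [A [_ _ HA]] := covd_avg_expand hN sc w0; exists A => g x sg cx _; exact: HA.
by exists E => w g x sg cx w0; rewrite -HE // addrC subrK.
Qed.

(* As transfer symbols only see the symmetric parts of covariant derivatives, for such
   g the sum of the v i * transfer [:: i] b is the ordinary derivative of g along b. *)
Definition adapted N c x (v : 'I_d -> R) g := [/\ smooth_fun setT g,
  forall i, covd nabla c g [:: i] x = v i &
  forall n (S : seq 'I_d -> R), (1 < n <= N)%N -> symmetric_fun S ->
    \sum_(w <- WS n) S w * covd nabla c g w x = 0].

(** Vanishing of the symmetric parts is a triangular system for the jet of g at x. Its solution is
    realised by a function with compact support in the chart, which extends by zero to the
    manifold. *)
Lemma adapted_exists N c x (v : 'I_d -> R) : smooth_chart c -> cdom c x ->
  exists g, adapted N c x v g.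
Proof.
move=> sc cx; have oc := open_cdom sc.
have [E0 HE0] := avg_covd_jet sc.
have [t [yt t1 tN]] := triangular_solution (fun b a => E0 b a x) v N.
(* Order N + 1 makes the first derivatives prescribed even for N = 0. *)
have [g0 [K [sg0 cK Kc g0K g0t]]] := jet_realisation N.+1 oc cx yt.
have [g [sg gE]] := extend_by_zero sc sg0 cK Kc g0K.
have gt w : (size w <= N.+1)%N -> pds w (g \o cpar c) x = t w.
  move=> wN; rewrite -g0t //; apply: (pds_local w oc cx) => y cy; exact: gE.
exists g; split=> // [i|n S /andP[n1 nN] yS].
  by rewrite -t1 -gt // /covd /= big_ord0 subr0.
rewrite (sum_symmetric_avg _ _ yS) big_seq big1 // => w; rewrite mem_words => /eqP wn.
have wN : (1 < size w <= N)%N by rewrite wn n1.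
suff -> : avg (fun b => covd nabla c g b x) w = 0 by rewrite mulr0.
(* Averaging twice changes nothing; the inner average can then be expanded into the jet, and the
   outer one matches the system solved by t. *)
rewrite -(avg_symmetric w (symmetric_avg (fun b => covd nabla c g b x))).
rewrite (eq_avg (F' := fun b => t b + \sum_(a <- NW (size b).-1) E0 b a x * t a)); last first.
  move=> b bw; have sb := perm_size bw; have b1 : (1 < size b)%N by rewrite sb wn.
  have bN : (size b <= N)%N by rewrite sb wn.
  rewrite HE0 //; last exact: ltnW.
  rewrite gt; last exact: leq_trans bN (leqnSn N).
  congr (_ + _); apply: eq_big_seq => a; rewrite mem_newords_le => /andP[_ ab].
  rewrite gt //; apply: leq_trans ab (leq_trans (leq_pred _) (leq_trans bN (leqnSn N))).
by rewrite avgD (avg_symmetric w yt) tN // addNr.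
Qed.

Variable f : M -> tvec M -> R.
Hypothesis hf : is_one_form f.

Lemma form_comb c m (r : seq 'I_d) (a : 'I_d -> R) : smooth_chart c -> cim c m ->
  f m (fun g => \sum_(b <- r) a b * cvec c b m g) = \sum_(b <- r) a b * f m (cvec c b m).
Proof.
move=> sc cm; have t0 := tangent0 sc cm.
elim: r => [|b r IH].
  rewrite big_nil (_ : (fun g => _) = (fun=> 0)); last first.
    by apply/funext => g; rewrite big_nil.
  have := form_linear hf 1 t0 t0.
  rewrite (_ : (fun g => _) = (fun=> 0)); last by apply/funext => g; rewrite mulr0 addr0.
  by rewrite mul1r => H; apply: (addrI (f m (fun=> 0))); rewrite addr0 -H.
rewrite big_cons -IH -(form_linear hf (a b) (tangent_cvec b sc cm)).
  by congr (f m _); apply/funext => g; rewrite big_cons.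
have := tangent_sum r (fun b j => (b == j)%:R * a b) sc cm.
congr (tangent m _); apply/funext => g; apply: eq_bigr => j _.
transitivity (\sum_k (j == k)%:R * (a j * cvec c k m g)); last exact: sum_delta.
by apply: eq_bigr => k _; rewrite mulrA.
Qed.

Lemma form_coord_change c c' i x : smooth_chart c -> smooth_chart c' -> overlap c c' x ->
  form_coord f c i x = \sum_k jac c c' x i k * form_coord f c' k (transition c c' x).
Proof.
move=> sc sc' xo; have cm := cim_par xo.1; have cm' := xo.2.
rewrite /form_coord (transition_par sc' xo) -(form_comb _ _ sc' cm').
by rewrite (cvec_change i sc sc' cm cm') (cinvK sc xo.1).
Qed.

(** In order one both sides transform as covectors. In higher orders the Jacobians are transposed
    onto S, which stays symmetric. *)
Lemma adapted_change N c c' x g : smooth_chart c -> smooth_chart c' -> overlap c c' x ->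
  adapted N c' (transition c c' x) (fun i => form_coord f c' i (transition c c' x)) g ->
  adapted N c x (fun i => form_coord f c i x) g.
Proof.
move=> sc sc' xo [sg g1 gn]; split=> // [i|n S nN yS].
  rewrite (form_coord_change i sc sc' xo) /covd (covd_tensor hN sc sc' sg xo erefl) /=.
  by apply: eq_bigr => k _; rewrite -g1.
transitivity (\sum_(w <- WS n) S w * contract (jac c c' x)
    (fun v => covd nabla c' g v (transition c c' x)) w).
  apply: eq_big_seq => w; rewrite mem_words => /eqP wn; congr (_ * _).
  rewrite /covd (covd_tensor hN sc sc' sg xo erefl); apply: eq_contract => v vw.
  by rewrite vw.
rewrite contract_transpose; apply: gn => //.
exact: symmetric_contract.
Qed.

(** In the expansion of the derivative along b, the transfer symbols of each order form a symmetric
    S, so the orders from two on vanish and order one gives the left side. *)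
Lemma transfer_adapted N c x v g b : smooth_chart c -> cdom c x -> adapted N c x v g ->
  b \in NW N -> \sum_(i < d) v i * transfer nabla N c [:: i] b x = pds b (g \o cpar c) x.
Proof.
case: N => [|N] sc cx [sg g1 gn] bN.
  by move: bN; rewrite mem_newords_le => /andP[b0 /(leq_trans b0)].
have [_ yT _ ->] := transferP hN sc N.+1 => //.
(* Symmetry in the upper tuple is known up to length N + 1 only; extension by zero makes S symmetric
   on all words. *)
pose S a := if a \in NW N.+1 then transfer nabla N.+1 c a b x else 0.
have yS : symmetric_fun S.
  move=> a a' aa'; rewrite /S !mem_newords_le (perm_size aa').
  case: ifP => // aN; apply: yT => //.
  by rewrite mem_newords_le (perm_size aa').
transitivity (\sum_(a <- NW N.+1) S a * covd nabla c g a x); last first.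
  by apply: eq_big_seq => a aN; rewrite /S aN.
rewrite sum_newords_le.
rewrite big_ord_recl [X in _ = _ + X]big1 ?addr0; last first.
  by move=> k _; apply: gn => //; exact: ltn_ord.
rewrite sum_wordsS; apply: eq_bigr => i _; rewrite sum_words0 g1 mulrC /S.
by rewrite mem_newords_le.
Qed.

Lemma form_integrand_ito p c x g l : smooth_chart c -> cdom c x ->
  adapted (Num.truncn p) c x (fun i => form_coord f c i x) g ->
  form_integrand nabla (Num.truncn p) f c l x = ito_letter p (g \o cpar c) l x.
Proof.
move=> sc cx ag; rewrite /form_integrand /ito_letter big_seq_cond [RHS]big_seq_cond.
apply: eq_bigr => b /andP[bN _]; congr (_ * _).
exact: (transfer_adapted sc cx ag bN).
Qed.

(** The adapted g depends on x and enters at x alone; since x is arbitrary in the overlap, the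
    identity may be differentiated afterwards. *)
Lemma form_integrand_change (p : R) c c' l x : let N := Num.truncn p in
  smooth_chart c -> smooth_chart c' -> overlap c c' x -> (lwt l <= N)%N ->
  form_integrand nabla N f c l x = \sum_(k <- letters_le N)
    form_integrand nabla N f c' k (transition c c' x) *
      Phi (transition c c') (enum_mset (val k)) l x.
Proof.
move=> N sc sc' xo lN.
have cx' := transition_dom sc' xo; have oo := open_overlap sc sc'.
have [g ag'] := adapted_exists N (fun i => form_coord f c' i (transition c c' x)) sc' cx'.
have ag := adapted_change sc sc' xo ag'.
rewrite (form_integrand_ito l sc xo.1 ag).
under [RHS]eq_bigr do rewrite (form_integrand_ito _ sc' cx' ag').
have [sg _ _] := ag.
rewrite -(ito_letter_push oo (open_cdom sc') _ (smooth_transition sc sc')) //.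
- apply: eq_bigr => b _; congr (_ * _); apply: (pds_local b oo xo) => y yo /=.
  by rewrite (transition_par sc' yo).
- by move=> y yo; exact: transition_dom.
- exact: smooth_fun_chart.
Qed.

Lemma smooth_form_integrand N c l : smooth_chart c ->
  smooth_on (cdom c) (form_integrand nabla N f c l).
Proof.
move=> sc; have oc := open_cdom sc; have [sT _ _ _] := transferP hN sc N.
(* Transfer symbols are known to be smooth only for tuples within the bound, so membership of b is
   added as a predicate, as is 0 < N, which makes [:: i] admissible. *)
rewrite /form_integrand (_ : (fun x => _) = (fun x => \sum_(b <- NW N | (b \in NW N) && (seq_mset b == val l))
   (size b)`!%:R^-1 * (\sum_(i < d | (0 < N)%N) form_coord f c i x * transfer nabla N c [:: i] b x))).
  apply: (smooth_sum _ oc) => b /andP[bN _]; apply: (smoothZ _ oc).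
  apply: (smooth_sum _ oc) => i N0; apply: (smoothM oc); first exact: form_smooth.
  by apply: sT => //; rewrite mem_newords_le.
apply/funext => x; rewrite big_seq_cond; apply: eq_bigr => b /andP[+ _].
rewrite mem_newords_le => /andP[b0 bN]; congr (_ * _); apply: eq_bigl => i.
by rewrite (leq_trans b0 bN).
Qed.

End AdaptedFunctions.

(** * Integrals on the manifold *)

Section Restriction.
Context {R : realType}.
Variables (p : R) (omega : R -> R -> R) (a b a' b' : R).
Hypotheses (aa' : a <= a') (b'b : b' <= b).

Lemma simplexS s t : simplex a' b' (s, t) -> simplex a b (s, t).
Proof. by move=> [/= h1 h2 h3]; split => //=; [exact: le_trans h1|exact: le_trans b'b]. Qed.

Lemma branched_rp_restrict A (wt : A -> nat) (X : rpfam R A) :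
  branched_rp wt p omega a b X -> branched_rp wt p omega a' b' X.
Proof.
move=> [h1 h2 h3 h4 h5]; split.
- by move=> f g s t fN fg st; exact: h1 (simplexS st).
- move=> f fN; have [c [C HC]] := h2 f fN; split.
    by apply: continuous_subspaceW c => -[s t]; exact: simplexS.
  by exists C => s t st; exact: HC (simplexS st).
- by move=> s t st; exact: h3 (simplexS st).
- move=> f s u t fN s0 su ut t0; apply: h4 => //; first exact: le_trans s0.
  exact: le_trans b'b.
- by move=> f g s t fN st; exact: h5 (simplexS st).
Qed.

Lemma simple_brp_restrict d (X : srp R d) :
  simple_brp p omega a b X -> simple_brp p omega a' b' X.
Proof.
move=> [h1 h2 h3]; split.
- exact: branched_rp_restrict.
- by move=> i w g nu gnu wN s t st; exact: h2 (simplexS st).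
- by move=> i s t st; exact: h3 (simplexS st).
Qed.

Lemma is_pushforward_restrict d e (h : 'rV[R]_d -> 'rV[R]_e) X Y :
  is_pushforward h p omega a b X Y -> is_pushforward h p omega a' b' X Y.
Proof.
move=> [h1 h2 h3]; split.
- exact: branched_rp_restrict.
- by move=> f fN; have [C HC] := h2 f fN; exists C => s t st; exact: HC (simplexS st).
- move=> u /andP[u1 u2]; apply: h3; rewrite (le_trans aa' u1) /=; exact: le_trans b'b.
Qed.

Lemma integral_path_restrict d (X : srp R d) phi J :
  integral_path p omega a b X phi J -> integral_path p omega a' b' X phi J.
Proof. by move=> [C C0 HC]; exists C => // -[s t] st; exact: HC (simplexS st). Qed.

End Restriction.

Section IntegralPaths.
Context {R : realType} {d : nat}.
Variables (p T : R) (omega : R -> R -> R).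
Hypotheses (hp : 1 <= p) (comega : control T omega).
Variables (a b : R) (X : srp R d).
Hypotheses (a0 : 0 <= a) (bT : b <= T).
Local Notation x := (srp_trace X).
Local Notation N := (Num.truncn p).

Lemma simplex_left s t : simplex a b (s, t) -> a <= s <= b.
Proof. by move=> [/= s1 st t1]; rewrite s1 (le_trans st t1). Qed.

Lemma integral_path_incr phi J F : (forall s t, simplex a b (s, t) -> J t - J s = F t - F s) ->
  integral_path p omega a b X phi J -> integral_path p omega a b X phi F.
Proof. by move=> JF [C C0 HC]; exists C => // -[s t] st; rewrite /= -(JF s t st); exact: (HC (s, t) st). Qed.

Lemma integral_path_ext (U : set 'rV[R]_d) phi psi J : open U ->
  (forall u, a <= u <= b -> U (x u)) ->
  (forall c y, (lwt c <= N)%N -> U y -> phi c y = psi c y) ->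
  integral_path p omega a b X phi J -> integral_path p omega a b X psi J.
Proof.
move=> oU xU E [C C0 HC]; exists C => // -[s t] st.
have Us : U (x s) by exact: xU (simplex_left st).
suff E0 : riemann_term p X psi s t = riemann_term p X phi s t by rewrite /= E0; exact: (HC (s, t) st).
apply: eq_big_seq => c cN; apply: eq_bigr => w _; congr (_ * _ * _).
apply: (pds_local w oU Us) => y Uy; rewrite E //.
by rewrite mem_letters_le in cN.
Qed.

(** Without fine partitions [rough_integral] would be vacuous; they are what makes its value unique.
    [itv_partition] is strict, so a trivial interval gets the empty partition. *)
Lemma fine_partition (s t delta : R) : s <= t -> 0 < delta ->
  exists l, itv_partition s t l /\ all (fun uv => uv.2 - uv.1 < delta) (zip (s :: l) l).
Proof.
move=> st d0; have d2 : 0 < delta / 2 by rewrite divr_gt0.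
have [n] : exists n : nat, t - s <= n%:R * (delta / 2).
  exists (Num.bound ((t - s) / (delta / 2))); rewrite -ler_pdivrMr //.
  by apply/ltW/archi_boundP; rewrite divr_ge0 ?subr_ge0 // ltW.
elim: n s st => [|n IH] s st tn.
  exists [::]; split => //; split => //=.
  by rewrite eq_le st /= -subr_le0; move: tn; rewrite mul0r.
have [td|td] := ltP (t - s) delta.
  have [->|sneqt] := eqVneq s t; first by exists [::].
  by exists [:: t]; rewrite /itv_partition /= td eqxx lt_neqAle sneqt st.
have sut : s + delta / 2 <= t by lra.
have [|l [[lp ll] la]] := IH _ sut.
  by move: tn; rewrite -natr1 mulrDl mul1r; lra.
exists (s + delta / 2 :: l); split; first by split => //=; rewrite lp andbT ltrDl.
by rewrite /= la andbT; lra.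
Qed.

Lemma rough_integral_unique phi s t I I' : s <= t -> rough_integral p X phi s t I ->
  rough_integral p X phi s t I' -> I = I'.
Proof.
move=> st H H'; apply/eqP; rewrite -subr_eq0 -normr_le0; apply/ler_addgt0Pr => e e0.
have e2 : 0 < e / 2 by rewrite divr_gt0.
have [d1 d10 H1] := H _ e2; have [d2 d20 H2] := H' _ e2.
have [|l [lp la]] := fine_partition (delta := Num.min d1 d2) st.
  by rewrite lt_min d10.
have {}H1 := H1 l lp; have {}H2 := H2 l lp.
rewrite add0r.
have /H1 B1 : all (fun uv => uv.2 - uv.1 < d1) (zip (s :: l) l).
  by apply: sub_all la => uv; rewrite lt_min => /andP[].
have /H2 B2 : all (fun uv => uv.2 - uv.1 < d2) (zip (s :: l) l).
  by apply: sub_all la => uv; rewrite lt_min => /andP[].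
move: B1 B2; set S := \sum_(uv <- _) _ => B1 B2.
have -> : I - I' = (S - I') - (S - I) by ring.
by rewrite (le_trans (ler_normB _ _)) // [leRHS]splitr lerD // ltW.
Qed.

Lemma integral_path_unique phi J F s t : integral_path p omega a b X phi J ->
  integral_path p omega a b X phi F -> simplex a b (s, t) -> J t - J s = F t - F s.
Proof.
move=> iJ iF [/= s1 st t1]; apply: (rough_integral_unique (phi := phi) st).
- exact: (integral_path_rough hp comega a0 bT iJ).
- exact: (integral_path_rough hp comega a0 bT iF).
Qed.

Hypothesis sX : simple_brp p omega a b X.
Variables (U : set 'rV[R]_d).
Hypotheses (oU : open U) (xU : forall u, a <= u <= b -> U (x u)).

Lemma riemann_term_comb (I : Type) (r : seq I) (k : I -> R)
    (phi : I -> letter d -> 'rV[R]_d -> R) s t : (forall i c, smooth_on U (phi i c)) ->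
  simplex a b (s, t) ->
  riemann_term p X (fun c y => \sum_(i <- r) k i * phi i c y) s t =
  \sum_(i <- r) k i * riemann_term p X (phi i) s t.
Proof.
move=> sphi st.
have Us : U (x s) by exact: xU (simplex_left st).
rewrite (eq_bigr _ (fun i _ => mulr_sumr _ _ _ _)) exchange_big; apply: eq_bigr => c _ /=.
rewrite (eq_bigr _ (fun i _ => mulr_sumr _ _ _ _)) exchange_big; apply: eq_bigr => w _ /=.
rewrite (pds_sum _ _ oU _ Us); last by move=> i _; exact: (smoothZ _ oU (sphi i c)).
rewrite mulr_sumr mulr_suml; apply: eq_bigr => i _.
by rewrite (pdsZ _ _ oU (sphi i c) Us) [_ * (k i * _)]mulrCA -!mulrA.
Qed.

Lemma integral_path_comb (I : eqType) (r : seq I) (k : I -> R)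
    (phi : I -> letter d -> 'rV[R]_d -> R) (J : I -> R -> R) :
  (forall i c, smooth_on U (phi i c)) ->
  (forall i, i \in r -> integral_path p omega a b X (phi i) (J i)) ->
  integral_path p omega a b X (fun c y => \sum_(i <- r) k i * phi i c y)
    (fun t => \sum_(i <- r) k i * J i t).
Proof.
move=> sphi iJ.
have H := dominated_sum (fun i ir => dominatedZ (k i) (iJ i ir)) (fun _ _ => powR_ge0 _ _).
apply: dominated_ext H => -[s t] st; rewrite /= riemann_term_comb // -!sumrB.
by apply: eq_bigr => i _; rewrite -!mulrBr.
Qed.

End IntegralPaths.

(** Sewing gives a path J on all of [a, b]. By uniqueness on either side of u it has the increments
    of F there, and an interval across u is cut at u. *)
Lemma integral_path_cat {R : realType} {d : nat} (p T : R) (omega : R -> R -> R) (a u b : R)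
    (X : srp R d) (U : set 'rV[R]_d) phi F :
  1 <= p -> control T omega -> 0 <= a -> b <= T -> simple_brp p omega a b X ->
  open U -> (forall t, a <= t <= b -> U (srp_trace X t)) ->
  (forall c, smooth_on U (phi c)) -> a <= u -> u <= b ->
  integral_path p omega a u X phi F -> integral_path p omega u b X phi F ->
  integral_path p omega a b X phi F.
Proof.
move=> hp comega a0 bT sX oU xU sphi au ub F1 F2.
have [J iJ] := integral_path_exists hp comega a0 bT sX oU xU sphi.
have u0 := le_trans a0 au; have uT := le_trans ub bT.
have E1 s t := integral_path_unique (s := s) (t := t) hp comega a0 uT
  (integral_path_restrict (lexx a) ub iJ) F1.
have E2 s t := integral_path_unique (s := s) (t := t) hp comega u0 bT
  (integral_path_restrict au (lexx b) iJ) F2.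
apply: integral_path_incr iJ => s t [/= s1 st t1].
have [tu|ut] := leP t u; first by apply: E1.
have [us|su] := leP u s; first by apply: E2; split => //=; exact: ltW.
have := E1 s u; have := E2 u t => H2 H1.
have {}H2 : J t - J u = F t - F u by apply: H2; split => //=; exact: ltW.
have {}H1 : J u - J s = F u - F s by apply: H1; split => //=; exact: ltW.
by rewrite -(subrK (J u) (J t)) -addrA H1 H2 addrA subrK.
Qed.

(** * Local expressions and patchings *)

Section Patching.
Context {R : realType} {d : nat} {M : manifold R d}.
Variables (p T : R) (omega : R -> R -> R).
Hypotheses (hp : 1 <= p) (comega : control T omega).
Variable X : mrp M.
Hypothesis hX : is_mrp p T omega X.
Implicit Types c : chart R d M.
Local Notation N := (Num.truncn p).

Lemma local_expr_restrict c s t s' t' Y : s <= s' -> t' <= t ->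
  local_expr p omega X c s t Y -> local_expr p omega X c s' t' Y.
Proof.
move=> ss' t't [h1 h2 h3 h4]; split => //.
- exact: (simple_brp_restrict ss' t't h2).
- by move=> u /andP[u1 u2]; apply: h3; rewrite (le_trans ss' u1) (le_trans u2 t't).
- move=> i lo hi lohi.
  have lo1 : Num.max s (mrp_lo X i) <= lo by rewrite ge_max !le_max ss' lexx orbT.
  have hi1 : hi <= Num.min t (mrp_hi X i) by rewrite le_min !ge_min t't lexx orbT.
  apply: (is_pushforward_restrict lo1 hi1); apply: h4.
  exact: le_lt_trans lo1 (lt_le_trans lohi hi1).
Qed.

Lemma local_expr_member i a b : mrp_lo X i <= a -> b <= mrp_hi X i ->
  local_expr p omega X (mrp_chart X i) a b (mrp_rp X i).
Proof.
move=> ia bi; split.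
- exact: mrp_charts hX i.
- exact: (simple_brp_restrict ia bi (mrp_simple hX i)).
- move=> u /andP[u1 u2]; apply: (mrp_traceE hX).
  by rewrite (le_trans ia u1) (le_trans u2 bi).
- move=> j lo hi lohi.
  have lo1 : Num.max (mrp_lo X j) (mrp_lo X i) <= lo by rewrite ge_max !le_max lexx ia orbT.
  have hi1 : hi <= Num.min (mrp_hi X j) (mrp_hi X i) by rewrite le_min !ge_min lexx bi orbT.
  apply: (is_pushforward_restrict lo1 hi1); apply: (mrp_compatible hX).
  exact: le_lt_trans lo1 (lt_le_trans lohi hi1).
Qed.

(** Induction on a list containing the endpoints of the finite cover that lie inside (a, b); the
    interval is cut at each of them. *)
Lemma interval_ind (P : R -> R -> Prop) :
  (forall i a b, 0 <= a -> a <= b -> b <= T -> mrp_lo X i <= a -> b <= mrp_hi X i -> P a b) ->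
  (forall a u b, 0 <= a -> a <= u -> u <= b -> b <= T -> P a u -> P u b -> P a b) ->
  forall a b, 0 <= a -> a <= b -> b <= T -> P a b.
Proof.
move=> Pbase Pcat a b a0 ab bT; have [n [idx cov]] := mrp_cover hX.
suff H (E : seq R) : forall a b, 0 <= a -> a <= b -> b <= T ->
    (forall k, a < mrp_lo X (idx k) < b -> mrp_lo X (idx k) \in E) ->
    (forall k, a < mrp_hi X (idx k) < b -> mrp_hi X (idx k) \in E) -> P a b.
  apply: (H ([seq mrp_lo X (idx k) | k <- enum 'I_n] ++
             [seq mrp_hi X (idx k) | k <- enum 'I_n])) => // k _; rewrite mem_cat.
    by rewrite map_f ?mem_enum.
  by rewrite orbC map_f ?mem_enum.
elim: E => [|e E IH] {a0 ab bT}a {}b a0 ab bT Elo Ehi.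
  (* No endpoint lies inside (a, b), so the member of the cover that contains the midpoint contains
     [a, b]. The midpoint excludes members that merely touch an end. *)
  have [|k /andP[k1 k2]] := cov ((a + b) / 2); first by apply/andP; split; lra.
  have [abE|ab'] := eqVneq a b.
    apply: (Pbase (idx k)) => //; [move: k1|move: k2]; rewrite abE; lra.
  have {}ab' : a < b by rewrite lt_neqAle ab'.
  apply: (Pbase (idx k)) => //; rewrite leNgt; apply/negP => h.
    by have := Elo k; rewrite h /= in_nil => H; suff : false by []; apply: H; lra.
  by have := Ehi k; rewrite h andbT in_nil => H; suff : false by []; apply: H; lra.
have [/andP[ae eb]|eab] := boolP (a < e < b).
  have ae' := ltW ae; have eb' := ltW eb.
  apply: (Pcat a e b) => //.
    apply: IH => //; first exact: le_trans eb' bT.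
      move=> k /andP[k1 k2]; have := Elo k; rewrite k1 (lt_trans k2 eb) => /(_ isT).
      by rewrite inE lt_eqF.
    move=> k /andP[k1 k2]; have := Ehi k; rewrite k1 (lt_trans k2 eb) => /(_ isT).
    by rewrite inE lt_eqF.
  apply: IH => //; first exact: le_trans a0 ae'.
    move=> k /andP[k1 k2]; have := Elo k; rewrite k2 (lt_trans ae k1) => /(_ isT).
    by rewrite inE gt_eqF.
  move=> k /andP[k1 k2]; have := Ehi k; rewrite k2 (lt_trans ae k1) => /(_ isT).
  by rewrite inE gt_eqF.
apply: IH => // k kab; [have := Elo k kab|have := Ehi k kab]; rewrite inE => /orP[/eqP E1|//].
  by move: eab; rewrite -E1 kab.
by move: eab; rewrite -E1 kab.
Qed.

Lemma patching_exists s t : 0 <= s -> s <= t -> t <= T -> exists P, patching_of p omega X s t P.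
Proof.
move: s t; apply: interval_ind => [i a b a0 ab bT ia bi|a u b a0 au ub bT [P1 [p1 e1]] [P2 [p2 e2]]].
  (* Partitions are strictly increasing, so a trivial interval gets the empty one. *)
  have [->|neq] := eqVneq a b.
    by exists (Patching [::] (fun=> mrp_chart X i) (fun=> mrp_rp X i)).
  exists (Patching [:: b] (fun=> mrp_chart X i) (fun=> mrp_rp X i)).
  split; first by rewrite /itv_partition /= lt_neqAle neq ab eqxx.
  by case=> [|//] _ /=; exact: local_expr_member.
pose n1 := size (pt_pts P1).
exists (Patching (pt_pts P1 ++ pt_pts P2)
  (fun k => if (k < n1)%N then pt_chart P1 k else pt_chart P2 (k - n1))
  (fun k => if (k < n1)%N then pt_rp P1 k else pt_rp P2 (k - n1))); split => /=.
  case: p1 p2 => p1 /eqP l1 [p2 l2].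
  by split; rewrite ?cat_path ?last_cat l1 ?p1.
have l1 : last a (pt_pts P1) = u by case: p1 => _ /eqP.
move=> k; rewrite size_cat => kn; case: ifP => kn1.
  have := e1 k kn1; rewrite -cat_cons !nth_cat /= kn1.
  by rewrite (leqW kn1).
have {}kn1 : (n1 <= k)%N by rewrite leqNgt kn1.
have kn2 : (k - n1 < size (pt_pts P2))%N by rewrite ltn_subLR.
have := e2 _ kn2; rewrite -/n1; congr (local_expr _ _ _ _ _ _ _).
  (* For k = n1 the left endpoint is the last point of the first partition, which is u; later ones
     are points of the second. *)
  move: kn1; rewrite leq_eqVlt => /orP[/eqP <-|kn1].
    rewrite subnn -cat_cons nth_cat /= ltnS leqnn -[LHS]l1.
    exact/esym/(nth_last a (a :: pt_pts P1)).
  rewrite -cat_cons nth_cat /= ltnS leqNgt kn1 /= -[in LHS](subnSK kn1) /=.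
  by apply: set_nth_default; rewrite ltn_subLR // addSn ltnW.
by rewrite nth_cat ltnNge kn1 /=; apply: set_nth_default.
Qed.

Lemma path_bounds (s : R) l x : path <%R s l -> x \in s :: l -> s <= x <= last s l.
Proof.
elim: l s x => [|y l IH] s x /= => [_|/andP[sy yl]].
  by rewrite inE => /eqP ->; rewrite lexx.
have /andP[_ yt] := IH _ _ yl (mem_head _ _).
rewrite inE => /orP[/eqP ->|xl]; first by rewrite lexx (le_trans (ltW sy) yt).
by have /andP[yx ->] := IH _ _ yl xl; rewrite (le_trans (ltW sy) yx).
Qed.

Lemma sum_increments (F : R -> R) (x0 s : R) l :
  \sum_(k < size l) (F (nth x0 l k) - F (nth x0 (s :: l) k)) = F (last s l) - F s.
Proof.
elim: l s => [|y l IH] s; first by rewrite big_ord0 /= subrr.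
by rewrite big_ord_recl IH /= addrC addrA subrK.
Qed.

Lemma patched_of_path (loc : chart R d M -> srp R d -> R -> R -> R -> Prop) (F : R -> R) s t :
  0 <= s -> s <= t -> t <= T ->
  (forall c Y u v, local_expr p omega X c u v Y -> s <= u -> u <= v -> v <= t ->
     loc c Y u v (F v - F u)) ->
  patched_integral p omega X loc s t (F t - F s).
Proof.
move=> s0 st tT H; split; first exact: patching_exists.
move=> P [[pP /eqP lP] eP]; exists (fun k => F (nth s (pt_pts P) k) - F (nth s (s :: pt_pts P) k)).
have lt_path k : (k < size (pt_pts P))%N -> nth s (s :: pt_pts P) k < nth s (pt_pts P) k.
  by move: k; apply/(pathP s).
split.
  move=> k kP; apply: H; first exact: eP.
  - have [] := andP (path_bounds pP (mem_nth s (_ : k < size (s :: pt_pts P))%N)) => //.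
    exact: ltnW.
  - exact: ltW (lt_path k kP).
  - rewrite -lP; have [] := andP (path_bounds pP (_ : nth s (pt_pts P) k \in s :: pt_pts P)) => //.
    by rewrite inE mem_nth ?orbT.
by rewrite -[in RHS]lP -(sum_increments F s).
Qed.

End Patching.

(** * The integral of a one-form and the Ito formula *)

Section ManifoldIntegrals.
Context {R : realType} {d : nat} {M : manifold R d}.
Variables (p T : R) (omega : R -> R -> R).
Hypotheses (hp : 1 <= p) (comega : control T omega).
Variable X : mrp M.
Hypothesis hX : is_mrp p T omega X.
Variable nabla : M -> tvec M -> (M -> tvec M) -> tvec M.
Hypothesis hN : is_connection nabla.
Implicit Types c : chart R d M.
Local Notation N := (Num.truncn p).

Section Form.
Variable f : M -> tvec M -> R.
Hypothesis hf : is_one_form f.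
Local Notation phi c := (form_integrand nabla N f c).

(** One path for all charts at once: independence of the chart is built in, and independence of the
    partition becomes telescoping. *)
Definition is_form_path (F : R -> R) a b := forall c Y u v, local_expr p omega X c u v Y ->
  a <= u -> u <= v -> v <= b -> integral_path p omega u v Y (phi c) F.

(** The path is built in the chart of the i-th member and carried to any other chart by the
    pushforward that relates the local expressions. *)
Lemma form_path_member i a b : 0 <= a -> a <= b -> b <= T ->
  mrp_lo X i <= a -> b <= mrp_hi X i -> exists F, is_form_path F a b.
Proof.
move=> a0 ab bT ia bi.
have ei := local_expr_member hX ia bi.
have sci := local_chart ei; have oi := open_cdom sci.
have xi u : a <= u <= b -> cdom (mrp_chart X i) (srp_trace (mrp_rp X i) u).
  by move=> uab; exact: (local_trace ei uab).1.
have [F iF] := integral_path_exists hp comega a0 bT (local_simple ei) oi xi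
  (fun k => smooth_form_integrand hN hf N k sci).
exists F => c Y u v eY au uv vb.
have u0 := le_trans a0 au; have vT := le_trans vb bT.
have sc := local_chart eY.
have yc t : u <= t <= v -> cdom c (srp_trace Y t) by move=> /(local_trace eY)[].
(* Local expressions are related by pushforward on nondegenerate intervals only; over a point all
   increments vanish, and any path will do. *)
have [uE|neq] := eqVneq u v.
  have [J] := integral_path_exists hp comega u0 vT (local_simple eY) (open_cdom sc) yc
    (fun k => smooth_form_integrand hN hf N k sc).
  apply: integral_path_incr => s t [/= us st tv].
  have sE : s = u by apply/eqP; rewrite eq_le us andbT uE (le_trans st tv).
  have tE : t = u by apply/eqP; rewrite eq_le (le_trans us st) andbT uE tv.
  by rewrite sE tE !subrr.
have {neq}uv' : u < v by rewrite lt_neqAle neq.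
have ei' := local_expr_restrict au vb ei.
have iF' := integral_path_restrict au vb iF.
have push : is_pushforward (transition (mrp_chart X i) c) p omega u v (mrp_rp X i) Y.
  have := local_compatible eY (i := i).
  rewrite (max_l (le_trans ia au)) (min_l (le_trans vb bi)); exact.
have oo := open_overlap sci sc.
have xo t : u <= t <= v -> overlap (mrp_chart X i) c (srp_trace (mrp_rp X i) t).
  move=> uv1; have [h1 h2] := local_trace ei' uv1; split => //.
  rewrite /preimage /= h2; have [h3 <-] := local_trace eY uv1; exact: cim_par.
apply: (integral_path_pushforward oo (open_cdom sc) _ (smooth_transition sci sc) hp
  (local_simple ei') xo push (fun k => smooth_form_integrand hN hf N k sc)).
  by move=> y yo; exact: transition_dom.
apply: (integral_path_ext oo xo _ iF') => l y lN yo.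
exact: (form_integrand_change hN hf sci sc yo lN).
Qed.

Lemma form_path_exists a b : 0 <= a -> a <= b -> b <= T -> exists F, is_form_path F a b.
Proof.
move: a b; apply: (interval_ind hX) => [i a b|a w b a0 aw wb bT [F HF] [G HG]].
  exact: form_path_member.
(* G is shifted to agree with F at w, which leaves its increments unchanged. *)
pose H t := if t <= w then F t else F w + (G t - G w).
have HF' c Y u v : local_expr p omega X c u v Y -> a <= u -> u <= v -> v <= w ->
    integral_path p omega u v Y (phi c) H.
  move=> eY au uv vw; apply: integral_path_incr (HF c Y u v eY au uv vw) => s t [/= us st tv].
  by rewrite /H (le_trans tv vw) (le_trans st (le_trans tv vw)).
have HG' c Y u v : local_expr p omega X c u v Y -> w <= u -> u <= v -> v <= b ->
    integral_path p omega u v Y (phi c) H.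
  move=> eY wu uv vb; apply: integral_path_incr (HG c Y u v eY wu uv vb) => s t [/= us st tv].
  have HE r : w <= r -> H r = F w + (G r - G w).
    rewrite le_eqVlt => /orP[/eqP <-|wr]; first by rewrite /H lexx subrr addr0.
    by rewrite /H leNgt wr.
  rewrite !HE; [by ring|exact: le_trans us|exact: le_trans (le_trans us st)].
exists H => c Y u v eY au uv vb.
have [vw|wv] := leP v w; first exact: HF'.
have [wu|uw] := leP w u; first exact: HG'.
have sc := local_chart eY.
apply: (integral_path_cat hp comega (le_trans a0 au) (le_trans vb bT) (local_simple eY)
  (open_cdom sc) _ (fun k => smooth_form_integrand hN hf N k sc) (ltW uw) (ltW wv)).
- by move=> t /(local_trace eY)[].
- by apply: HF' (ltW uw) _ => //; exact: local_expr_restrict (ltW wv) eY.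
- by apply: HG' (ltW wv) _ => //; exact: local_expr_restrict (ltW uw) _ eY.
Qed.

Lemma form_path_integral F a b c Y u v : 0 <= a -> b <= T -> is_form_path F a b ->
  local_expr p omega X c u v Y -> a <= u -> u <= v -> v <= b ->
  form_integral nabla p f c Y u v (F v - F u).
Proof.
move=> a0 bT HF eY au uv vb.
exact: (integral_path_rough hp comega (le_trans a0 au) (le_trans vb bT)
  (HF c Y u v eY au uv vb) (lexx u) (lexx v)).
Qed.

End Form.

Lemma smooth_ito_integrand g c gam l : smooth_chart c -> smooth_fun setT g ->
  gam \in newords_le (enum 'I_d) N -> smooth_on (cdom c) (ito_integrand nabla N g c gam l).
Proof.
move=> sc sg gamN; have oc := open_cdom sc; have [sT _ _ _] := transferP hN sc N.
apply: (smoothM oc); first exact: (smooth_covd_rec hN _ _ sc sg).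
rewrite (_ : (fun x => _) = (fun x => \sum_(b <- newords_le (enum 'I_d) N |
    (b \in newords_le (enum 'I_d) N) && (seq_mset b == val l))
   ((size gam)`!%:R / (size b)`!%:R) * transfer nabla N c gam b x)).
  by apply: (smooth_sum _ oc) => b /andP[bN _]; apply: (smoothZ _ oc); exact: sT.
by apply/funext => x; rewrite big_seq_cond.
Qed.

(** The factorials of |gamma| cancel, and the remaining sum over gamma is the defining property of
    the transfer symbols. *)
Lemma sum_ito_integrand g c l x : smooth_chart c -> smooth_fun setT g -> cdom c x ->
  \sum_(gam <- newords_le (enum 'I_d) N) (size gam)`!%:R^-1 * ito_integrand nabla N g c gam l x =
  ito_letter p (g \o cpar c) l x.
Proof.
move=> sc sg cx; have [_ _ _ HT] := transferP hN sc N.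
under eq_bigr do rewrite /ito_integrand !mulr_sumr.
rewrite exchange_big /ito_letter big_seq_cond [RHS]big_seq_cond.
apply: eq_bigr => b /andP[bN _] /=; rewrite HT // mulr_sumr; apply: eq_bigr => gam _.
have f0 : (size gam)`!%:R != 0 :> R by rewrite pnatr_eq0 -lt0n fact_gt0.
rewrite [RHS](_ : _ = covd nabla c g gam x * ((size b)`!%:R^-1 * transfer nabla N c gam b x)).
  by rewrite mulrCA -[_ / _ * _]mulrA mulKf.
by rewrite [RHS]mulrCA; congr (_ * _); exact: mulrC.
Qed.

(** The weighted sum of the paths for the single gamma and the path g(X) belong to the same
    integrand, hence have equal increments. *)
Lemma ito_local g c Y u v : smooth_fun setT g -> local_expr p omega X c u v Y ->
  0 <= u -> u <= v -> v <= T ->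
  ito_integral nabla p g c Y u v (g (mrp_trace X v) - g (mrp_trace X u)).
Proof.
move=> sg eY u0 uv vT; have sc := local_chart eY; have oc := open_cdom sc.
have yc t : u <= t <= v -> cdom c (srp_trace Y t) by move=> /(local_trace eY)[].
(* The combination lemma asks for smoothness for every word, so the integrand is set to 0 for words
   outside the range of the sum. *)
pose phi gam := if gam \in newords_le (enum 'I_d) N then ito_integrand nabla N g c gam
  else fun _ _ => 0.
have sphi gam l : smooth_on (cdom c) (phi gam l).
  rewrite /phi; case: ifP => gN; last exact: (smooth_cst 0).
  exact: smooth_ito_integrand.
have /choice[J iJ] (gam : seq 'I_d) : exists J, integral_path p omega u v Y (phi gam) J.
  exact: (integral_path_exists hp comega u0 vT (local_simple eY) oc yc (sphi gam)).
exists (fun gam => J gam v - J gam u); split.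
  move=> gam gN; have := integral_path_rough hp comega u0 vT (iJ gam) (lexx u) (lexx v).
  by rewrite /phi gN.
have iS := integral_path_comb (r := newords_le (enum 'I_d) N)
  oc yc (fun gam => (size gam)`!%:R^-1) sphi (fun gam _ => iJ gam).
have iS' : integral_path p omega u v Y (ito_letter p (g \o cpar c))
    (fun t => \sum_(gam <- newords_le (enum 'I_d) N) (size gam)`!%:R^-1 * J gam t).
  apply: (integral_path_ext oc yc _ iS) => l y _ cy.
  rewrite -(sum_ito_integrand l sc sg cy); apply: eq_big_seq => gam gN.
  by rewrite /phi gN.
have iG := ito_formula hp (local_simple eY) oc yc (smooth_fun_chart sc sg).
have uv' : simplex u v (u, v) by split => //=; exact: lexx.
have := integral_path_unique hp comega u0 vT iS' iG uv'.
rewrite -sumrB => E; under eq_bigr do rewrite mulrBr.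
rewrite E /=; congr (g _ - g _).
  by have [|_ ->] := local_trace eY (u := v); rewrite ?lexx ?uv.
by have [|_ ->] := local_trace eY (u := u); rewrite ?lexx ?uv.
Qed.

End ManifoldIntegrals.

Theorem theorem4p3 (R : realType) (p T : R) (omega : R -> R -> R) (d : nat)
    (M : manifold R d) (nabla : M -> tvec M -> (M -> tvec M) -> tvec M)
    (X : mrp M) (f : M -> tvec M -> R)
    (hp : 1 <= p) (hT : 0 <= T) (homega : control T omega)
    (hnabla : is_connection nabla) (hX : is_mrp p T omega X)
    (hf : is_one_form f) :
  [/\ (forall s t, 0 <= s -> s <= t -> t <= T ->
         forall (c1 c2 : chart R d M) (Y1 Y2 : srp R d),
           local_expr p omega X c1 s t Y1 -> local_expr p omega X c2 s t Y2 ->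
           exists I, form_integral nabla p f c1 Y1 s t I /\
                     form_integral nabla p f c2 Y2 s t I),
      (forall s t, 0 <= s -> s <= t -> t <= T ->
         exists I, patched_integral p omega X (form_integral nabla p f) s t I) &
      (forall g : M -> R, smooth_fun setT g ->
         forall s t, 0 <= s -> s <= t -> t <= T ->
         patched_integral p omega X (ito_integral nabla p g) s t
           (g (mrp_trace X t) - g (mrp_trace X s)))].
Proof.
split.
- move=> s t s0 st tT c1 c2 Y1 Y2 e1 e2.
  have [F HF] := form_path_exists hp homega hX hnabla hf s0 st tT.
  exists (F t - F s); split.
    exact: (form_path_integral hp homega s0 tT HF e1 (lexx s) st (lexx t)).
  exact: (form_path_integral hp homega s0 tT HF e2 (lexx s) st (lexx t)).
- move=> s t s0 st tT.
  have [F HF] := form_path_exists hp homega hX hnabla hf s0 st tT.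
  exists (F t - F s); apply: (patched_of_path hX s0 st tT) => c Y u v eY su uv vt.
  exact: (form_path_integral hp homega s0 tT HF eY su uv vt).
- move=> g sg s t s0 st tT.
  apply: (patched_of_path hX (F := fun t => g (mrp_trace X t)) s0 st tT) => c Y u v eY su uv vt.
  exact: (ito_local hp homega hnabla sg eY (le_trans s0 su) uv (le_trans vt tT)).
Qed.
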